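(* Let $d\ge 2$ and let $\mu$ be a non-degenerate probability measure with finite first moment on the free group $\mathbf{F}_d$. Suppose $\Gamma$ is a proper quotient of $\mathbf{F}_d$. Then for any $\epsilon>0$ there exists a quotient group $\tilde\Gamma$ of $\mathbf{F}_d$ such that $\mathbf{F}_d\twoheadrightarrow\tilde\Gamma\twoheadrightarrow\Gamma$ and $$h(\Gamma,\mu)<h(\tilde\Gamma,\mu)<h(\Gamma,\mu)+\epsilon .$$ In particular, the set $\mathfrak{H}(\mathbf{F}_d,\mu)=\{h(\Gamma,\mu):\ \Gamma \text{ is a quotient group of }\mathbf{F}_d\}\subset\mathbb{R}$ has no isolated points, except perhaps its maximum.
   Context: $\mathbf{F}_d$ is the free group of rank $d$ with free generating tuple $\mathbf{S}$. A probability measure $\mu$ on a countable group $G$ is non-degenerate if its support generates $G$ as a semigroup. For $G$ finitely generated by $S$, $\mu$ has finite first moment if $\sum_{g\in G}|g|_S\,\mu(g)<\infty$, where $|\cdot|_S$ is word length with respect to $S$. A quotient of $\mathbf{F}_d$ is a group $\Gamma=\mathbf{F}_d/N$ with $N$ a normal subgroup, together with the quotient map; it is proper if $N\neq\{id\}$. The notation $\mathbf{F}_d\twoheadrightarrow\tilde\Gamma\twoheadrightarrow\Gamma$ means that the quotient map $\mathbf{F}_d\to\Gamma$ factors through the quotient map $\mathbf{F}_d\to\tilde\Gamma$ (i.e. $\ker(\mathbf{F}_d\to\tilde\Gamma)\subseteq\ker(\mathbf{F}_d\to\Gamma)$). For a probability measure $\mu$ on a group $G$, the (Avez) asymptotic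 entropy is $h(G,\mu)=\lim_{n\to\infty}\frac1n H(\mu^{(n)})$, where $\mu^{(n)}$ is the $n$-fold convolution power (the law of the $\mu$-random walk at time $n$) and $H$ is Shannon entropy. For a quotient $\Gamma$ of $\mathbf{F}_d$, $h(\Gamma,\mu)$ denotes the asymptotic entropy of the pushforward of $\mu$ to $\Gamma$ under the quotient map. *)

(* Defs.v *)
From HB Require Import structures.
From mathcomp Require Import all_boot all_order all_algebra.
From mathcomp Require Import all_classical all_reals all_analysis.

Set Implicit Arguments.
Unset Strict Implicit.
Unset Printing Implicit Defensive.

Import Order.TTheory GRing.Theory Num.Theory.
Import numFieldNormedType.Exports.

Local Open Scope classical_set_scope.
Local Open Scope ring_scope.

(* The letter [(i, false)] is the i-th free generator, [(i, true)] its inverse;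
   elements of the free group are reduced words in these letters. *)
Notation letter d := ('I_d * bool)%type.

Section ReducedWords.
Variable d : nat.
Implicit Types (a b : letter d) (u v w : seq (letter d)).

Definition inv_letter a : letter d := (a.1, ~~ a.2).

Definition reduced w : bool := sorted (fun a b => b != inv_letter a) w.

Definition cons_red a w : seq (letter d) :=
  if w is b :: w' then if b == inv_letter a then w' else a :: w else [:: a].

Definition mul_word u v : seq (letter d) := foldr cons_red v u.

Definition inv_word u : seq (letter d) := rev (map inv_letter u).

Lemma inv_letterK : involutive inv_letter.
Proof. by case=> i b; rewrite /inv_letter /= negbK. Qed.

Lemma cons_red_cons a w : reduced (a :: w) -> cons_red a w = a :: w.
Proof. by case: w => //= b w /andP[/negbTE ->]. Qed.

Lemma reduced_tail a w : reduced (a :: w) -> reduced w.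
Proof. by case: w => //= b w /andP[]. Qed.

Lemma reduced_cons_red a w : reduced w -> reduced (cons_red a w).
Proof.
case: w => [//|b w] rw /=; case: eqVneq => [_|ne]; first exact: reduced_tail rw.
by rewrite /reduced /= ne.
Qed.

Lemma cons_redK a w : reduced w -> cons_red (inv_letter a) (cons_red a w) = w.
Proof.
case: w => [|b w] rw /=; first by rewrite inv_letterK eqxx.
case: eqVneq => [eb|_] /=; last by rewrite inv_letterK eqxx.
by rewrite -eb; apply: cons_red_cons.
Qed.

Lemma reduced_mul u v : reduced v -> reduced (mul_word u v).
Proof. by move=> rv; elim: u => //= a u IH; apply: reduced_cons_red. Qed.

Lemma mul_cons_red a u v : reduced v ->
  mul_word (cons_red a u) v = cons_red a (mul_word u v).
Proof.
case: u => [//|b u] rv /=; case: eqVneq => [->|//].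
by rewrite -{1}(inv_letterK a) cons_redK // reduced_mul.
Qed.

Lemma mul_wordA u v w : reduced w ->
  mul_word u (mul_word v w) = mul_word (mul_word u v) w.
Proof. by move=> rw; elim: u => //= a u ->; rewrite mul_cons_red. Qed.

Lemma mul_word_nil u : reduced u -> mul_word u [::] = u.
Proof.
elim: u => //= a u IH ru; rewrite IH ?cons_red_cons //.
exact: reduced_tail ru.
Qed.

Lemma inv_wordK : involutive inv_word.
Proof.
by move=> u; rewrite /inv_word map_rev revK -map_comp map_id_in // => a _;
  apply: inv_letterK.
Qed.

Lemma reduced_inv u : reduced u -> reduced (inv_word u).
Proof.
rewrite /reduced /inv_word rev_sorted sorted_map; apply: sub_sorted => a b /=.
by apply: contra => /eqP/(can_inj inv_letterK) ->; rewrite inv_letterK.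
Qed.

Lemma mul_invw u : reduced u -> mul_word (inv_word u) u = [::].
Proof.
elim: u => // a u IH ru; rewrite /mul_word /inv_word /= rev_cons foldr_rcons /=.
by rewrite inv_letterK eqxx; apply: IH; apply: reduced_tail ru.
Qed.

End ReducedWords.

Record free_group (d : nat) := FreeGroup {
  word_of : seq (letter d);
  word_ofP : reduced word_of }.

HB.instance Definition _ d := [isSub for @word_of d].
HB.instance Definition _ d := [Countable of free_group d by <:].

Section FreeGroupStructure.
Variable d : nat.
Implicit Types x y z : free_group d.

Definition fg_one : free_group d := @FreeGroup d [::] isT.
Definition fg_mul x y := FreeGroup (reduced_mul (word_of x) (word_ofP y)).
Definition fg_inv x := FreeGroup (reduced_inv (word_ofP x)).

Lemma fg_mulA : associative fg_mul.
Proof. by move=> x y z; apply: val_inj; apply: mul_wordA; apply: word_ofP. Qed.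

Lemma fg_mul1g : left_id fg_one fg_mul.
Proof. by move=> x; apply: val_inj. Qed.

Lemma fg_mulg1 : right_id fg_one fg_mul.
Proof. by move=> x; apply: val_inj; apply: mul_word_nil; apply: word_ofP. Qed.

Lemma fg_mulVg : left_inverse fg_one fg_inv fg_mul.
Proof. by move=> x; apply: val_inj; apply: mul_invw; apply: word_ofP. Qed.

Lemma fg_mulgV : right_inverse fg_one fg_inv fg_mul.
Proof.
move=> x; apply: val_inj => /=; rewrite -{1}(inv_wordK (word_of x)).
by apply: mul_invw; apply: reduced_inv; apply: word_ofP.
Qed.

HB.instance Definition _ := isGroup.Build (free_group d)
  fg_mulA fg_mul1g fg_mulg1 fg_mulVg fg_mulgV.

Definition fg_gen (i : 'I_d) : free_group d := @FreeGroup d [:: (i, false)] isT.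

End FreeGroupStructure.

Record normal_subgroup (G : groupType) := NormalSubgroup {
  ns_set :> set G;
  ns_one : ns_set 1%g;
  ns_mul : forall x y, ns_set x -> ns_set y -> ns_set (x * y)%g;
  ns_inv : forall x, ns_set x -> ns_set x^-1%g;
  ns_conj : forall x y, ns_set x -> ns_set (x ^ y)%g }.

Section QuotientGroup.
Variables (G : groupType) (N : normal_subgroup G).
Implicit Types x y : G.

Definition same_coset x y : bool := `[< ns_set N (x^-1 * y)%g >].

Lemma same_coset_refl : reflexive same_coset.
Proof. by move=> x; apply/asboolP; rewrite mulVg; apply: ns_one. Qed.

Lemma same_coset_sym : symmetric same_coset.
Proof.
suff H x y : same_coset x y -> same_coset y x.
  by move=> x y; apply/idP/idP => /H.
by move=> /asboolP /ns_inv; rewrite invgM invgK => ?; apply/asboolP.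
Qed.

Lemma same_coset_trans : transitive same_coset.
Proof.
move=> y x z /asboolP Nxy /asboolP Nyz; apply/asboolP.
by have := ns_mul Nxy Nyz; rewrite mulgA mulgK.
Qed.

Canonical same_coset_equiv :=
  EquivRel same_coset same_coset_refl same_coset_sym same_coset_trans.

Definition quot_group : Type := {eq_quot same_coset}%qT.

HB.instance Definition _ := Choice.on quot_group.

Definition quotient_map (x : G) : quot_group :=
  (\pi_({eq_quot same_coset}) x)%qT.

Definition quotient_repr (c : quot_group) : G :=
  repr (c : {eq_quot same_coset}%qT).

Lemma quotient_reprK : cancel quotient_repr quotient_map.
Proof. by move=> c; apply: reprK. Qed.

Lemma quotient_mapP x y :
  quotient_map x = quotient_map y <-> ns_set N (x^-1 * y)%g.
Proof.
split=> [/eqmodP/asboolP // | Nxy]; apply/eqmodP; exact/asboolP.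
Qed.

Definition quo_one : quot_group := quotient_map 1%g.
Definition quo_mul (c e : quot_group) : quot_group :=
  quotient_map (quotient_repr c * quotient_repr e)%g.
Definition quo_inv (c : quot_group) : quot_group :=
  quotient_map (quotient_repr c)^-1%g.

Lemma quotient_mapM x y :
  quotient_map (x * y)%g = quo_mul (quotient_map x) (quotient_map y).
Proof.
apply/quotient_mapP.
set x' := quotient_repr _; set y' := quotient_repr _.
have Nx : ns_set N (x^-1 * x')%g by apply/quotient_mapP; rewrite quotient_reprK.
have Ny : ns_set N (y^-1 * y')%g by apply/quotient_mapP; rewrite quotient_reprK.
have := ns_mul (ns_conj y Nx) Ny; rewrite /conjg invgM !mulgA.
by rewrite mulgK.
Qed.

Lemma quotient_mapV x : quotient_map x^-1%g = quo_inv (quotient_map x).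
Proof.
apply/quotient_mapP; set x' := quotient_repr _.
have Nx : ns_set N (x'^-1 * x)%g by apply/quotient_mapP; rewrite quotient_reprK.
by have := ns_conj x^-1%g Nx; rewrite /conjg !mulgA mulgK.
Qed.

Lemma quo_mulA : associative quo_mul.
Proof.
move=> a b c; rewrite -[a]quotient_reprK -[b]quotient_reprK -[c]quotient_reprK.
by rewrite -!quotient_mapM mulgA.
Qed.

Lemma quo_mul1g : left_id quo_one quo_mul.
Proof.
by move=> c; rewrite -[c]quotient_reprK -quotient_mapM mul1g.
Qed.

Lemma quo_mulg1 : right_id quo_one quo_mul.
Proof.
by move=> c; rewrite -[c]quotient_reprK -quotient_mapM mulg1.
Qed.

Lemma quo_mulVg : left_inverse quo_one quo_inv quo_mul.
Proof.
by move=> c; rewrite -[c]quotient_reprK -quotient_mapV -quotient_mapM mulVg.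
Qed.

Lemma quo_mulgV : right_inverse quo_one quo_inv quo_mul.
Proof.
by move=> c; rewrite -[c]quotient_reprK -quotient_mapV -quotient_mapM mulgV.
Qed.

HB.instance Definition _ := isGroup.Build quot_group
  quo_mulA quo_mul1g quo_mulg1 quo_mulVg quo_mulgV.

HB.instance Definition _ :=
  isMultiplicative.Build G quot_group quotient_map quotient_mapM.

End QuotientGroup.

Definition proper_quotient (G : groupType) (N : normal_subgroup G) : Prop :=
  N <> [set 1%g] :> set G.

(* G ->> G/M ->> G/N *)
Definition factors_through (G : groupType) (M N : normal_subgroup G) : Prop :=
  exists f : {multiplicative quot_group M -> quot_group N},
    forall x : G, f (quotient_map M x) = quotient_map N x.

(* Probability measures on a countable group are given by their mass functions.
   Sums of nonnegative families are taken in \bar R with \esum; [fine] is only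
   applied to sums of masses, which are at most 1. *)
Section MassFunctions.
Variable R : realType.

Definition probability_mass (T : choiceType) (p : T -> R) : Prop :=
  (forall x, 0 <= p x) /\ \esum_(x in [set: T]) (p x)%:E = 1%E.

Definition mass_support (T : choiceType) (p : T -> R) : set T :=
  [set x | 0 < p x].

Definition pushforward_mass (T U : choiceType) (f : T -> U) (p : T -> R)
    : U -> R :=
  fun y => fine (\esum_(x in f @^-1` [set y]) (p x)%:E).

Definition shannon_entropy (T : choiceType) (p : T -> R) : \bar R :=
  \esum_(x in [set: T]) (- (p x * ln (p x)))%:E.

Section OnGroup.
Variable G : groupType.
Implicit Types p q : G -> R.

Definition mul_closed (A : set G) : Prop :=
  forall x y, A x -> A y -> A (x * y)%g.

Definition nondegenerate_mass p : Prop :=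
  smallest mul_closed (mass_support p) = [set: G].

(* +oo when g does not lie in the subgroup generated by S *)
Definition word_length (S : set G) (g : G) : \bar R :=
  ereal_inf [set (size s)%:R%:E | s in
    [set s : seq G | (forall x, x \in s -> S x \/ S x^-1%g)
                     /\ (\prod_(x <- s) x)%g = g]].

Definition finite_first_moment (S : set G) p : Prop :=
  (\esum_(g in [set: G]) (word_length S g * (p g)%:E) < +oo)%E.

Definition convolution p q : G -> R :=
  fun g => fine (\esum_(h in [set: G]) (p h * q (h^-1 * g)%g)%:E).

Definition convolution_power p (n : nat) : G -> R :=
  iter n (convolution p) (fun g => (g == 1%g)%:R).

Definition asymptotic_entropy p : \bar R :=
  limn (fun n => ((n%:R^-1)%:E * shannon_entropy (convolution_power p n))%E).

End OnGroup.

Definition quotient_entropy (G : groupType) (p : G -> R)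
    (N : normal_subgroup G) : \bar R :=
  asymptotic_entropy (pushforward_mass (quotient_map N) p).

Definition entropy_spectrum (G : groupType) (p : G -> R) : set R :=
  [set fine (quotient_entropy p N) | N in [set: normal_subgroup G]].

End MassFunctions.

(* Main.v *)
Require Import Defs.
From HB Require Import structures.
From mathcomp Require Import all_boot all_order all_algebra.
From mathcomp Require Import all_classical all_reals all_analysis.
From mathcomp Require Import ring lra zify.
From mathcomp Require Import perm.

Set Implicit Arguments.
Unset Strict Implicit.
Unset Printing Implicit Defensive.

Import Order.TTheory GRing.Theory Num.Theory.
Import numFieldNormedType.Exports.

Local Open Scope classical_set_scope.
Local Open Scope ring_scope.

(** Above [F / N] the quotients with slightly more entropy are found among the
[F / (N :&: K)], where [K] is the kernel of an action of the free group [F] for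
which [F / K] has small entropy.  Entropy is subadditive for joint observations,
so [h (F / (N :&: K)) <= h (F / N) + h (F / K)] ([quotient_entropy_cap]), and it
remains to find [K] of entropy less than [eps] that makes the entropy strictly
larger than [h (F / N)].

Small entropy.  Let the first generator act on the integers by [x |-> - x] and
the other ones by [x |-> 1 - x].  Through this infinite dihedral action the walk
has zero speed, because it is centred by the reflections and has a finite first
moment ([mean_drift_sublinear]).  Let moreover the letters that are read at
distance less than [c] from the origin act by permutations of a finite set.  An
element of the resulting lamplighter-like quotient is coded by a word whose
length is about twice the range of the slow walk, so the entropy of that
quotient is zero ([lamplighter_entropy]).  The action used for [K] lives on
[T * 'Z_(2 * q)] for some forest [T]; around each of its points it looks like the
previous one, so its kernel contains any given element of the lamplighter kernel
once [q] is large ([lamp_kernel_sub]).  Since the entropy at a fixed time is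
upper semicontinuous in the kernel ([qlaw_entropy_usc]), the entropy of [F / K]
is less than [eps] for large [q].

Strict increase.  The circle ['Z_(2 * q)] has two fixed points of the first
reflection, [0] and [q].  Near each of them the letters act on [T] by permutations
coming from a finite quotient of [F] that separates a large ball, and the two
actions are combined as in a free product ([tree_act]).  Now two elements of [N]
are enough to make the action expanding: finitely many group elements
suffice to move all the points injectively, in two ways with disjoint images
([branch_doubling]).  Hence the walk contracts the l2 norm
([walk_operator_contract]), and for a set [E] with finite boundary the hitting
probabilities of [E] at time [n] differ from the indicator of [E] by a function
whose l2 norm is bounded independently of [n] ([defect_bounded]).  There are
such a set [E], a point [x0] and some [l] in [N] for which the points
[x0 * l ^ n] are in [E] for [n > 0] and outside [E] for [n < 0].

If [N :&: K] had the same entropy as [N], the conditional entropy of the position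
modulo [N :&: K] given the position modulo [N] would grow sublinearly.  At some
time its increment is small, and by the chain rule for relative entropy the walks
started from finitely many given elements of [N] are then close to each other
modulo [N :&: K] ([translates_close]).  So the probability of hitting [E] is almost
the same from [x0 * l ^ n] and from [x0 * l ^ (- n)], whereas it is near 1 from
most of the former and near 0 from most of the latter.  This is the contradiction
of [entropy_gap].

As for isolated points, a proper quotient has nearby values of entropy by what
precedes, and the free group itself has the largest entropy of all its quotients. *)

(** * Sums of nonnegative families *)

Notation "\tsum_ x F" := (esum setT (fun x => F%E))
  (at level 41, x name, F at level 41, format "\tsum_ x  F") : ereal_scope.

Section TotalSums.
Variable R : realType.
Implicit Types T U : choiceType.
Local Open Scope ereal_scope.

Lemma tsum_ge0 T (f : T -> \bar R) : (forall x, 0 <= f x) -> 0 <= \tsum_x f x.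
Proof. by move=> f0; apply: esum_ge0. Qed.

Lemma eq_tsum T (f g : T -> \bar R) : f =1 g -> \tsum_x f x = \tsum_x g x.
Proof. by move=> fg; apply: eq_esum => x _; apply: fg. Qed.

Lemma le_tsum T (f g : T -> \bar R) :
  (forall x, f x <= g x) -> \tsum_x f x <= \tsum_x g x.
Proof. by move=> fg; apply: le_esum => x _; apply: fg. Qed.

Lemma tsumD T (f g : T -> \bar R) :
  (forall x, 0 <= f x) -> (forall x, 0 <= g x) ->
  \tsum_x (f x + g x) = \tsum_x f x + \tsum_x g x.
Proof. by move=> f0 g0; apply: esumD. Qed.

Lemma tsum0 T (f : T -> \bar R) : (forall x, f x = 0) -> \tsum_x f x = 0.
Proof. by move=> f0; apply: esum1. Qed.

Lemma exchange_tsum T U (f : T -> U -> \bar R) : (forall x y, 0 <= f x y) ->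
  \tsum_x \tsum_y f x y = \tsum_y \tsum_x f x y.
Proof.
move=> f0; rewrite !esum_esum //.
rewrite (reindex_esum (setT `*`` (fun _ => setT)) _ (fun k : U * T => (k.2, k.1))) //.
split=> //; first by move=> [y x] [y' x'] _ _ /= [-> ->].
by move=> [x y] _; exists (y, x).
Qed.

Lemma tsum_pair T U (f : T * U -> \bar R) : (forall x, 0 <= f x) ->
  \tsum_x f x = \tsum_x \tsum_y f (x, y).
Proof.
move=> f0; rewrite [RHS]esum_esum //.
have -> : ([set: T] `*`` fun=> [set: U]) = setT by apply/seteqP; split.
by apply: eq_esum => -[].
Qed.

Lemma tsum_only T (f : T -> \bar R) (a : T) : 0 <= f a ->
  (forall x, x != a -> f x = 0) -> \tsum_x f x = f a.
Proof.
move=> f0 fa; rewrite -[RHS](esum_set1 (a := f) (t := a)) // [RHS]esum_mkcond.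
apply: eq_esum => x _; case: ifPn => //.
by rewrite notin_setE => /eqP /fa.
Qed.

Lemma tsum_ifeq T (a : T) (f : T -> \bar R) : 0 <= f a ->
  \tsum_x (if x == a then f x else 0) = f a.
Proof.
move=> fa; rewrite (@tsum_only _ _ a) ?eqxx // => x /negbTE -> //.
Qed.

Lemma tsum_ge_term T (f : T -> \bar R) a : (forall x, 0 <= f x) ->
  f a <= \tsum_x f x.
Proof.
move=> f0; rewrite -(@tsum_ifeq _ a f) //; apply: le_tsum => x.
by case: ifP.
Qed.

Lemma tsum_fiber T U (h : T -> U) (f : T -> \bar R) : (forall x, 0 <= f x) ->
  \tsum_x f x = \tsum_y \esum_(x in h @^-1` [set y]) f x.
Proof.
move=> f0.
under [RHS]eq_esum => y _ do rewrite esum_mkcond.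
rewrite exchange_tsum; last by move=> y x; case: ifP.
apply: eq_tsum => x.
rewrite (@tsum_only _ _ (h x)); first by rewrite mem_set.
  by case: ifP.
by move=> y /eqP yh; rewrite memNset //= => /esym.
Qed.

Lemma tsum_finite T (r : seq T) (f : T -> \bar R) : uniq r ->
  (forall x, 0 <= f x) -> (forall x, x \notin r -> f x = 0) ->
  \tsum_x f x = (\sum_(x <- r) f x)%E.
Proof.
move=> ur f0 fr; transitivity (\tsum_x \sum_(a <- r) (if x == a then f x else 0)).
  apply: eq_tsum => x; case: (boolP (x \in r)) => xr.
    rewrite (bigD1_seq x) //= eqxx big1 ?adde0 // => a ax.
    by rewrite eq_sym (negbTE ax).
  rewrite fr // big1 // => a _; by case: eqP.
rewrite esum_sum; last by move=> i j _ _; case: ifP.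
by apply: eq_bigr => a _; rewrite tsum_ifeq.
Qed.

Lemma tsum_fin (T : finType) (f : T -> \bar R) : (forall x, 0 <= f x) ->
  \tsum_x f x = (\sum_x f x)%E.
Proof.
move=> f0; rewrite (@tsum_finite _ (index_enum T)) //.
- exact: index_enum_uniq.
- by move=> x; rewrite mem_index_enum.
Qed.

Let tsumZ_fin T (c : R) (f : T -> \bar R) : (0 <= c)%R -> (forall x, 0 <= f x) ->
  \tsum_x (c%:E * f x) = c%:E * \tsum_x f x.
Proof.
move=> c0 f0.
have le (k : R) (g : T -> \bar R) : (0 < k)%R -> (forall x, 0 <= g x) ->
    \esum_(x in [set: T]) (k%:E * g x) <= k%:E * \tsum_x g x.
  move=> k0 g0; apply: ge_ereal_sup => _ [A [finA _] <-].
  rewrite -ge0_mule_fsumr //; apply: lee_wpmul2l; first by rewrite lee_fin ltW.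
  by apply: ereal_sup_ubound; exists A.
move: c0; rewrite le_eqVlt => /predU1P[<-|c0].
  by rewrite mul0e; apply: tsum0 => x; rewrite mul0e.
apply/eqP; rewrite eq_le le //=.
rewrite -[leRHS](mul1e _) -(divff (lt0r_neq0 c0)) EFinM -muleA.
apply: lee_wpmul2l; first by rewrite lee_fin ltW.
have := le c^-1%R (fun x => c%:E * f x) _ _.
rewrite invr_gt0 => /(_ c0); under eq_esum => x _.
  rewrite muleA -EFinM mulVf ?lt0r_neq0 // mul1e; over.
by apply=> x; rewrite mule_ge0 // lee_fin ltW.
Qed.

Lemma tsumZ T (c : \bar R) (f : T -> \bar R) : 0 <= c -> (forall x, 0 <= f x) ->
  \tsum_x (c * f x) = c * \tsum_x f x.
Proof.
move=> c0 f0; case: c c0 => [r r0|_|//]; first exact: tsumZ_fin.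
case: (pselect (exists x, f x != 0)) => [[x fx]|nx].
  have fx0 : 0 < f x by rewrite lt0e fx f0.
  rewrite [in RHS]gt0_mulye; last exact: lt_le_trans fx0 (tsum_ge_term x f0).
  apply/eqP; rewrite -leye_eq -[leLHS](gt0_mulye fx0).
  by apply: (tsum_ge_term (f := fun x => +oo * f x)) => y; rewrite mule_ge0 ?leey.
have f00 x : f x = 0 by apply/eqP/negPn/negP => fx; apply: nx; exists x.
by rewrite !tsum0 ?mule0 // => x; rewrite f00 mule0.
Qed.

Lemma tsumZr T (c : \bar R) (f : T -> \bar R) : 0 <= c -> (forall x, 0 <= f x) ->
  \tsum_x (f x * c) = (\tsum_x f x) * c.
Proof.
by move=> c0 f0; rewrite muleC -tsumZ //; apply: eq_tsum => x; rewrite muleC.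
Qed.

Lemma tsum_bij T U (e : T -> U) (f : U -> \bar R) : bijective e ->
  \tsum_x f (e x) = \tsum_y f y.
Proof.
by move=> be; apply/esym/reindex_esum; rewrite setTT_bijective.
Qed.

(** The values of a nonnegative family along an injection form a
subfamily; this is the form in which the two disjoint copies of the space are
compared with the space in [tsum_double]. *)
Lemma tsum_inj T U (e : T -> U) (f : U -> \bar R) : injective e ->
  (forall y, 0 <= f y) -> \tsum_x f (e x) <= \tsum_y f y.
Proof.
move=> ie f0; rewrite (@tsum_fiber _ _ e) //; apply: le_tsum => y.
case: (pselect (exists x, e x = y)) => [[x <-]|nx].
  rewrite (_ : _ @^-1` _ = [set x]) ?esum_set1 //.
  by apply/seteqP; split => x' /=; [apply: ie | move=> ->].
rewrite (_ : _ @^-1` _ = set0) ?esum_set0 //.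
by apply/seteqP; split => x' //= ex; case: nx; exists x'.
Qed.

End TotalSums.

(** * Expectations, images and convolutions of mass functions *)

(** Expectations are taken in the extended reals, so that they make sense
for all nonnegative functions, before any integrability is known. *)
Definition expect (R : realType) (T : choiceType) (p : T -> R)
  (phi : T -> \bar R) : \bar R := (\tsum_x ((p x)%:E * phi x))%E.

Section Expectation.
Variable R : realType.
Implicit Types T U : choiceType.
Local Open Scope ereal_scope.

Section OneMass.
Variables (T : choiceType) (p : T -> R).
Hypothesis p0 : forall x, (0 <= p x)%R.

Lemma expect_ge0 phi : (forall x, 0 <= phi x) -> 0 <= expect p phi.
Proof. by move=> f0; apply: tsum_ge0 => x; rewrite mule_ge0 // ?lee_fin. Qed.

Lemma eq_expect phi psi : phi =1 psi -> expect p phi = expect p psi.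
Proof. by move=> e; apply: eq_tsum => x; rewrite e. Qed.

Lemma le_expect phi psi :
  (forall x, phi x <= psi x) -> expect p phi <= expect p psi.
Proof. by move=> e; apply: le_tsum => x; rewrite lee_wpmul2l // lee_fin. Qed.

Lemma expectD phi psi : (forall x, 0 <= phi x) -> (forall x, 0 <= psi x) ->
  expect p (fun x => phi x + psi x) = expect p phi + expect p psi.
Proof.
move=> f0 g0; rewrite -tsumD => [|x|x]; try by rewrite mule_ge0 // ?lee_fin.
by apply: eq_tsum => x; rewrite ge0_muleDr.
Qed.

Lemma expectZ (c : \bar R) phi : 0 <= c -> (forall x, 0 <= phi x) ->
  expect p (fun x => c * phi x) = c * expect p phi.
Proof.
move=> c0 f0; rewrite -tsumZ // => [|x]; last by rewrite mule_ge0 // ?lee_fin.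
by apply: eq_tsum => x; rewrite muleCA.
Qed.

Lemma expect_tsum U (phi : T -> U -> \bar R) : (forall x y, 0 <= phi x y) ->
  expect p (fun x => \tsum_y phi x y) = \tsum_y expect p (phi^~ y).
Proof.
move=> f0; rewrite -exchange_tsum => [|x y]; last by rewrite mule_ge0 // ?lee_fin.
by apply: eq_tsum => x; rewrite tsumZ ?lee_fin.
Qed.

Lemma expect_ind a : expect p (fun x => (x == a)%:R%:E) = (p a)%:E.
Proof.
rewrite /expect (tsum_only (a := a)) => [|//|x xa]; rewrite ?eqxx ?mule1 ?lee_fin //.
by rewrite (negbTE xa) mule0.
Qed.

End OneMass.

(** Laws are compared through their expectations: convolution powers and
images are only ever handled through [expect_powerD] and [expect_push]. *)
Lemma mass_ext T (p q : T -> R) :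
  (forall x, 0 <= p x)%R -> (forall x, 0 <= q x)%R ->
  (forall phi, (forall x, 0 <= phi x) -> expect p phi = expect q phi) -> p = q.
Proof.
move=> p0 q0 e; apply/funext => x; apply: EFin_inj; rewrite -!expect_ind //.
by apply: e => y; rewrite lee_fin.
Qed.

Section ProbabilityMass.
Variables (T : choiceType) (p : T -> R).
Hypothesis pm : probability_mass p.

Lemma pmass_ge0 x : (0 <= p x)%R. Proof. by case: pm. Qed.
Let p0 := pmass_ge0.

Lemma pmass_le1 x : (p x <= 1)%R.
Proof.
rewrite -lee_fin -(proj2 pm); apply: (tsum_ge_term (f := fun x => (p x)%:E)).
by move=> y; rewrite lee_fin.
Qed.

Lemma expect_cst (c : R) : (0 <= c)%R -> expect p (fun=> c%:E) = c%:E.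
Proof.
move=> c0; rewrite /expect tsumZr //.
by rewrite (proj2 pm) mul1e.
Qed.

Lemma mass_sub_le1 (A : set T) : \esum_(x in A) (p x)%:E <= 1.
Proof.
rewrite esum_mkcond -(proj2 pm); apply: le_tsum => x.
by case: ifP => // _; rewrite lee_fin.
Qed.

Lemma fin_mass_sub (A : set T) : \esum_(x in A) (p x)%:E \is a fin_num.
Proof.
rewrite ge0_fin_numE; last by apply: esum_ge0 => x _; rewrite lee_fin.
by rewrite (le_lt_trans (mass_sub_le1 A)) // ltry.
Qed.

Lemma pushforwardE U (h : T -> U) y :
  (pushforward_mass h p y)%:E = \esum_(x in h @^-1` [set y]) (p x)%:E.
Proof. by rewrite fineK // fin_mass_sub. Qed.

Lemma push_ge0 U (h : T -> U) y : (0 <= pushforward_mass h p y)%R.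
Proof. by rewrite fine_ge0 // esum_ge0 // => x _; rewrite lee_fin. Qed.

Lemma expect_push U (h : T -> U) phi : (forall y, 0 <= phi y) ->
  expect (pushforward_mass h p) phi = expect p (phi \o h).
Proof.
move=> f0; rewrite [RHS](tsum_fiber h) => [|x]; last by rewrite /= mule_ge0 ?lee_fin.
apply: eq_tsum => y; rewrite pushforwardE !(esum_mkcond (_ @^-1` _)).
transitivity (\tsum_x ((if x \in h @^-1` [set y] then (p x)%:E else 0) * phi y)).
  rewrite tsumZr // => x; case: ifP => // _; rewrite lee_fin //.
by apply: eq_tsum => x; case: ifPn => [/set_mem /= <-|_]; rewrite ?mul0e.
Qed.

Lemma push_pmass U (h : T -> U) : probability_mass (pushforward_mass h p).
Proof.
split=> [y|]; first exact: push_ge0.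
have /= := expect_push h (phi := fun=> 1) _; rewrite expect_cst // => <- //.
by apply: eq_tsum => y; rewrite mule1.
Qed.

End ProbabilityMass.

Section Convolution.
Variable G : groupType.
Implicit Types p q : G -> R.

Lemma convolutionE p q g : probability_mass p -> probability_mass q ->
  (convolution p q g)%:E = \tsum_h (p h * q (h^-1 * g)%g)%:E.
Proof.
move=> pp pq; rewrite fineK // ge0_fin_numE; last first.
  by apply: esum_ge0 => x _; rewrite lee_fin mulr_ge0 ?pmass_ge0.
apply: le_lt_trans (ltry 1); rewrite -(proj2 pp); apply: le_tsum => x.
by rewrite lee_fin ler_piMr ?pmass_ge0 ?pmass_le1.
Qed.

Lemma conv_ge0 p q g : probability_mass p -> probability_mass q ->
  (0 <= convolution p q g)%R.
Proof.
move=> pp pq; rewrite -lee_fin convolutionE //; apply: tsum_ge0 => x.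
by rewrite lee_fin mulr_ge0 ?pmass_ge0.
Qed.

Lemma expect_conv p q phi : probability_mass p -> probability_mass q ->
  (forall x, 0 <= phi x) ->
  expect (convolution p q) phi =
  expect p (fun h => expect q (fun g => phi (h * g)%g)).
Proof.
move=> pp pq f0; rewrite /expect.
under eq_tsum => g.
  rewrite convolutionE // -tsumZr //; last first.
    by move=> x; rewrite lee_fin mulr_ge0 ?pmass_ge0.
  over.
rewrite exchange_tsum; last first.
  by move=> x y; rewrite mule_ge0 // ?lee_fin mulr_ge0 ?pmass_ge0.
apply: eq_tsum => h.
rewrite -tsumZ ?lee_fin ?pmass_ge0 //; last first.
  by move=> x; rewrite mule_ge0 // ?lee_fin pmass_ge0.
rewrite -[LHS](@tsum_bij _ _ _ (fun g => h * g)%g); last first.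
  by exists (fun g => h^-1 * g)%g => g; rewrite /= ?mulKg ?mulVKg.
by apply: eq_tsum => g; rewrite mulKg EFinM muleA.
Qed.

Lemma conv_pmass p q : probability_mass p -> probability_mass q ->
  probability_mass (convolution p q).
Proof.
move=> pp pq; split=> [g|]; first exact: conv_ge0.
have := @expect_conv p q (fun=> 1) pp pq (fun=> lee01).
under [X in _ = X -> _]eq_expect => h do rewrite expect_cst //.
by rewrite expect_cst // => <-; apply: eq_tsum => y; rewrite mule1.
Qed.

Lemma power_pmass p n : probability_mass p ->
  probability_mass (convolution_power p n).
Proof.
move=> pp; elim: n => [|n IH] /=; last exact: conv_pmass.
split=> [g|]; first by case: eqP.
rewrite (tsum_only (a := 1%g)) ?eqxx ?lee_fin // => x /negbTE -> //.
Qed.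

Lemma expect_power0 p phi : (forall x, 0 <= phi x) ->
  expect (convolution_power p 0) phi = phi 1%g.
Proof.
move=> f0; rewrite /expect (tsum_only (a := 1%g)) /= ?eqxx ?mul1e //.
by move=> x /negbTE ->; rewrite mul0e.
Qed.

Lemma expect_powerS p n phi : probability_mass p -> (forall x, 0 <= phi x) ->
  expect (convolution_power p n.+1) phi =
  expect p (fun h => expect (convolution_power p n) (fun g => phi (h * g)%g)).
Proof. by move=> pp f0; apply: expect_conv => //; apply: power_pmass. Qed.

Lemma expect_powerD p m n phi : probability_mass p -> (forall x, 0 <= phi x) ->
  expect (convolution_power p (m + n)) phi =
  expect (convolution_power p m)
    (fun h => expect (convolution_power p n) (fun g => phi (h * g)%g)).
Proof.
move=> pp; elim: m phi => [|m IH] phi f0.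
  rewrite add0n expect_power0 => [|x].
    by apply: eq_expect => g; rewrite mul1g.
  by apply: expect_ge0 => // y; apply: pmass_ge0; apply: power_pmass.
rewrite addSn !expect_powerS // => [|x]; last first.
  by apply: expect_ge0 => // y; apply: pmass_ge0; apply: power_pmass.
apply: eq_expect => h; rewrite IH //.
by apply: eq_expect => g; apply: eq_expect => k; rewrite mulgA.
Qed.

Lemma power1 p : probability_mass p -> convolution_power p 1 = p.
Proof.
move=> pp; apply: mass_ext => [x|x|phi f0]; try exact: pmass_ge0.
  exact: pmass_ge0 (power_pmass 1 pp) x.
rewrite expect_powerS //; apply: eq_expect => h.
by rewrite expect_power0 ?mulg1.
Qed.

Lemma powerM p m n : probability_mass p ->
  convolution_power (convolution_power p m) n = convolution_power p (m * n).
Proof.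
move=> pp; have pm := power_pmass m pp.
elim: n => [|n IH]; first by rewrite muln0.
apply: mass_ext => [x|x|phi f0].
- exact: pmass_ge0 (power_pmass _ pm) x.
- exact: pmass_ge0 (power_pmass _ pp) x.
rewrite mulnS expect_powerD // expect_powerS //.
by apply: eq_expect => h; rewrite IH.
Qed.

End Convolution.

Lemma push_power (G H : groupType) (h : {multiplicative G -> H}) (p : G -> R) n :
  h 1%g = 1%g -> probability_mass p ->
  convolution_power (pushforward_mass h p) n =
  pushforward_mass h (convolution_power p n).
Proof.
move=> h1 pp; have php := push_pmass pp h; have pn m := power_pmass m pp.
elim: n => [|n IH].
  apply: mass_ext => [x|x|phi f0].
  - exact: pmass_ge0 (power_pmass _ php) x.
  - exact: push_ge0.
  by rewrite expect_push // !expect_power0 //= h1.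
apply: mass_ext => [x|x|phi f0].
- exact: pmass_ge0 (power_pmass _ php) x.
- exact: push_ge0.
rewrite expect_push // !expect_powerS //; last by move=> x; apply: f0.
rewrite expect_push //; last first.
  by move=> x; apply: expect_ge0 => // y; apply: pmass_ge0 (power_pmass _ php) y.
apply: eq_expect => x /=; rewrite IH expect_push //.
by apply: eq_expect => y /=; rewrite gmulfM.
Qed.

End Expectation.

(** * Shannon entropy *)

Section RealInequalities.
Variable R : realType.
Implicit Types s r x : R.

Lemma ln_le_subr1 x : 0 < x -> ln x <= x - 1.
Proof.
move=> x0; have -> : ln x = ln (1 + (x - 1)) by congr ln; lra.
by apply: le_ln1Dx; lra.
Qed.

Lemma mul_ln_ge s r : 0 <= s -> (0 < s -> 0 < r) ->
  s - r <= s * (ln s - ln r) \/ s = 0.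
Proof.
rewrite le_eqVlt => /predU1P[<-|s0]; first by right.
move=> /(_ s0) r0; left.
have := ln_le_subr1 (divr_gt0 r0 s0); rewrite ln_div ?posrE // => h.
have -> : s * (ln s - ln r) = - (s * (ln r - ln s)) by ring.
have e : s * (r / s - 1) = r - s by field; rewrite gt_eqF.
by have := ler_wpM2l (ltW s0) h; rewrite e; lra.
Qed.

Lemma oppr_ln_ge0 x : x <= 1 -> 0 <= - ln x.
Proof. by move=> x1; rewrite oppr_ge0 ln_le0. Qed.

Lemma gibbs_pointwise s r : 0 <= s -> 0 <= r -> (0 < s -> 0 < r) ->
  s * (- ln s) + s <= s * (- ln r) + r.
Proof.
move=> s0 r0 sr; case: (mul_ln_ge s0 sr) => [|->]; last by rewrite !mul0r !add0r.
by rewrite mulrBr !mulrN; lra.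
Qed.

End RealInequalities.

Section Entropy.
Variable R : realType.
Implicit Types T U V : choiceType.
Local Open Scope ereal_scope.

Lemma entropyE T (p : T -> R) :
  shannon_entropy p = expect p (fun x => (- ln (p x))%:E).
Proof. by apply: eq_tsum => x; rewrite -EFinM mulrN. Qed.

Lemma entropy_ge0 T (p : T -> R) : probability_mass p -> 0 <= shannon_entropy p.
Proof.
move=> pm; rewrite entropyE; apply: expect_ge0 => x; first exact: pmass_ge0.
by rewrite lee_fin oppr_ln_ge0 // pmass_le1.
Qed.

(** Nonnegativity of relative entropy, for a reference family [g] that need not
have mass 1; the additional terms keep both sides free of subtractions. *)
Lemma gibbs T (p g : T -> R) : probability_mass p ->
  (forall x, 0 <= g x <= 1)%R -> (forall x, 0 < p x -> 0 < g x)%R ->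
  shannon_entropy p + 1 <=
  expect p (fun x => (- ln (g x))%:E) + \tsum_x (g x)%:E.
Proof.
move=> pm g01 pg; rewrite -[X in _ + X](proj2 pm) entropyE -!tsumD.
- apply: le_tsum => x; rewrite -!EFinM -!EFinD lee_fin.
  have /andP[g0 g1] := g01 x.
  by apply: gibbs_pointwise => //; [apply: pmass_ge0 | apply: pg].
- by move=> x; rewrite -EFinM lee_fin mulr_ge0 ?(pmass_ge0 pm) ?oppr_ln_ge0 //;
    have /andP[] := g01 x.
- by move=> x; rewrite lee_fin; have /andP[] := g01 x.
- by move=> x; rewrite -EFinM lee_fin mulr_ge0 ?(pmass_ge0 pm) ?oppr_ln_ge0 ?(pmass_le1 pm).
- by move=> x; rewrite lee_fin pmass_ge0.
Qed.

Lemma push_ge_term T U (h : T -> U) (p : T -> R) x : probability_mass p ->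
  (p x <= pushforward_mass h p (h x))%R.
Proof.
move=> pm; rewrite -lee_fin pushforwardE // esum_mkcond.
have /= := @tsum_ge_term _ _
  (fun z => if z \in h @^-1` [set h x] then (p z)%:E else 0) x.
rewrite mem_set //; apply => z; case: ifP => // _.
by rewrite lee_fin pmass_ge0.
Qed.

Lemma le_esum_sub T (A B : set T) (f : T -> \bar R) : A `<=` B ->
  (forall x, 0 <= f x) -> \esum_(x in A) f x <= \esum_(x in B) f x.
Proof.
move=> AB f0; rewrite esum_mkcond [leRHS]esum_mkcond; apply: le_tsum => x.
case: ifP => [/set_mem/AB/mem_set -> //|_]; by case: ifP.
Qed.

(** The entropy of an image law as an expectation upstairs: inequalities
between entropies of images then reduce to comparing atoms pointwise. *)
Lemma entropy_push T U (h : T -> U) (p : T -> R) : probability_mass p ->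
  shannon_entropy (pushforward_mass h p) =
  expect p (fun x => (- ln (pushforward_mass h p (h x)))%:E).
Proof.
move=> pm; rewrite entropyE expect_push // => y.
by rewrite lee_fin oppr_ln_ge0 // (pmass_le1 (push_pmass pm h)).
Qed.

(** Each atom of the law of [g] contains the corresponding atom of the
law of [f] when [f] determines [g]. *)
Lemma entropy_factor T U V (f : T -> U) (g : T -> V) (p : T -> R) :
  probability_mass p -> (forall x y, f x = f y -> g x = g y) ->
  shannon_entropy (pushforward_mass g p) <= shannon_entropy (pushforward_mass f p).
Proof.
move=> pm fg; rewrite !entropy_push //.
apply: le_tsum => x; have := pmass_ge0 pm x.
rewrite le_eqVlt => /predU1P[<-|px]; first by rewrite !mul0e.
apply: lee_wpmul2l; rewrite lee_fin ?(ltW px) //= lerN2 ler_ln ?posrE.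
- rewrite -lee_fin !pushforwardE //; apply: le_esum_sub => [y /fg //|y].
  by rewrite lee_fin pmass_ge0.
- exact: lt_le_trans px (push_ge_term f x pm).
- exact: lt_le_trans px (push_ge_term g x pm).
Qed.

Lemma entropy_push_le T U (h : T -> U) (p : T -> R) : probability_mass p ->
  shannon_entropy (pushforward_mass h p) <= shannon_entropy p.
Proof.
move=> pm; rewrite entropy_push // entropyE.
apply: le_tsum => x; have := pmass_ge0 pm x.
rewrite le_eqVlt => /predU1P[<-|px]; first by rewrite !mul0e.
apply: lee_wpmul2l; rewrite lee_fin ?(ltW px) //=.
rewrite lerN2 ler_ln ?posrE ?push_ge_term //.
exact: lt_le_trans px (push_ge_term h x pm).
Qed.

(** Gibbs inequality against the product of the two marginals. *)
Lemma entropy_joint T U V (f : T -> U) (g : T -> V) (p : T -> R) :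
  probability_mass p ->
  shannon_entropy (pushforward_mass (fun x => (f x, g x)) p) <=
  shannon_entropy (pushforward_mass f p) + shannon_entropy (pushforward_mass g p).
Proof.
move=> pm; set h := fun x => (f x, g x); have hm := push_pmass pm h.
have fm := push_pmass pm f; have gm := push_pmass pm g.
pose w (z : U * V) := (pushforward_mass f p z.1 * pushforward_mass g p z.2)%R.
have w01 z : (0 <= w z <= 1)%R.
  rewrite mulr_ge0 ?pmass_ge0 //= -[leRHS](mulr1 1%R).
  by rewrite ler_pM ?pmass_ge0 ?pmass_le1.
have sub (U' : choiceType) (k : U * V -> U') z :
    (pushforward_mass h p z <= pushforward_mass (k \o h) p (k z))%R.
  rewrite -lee_fin !pushforwardE //; apply: le_esum_sub => [y /= -> //|y].
  by rewrite lee_fin pmass_ge0.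
have w1 : \tsum_z (w z)%:E = 1.
  rewrite tsum_pair => [|z]; last by rewrite lee_fin; have /andP[] := w01 z.
  rewrite -(proj2 fm); apply: eq_tsum => x.
  rewrite -[RHS]mule1 -(proj2 gm) -tsumZ ?lee_fin ?pmass_ge0 //.
  by move=> y; rewrite lee_fin pmass_ge0.
have := gibbs hm w01; rewrite w1 leeD2rE //.
have pos z : (0 < pushforward_mass h p z)%R ->
    (0 < pushforward_mass f p z.1)%R /\ (0 < pushforward_mass g p z.2)%R.
  by move=> hz; split; [move: (sub _ fst z) | move: (sub _ snd z)];
    apply: lt_le_trans.
move=> /(_ _)/le_trans; apply => [z /pos[? ?]|]; first exact: mulr_gt0.
rewrite entropy_push // [X in _ + X]entropy_push //.
rewrite -expectD => [|x|x|x].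
- rewrite expect_push //; last first.
    by move=> y; rewrite lee_fin oppr_ln_ge0 //; have /andP[] := w01 y.
  apply: le_tsum => x /=; have := pmass_ge0 pm x.
  rewrite le_eqVlt => /predU1P[<-|px]; first by rewrite !mul0e.
  have [a b] := pos _ (lt_le_trans px (push_ge_term h x pm)).
  by rewrite lnM ?posrE // opprD EFinD.
- exact: pmass_ge0.
- by rewrite lee_fin oppr_ln_ge0 // pmass_le1.
- by rewrite lee_fin oppr_ln_ge0 // pmass_le1.
Qed.

Lemma conv_ge_term (G : groupType) (p q : G -> R) x y :
  probability_mass p -> probability_mass q ->
  (p x * q y <= convolution p q (x * y)%g)%R.
Proof.
move=> pm qm; rewrite -lee_fin convolutionE //.
have /= := tsum_ge_term (f := fun h => (p h * q (h^-1 * (x * y))%g)%:E) x.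
by rewrite mulKg; apply=> z; rewrite lee_fin mulr_ge0 ?pmass_ge0.
Qed.

(** The atom of [convolution p q] at [h * g] is at least [p h * q g], so
entropy is at most that of an independent pair. *)
Lemma entropy_conv (G : groupType) (p q : G -> R) :
  probability_mass p -> probability_mass q ->
  shannon_entropy (convolution p q) <= shannon_entropy p + shannon_entropy q.
Proof.
move=> pm qm; have cm := conv_pmass pm qm.
have ln0 (T : choiceType) (r : T -> R) x : probability_mass r -> 0 <= (- ln (r x))%:E.
  by move=> rm; rewrite lee_fin oppr_ln_ge0 // pmass_le1.
rewrite !entropyE expect_conv // => [|x]; last exact: ln0.
have q0 : 0 <= expect q (fun x => (- ln (q x))%:E).
  by apply: expect_ge0 => x; [apply: pmass_ge0 | apply: ln0].
have -> : expect p (fun x => (- ln (p x))%:E) + expect q (fun x => (- ln (q x))%:E)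
   = expect p (fun h => expect q (fun g => (- ln (p h))%:E + (- ln (q g))%:E)).
  rewrite -[X in _ + X]mul1e -(proj2 pm) -tsumZr //; last first.
    by move=> x; rewrite lee_fin pmass_ge0.
  rewrite -tsumD => [|x|x].
  - apply: eq_tsum => x; rewrite expectD => [|y|y|y].
    + rewrite expect_cst ?oppr_ln_ge0 ?(pmass_le1 pm) // ge0_muleDr //; first exact: ln0.
    + exact: pmass_ge0.
    + exact: ln0.
    + exact: ln0.
  - by rewrite mule_ge0 ?lee_fin ?(pmass_ge0 pm) ?oppr_ln_ge0 ?(pmass_le1 pm).
  - by rewrite mule_ge0 ?lee_fin ?pmass_ge0.
apply: le_tsum => x; have := pmass_ge0 pm x.
rewrite le_eqVlt => /predU1P[<-|px]; first by rewrite !mul0e.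
apply: lee_wpmul2l; first by rewrite lee_fin ltW.
apply: le_tsum => y; have := pmass_ge0 qm y.
rewrite le_eqVlt => /predU1P[<-|qy]; first by rewrite !mul0e.
apply: lee_wpmul2l; first by rewrite lee_fin ltW.
rewrite -EFinD lee_fin -opprD -lnM ?posrE //.
rewrite lerN2 ler_ln ?posrE ?mulr_gt0 ?conv_ge_term //.
exact: lt_le_trans (mulr_gt0 px qy) (conv_ge_term x y pm qm).
Qed.

End Entropy.

(** * Entropy of coded variables and asymptotic entropy *)

Section WordCodes.
Variable R : realType.
Local Open Scope ereal_scope.

Lemma geometric_half_le2 : \tsum_n ((2^-1 ^+ n : R)%:E) <= 2%:E.
Proof.
rewrite -nneseries_esumT; last by move=> n; rewrite lee_fin exprn_ge0.
apply: lime_le; first by apply: is_cvg_nneseries => n _ _; rewrite lee_fin exprn_ge0.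
apply: nearW => n; rewrite sumEFin lee_fin.
suff -> : (\sum_(0 <= i < n) 2^-1 ^+ i = 2 - 2 * 2^-1 ^+ n :> R)%R.
  by rewrite gerBl mulr_ge0 // exprn_ge0.
elim: n => [|n IH]; first by rewrite big_nil expr0; lra.
by rewrite big_nat_recr //= IH exprS; field.
Qed.

(** With weight [1 / (2 * #|A|)] per letter, the words of length [n] have total
weight [2 ^- n]: a Kraft inequality for arbitrary codes. *)
Lemma tsum_words_le2 (A : finType) : (0 < #|A|)%N ->
  \tsum_s ((((2 * #|A|%:R)^-1 : R) ^+ size (s : seq A))%:E) <= 2%:E.
Proof.
move=> A0; have AR : (0 < #|A|%:R :> R)%R by rewrite ltr0n.
have g0 n : (0 <= (2 * #|A|%:R)^-1 ^+ n :> R)%R.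
  by rewrite exprn_ge0 // invr_ge0 mulr_ge0 // ltW.
rewrite (tsum_fiber (fun s : seq A => size s)) => [|s]; last by rewrite lee_fin.
apply: le_trans geometric_half_le2; apply: le_tsum => n.
rewrite (@reindex_esum _ _ _ [set: n.-tuple A] _ (fun t : n.-tuple A => tval t)); last first.
  split=> [t _ /=|t u _ _ /val_inj //|s /= sn]; first by rewrite size_tuple.
  by exists (Tuple (introT eqP sn)).
rewrite tsum_fin => [|t]; last by rewrite lee_fin.
under eq_bigr => t _ do rewrite size_tuple.
rewrite sumEFin sumr_const card_tuple lee_fin -[leLHS]mulr_natl natrX -exprMn.
by rewrite invfM mulrCA divff ?gt_eqF // mulr1.
Qed.

(** Gibbs inequality against the weights of [tsum_words_le2]. *)
Lemma entropy_code (T : choiceType) (A : finType) (code : T -> seq A) (p : T -> R) :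
  probability_mass p -> (0 < #|A|)%N ->
  shannon_entropy (pushforward_mass code p) <=
  expect p (fun x => ((size (code x))%:R * ln (2 * #|A|%:R))%:E) + 1.
Proof.
move=> pm A0; have AR : (1 <= #|A|%:R :> R)%R by rewrite ler1n.
have cm := push_pmass pm code.
pose g (s : seq A) : R := ((2 * #|A|%:R)^-1 ^+ size s)%R.
have b0 : (0 < (2 * #|A|%:R)^-1 :> R)%R by rewrite invr_gt0; lra.
have b1 : ((2 * #|A|%:R)^-1 <= 1 :> R)%R by rewrite invf_le1; lra.
have g01 s : (0 <= g s <= 1)%R.
  by rewrite exprn_ge0 ?exprn_ile1 ?(ltW b0).
have gp s : (0 < g s)%R by rewrite exprn_gt0.
have := gibbs cm g01 (fun s _ => gp s).
have -> : expect (pushforward_mass code p) (fun x => (- ln (g x))%:E) =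
    expect p (fun x => ((size (code x))%:R * ln (2 * #|A|%:R))%:E).
  rewrite expect_push //; last first.
    by move=> s; rewrite lee_fin oppr_ln_ge0 //; have /andP[] := g01 s.
  apply: eq_expect => x /=; congr EFin.
  by rewrite lnXn // lnV ?posrE; [rewrite mulNrn opprK [RHS]mulr_natl|lra].
move=> h; have {h} := le_trans h (leeD2l _ (tsum_words_le2 A0)).
have -> : 2%:E = 1 + 1 :> \bar R by rewrite -EFinD.
by rewrite addeA leeD2rE.
Qed.

End WordCodes.

Section Subadditive.
Variable R : realType.

(** Fekete's lemma; that the limit is a lower bound of all [u n / n] is what lets
the entropy of a quotient be estimated at a single time. *)
Lemma fekete (u : nat -> R) : (forall n, 0 <= u n) ->
  (forall m n, u (m + n)%N <= u m + u n) ->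
  exists h, [/\ 0 <= h, forall n, (0 < n)%N -> h <= u n / n%:R &
    (fun n => n%:R^-1 * u n) @ \oo --> h].
Proof.
move=> u0 usub.
pose A := [set u n / n%:R | n in [set n | (0 < n)%N]].
have Alb : lbound A 0 by move=> _ [n /= n0 <-]; rewrite divr_ge0.
have hA : has_inf A by split; [exists (u 1%N / 1%:R), 1%N | exists 0].
exists (inf A); have infle n : (0 < n)%N -> inf A <= u n / n%:R.
  by move=> n0; apply: ge_inf; [exact: hA.2 | exists n].
split=> //; first by apply: lb_le_inf => //; case: hA.
have umul m q : u (q * m)%N <= q%:R * u m + u 0%N.
  elim: q => [|q IH]; first by rewrite mul0n mul0r add0r.
  by rewrite mulSn; have := usub m (q * m)%N; rewrite -natr1 mulrDl mul1r; lra.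
apply/cvgrPdist_le => e e0.
have [_ [m /= m0 <-] hm] := inf_adherent (divr_gt0 e0 (ltr0Sn R 1)) hA.
pose C := u 0%N + \sum_(r < m) u r.
have C0 : 0 <= C by rewrite addr_ge0 // sumr_ge0.
have uC r : (r < m)%N -> u 0%N + u r <= C.
  move=> rm; rewrite lerD2l (bigD1 (Ordinal rm)) //= lerDl sumr_ge0 //.
have m0R : 0 < m%:R :> R by rewrite ltr0n.
near=> n; have n0 : (0 < n)%N by near: n; exists 1%N.
have n0R : 0 < n%:R :> R by rewrite ltr0n.
have un : u n <= (u m / m%:R) * n%:R + C.
  have -> : n = (n %/ m * m + n %% m)%N by rewrite -divn_eq.
  set q := (n %/ m)%N; set r := (n %% m)%N.
  have h1 := usub (q * m)%N r; have h2 := umul m q.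
  have h3 := uC r (ltn_pmod _ m0).
  have -> : u m / m%:R * (q * m + r)%:R = q%:R * u m + u m / m%:R * r%:R.
    by rewrite natrD natrM mulrDr; congr (_ + _); field; rewrite gt_eqF.
  have : 0 <= u m / m%:R * r%:R by rewrite mulr_ge0 // divr_ge0.
  by lra.
have Cn : C / n%:R <= e / 2.
  rewrite ler_pdivrMr // -ler_pdivrMl ?divr_gt0 //.
  by near: n; exact: nbhs_infty_ger.
have := infle n n0; have -> : n%:R^-1 * u n = u n / n%:R by rewrite mulrC.
move=> lo; rewrite distrC ger0_norm ?subr_ge0 //.
have : u n / n%:R <= u m / m%:R + C / n%:R.
  by rewrite ler_pdivrMr // mulrDl divfK ?gt_eqF.
by lra.
Unshelve. all: by end_near. Qed.

End Subadditive.

Section AsymptoticEntropy.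
Variables (R : realType) (G : groupType) (p : G -> R).
Hypothesis pm : probability_mass p.
Hypothesis pfin : (shannon_entropy p < +oo)%E.
Local Open Scope ereal_scope.

Definition step_entropy n := fine (shannon_entropy (convolution_power p n)).

Lemma entropy_power0 : shannon_entropy (convolution_power p 0) = 0.
Proof.
rewrite entropyE expect_power0 => [|x]; last first.
  by rewrite lee_fin oppr_ln_ge0 // (pmass_le1 (power_pmass 0 pm)).
by rewrite /= eqxx ln1 oppr0.
Qed.

Lemma entropy_power_fin n : shannon_entropy (convolution_power p n) \is a fin_num.
Proof.
rewrite ge0_fin_numE; last by apply: entropy_ge0; apply: power_pmass.
elim: n => [|n IH]; first by rewrite entropy_power0 ltry.
have := entropy_conv pm (power_pmass n pm).
by move=> /le_lt_trans -> //; rewrite lte_add_pinfty.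
Qed.

Lemma step_entropyE n :
  (step_entropy n)%:E = shannon_entropy (convolution_power p n).
Proof. by rewrite fineK // entropy_power_fin. Qed.

Lemma step_entropy_ge0 n : (0 <= step_entropy n)%R.
Proof. by rewrite fine_ge0 // entropy_ge0 //; apply: power_pmass. Qed.

Lemma power_conv m n :
  convolution (convolution_power p m) (convolution_power p n) =
  convolution_power p (m + n).
Proof.
have pmm := power_pmass m pm; have pn := power_pmass n pm.
have pmn := power_pmass (m + n) pm.
apply: mass_ext => [x|x|phi f0].
- exact: conv_ge0.
- exact: pmass_ge0.
by rewrite expect_conv // expect_powerD.
Qed.

Lemma step_entropy_subadd m n :
  (step_entropy (m + n) <= step_entropy m + step_entropy n)%R.
Proof.
rewrite -lee_fin EFinD !step_entropyE -power_conv.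
by apply: entropy_conv; apply: power_pmass.
Qed.

Lemma asymptotic_entropyP : exists h : R, [/\ asymptotic_entropy p = h%:E,
  (0 <= h)%R, forall n, (0 < n)%N -> (h <= step_entropy n / n%:R)%R &
  (fun n => n%:R^-1 * step_entropy n)%R @ \oo --> h].
Proof.
have [h [h0 hle hc]] := fekete step_entropy_ge0 step_entropy_subadd.
exists h; split=> //; apply/cvg_lim => //.
under eq_fun => n do rewrite -step_entropyE -EFinM.
by apply: cvg_EFin => //; apply: nearW.
Qed.

End AsymptoticEntropy.

(** * First moments on the free group and entropy of quotients *)

Section FreeGroupLength.
Variable d : nat.
Implicit Types g h : free_group d.

Definition flen g : nat := size (word_of g).

Lemma size_cons_red (a : letter d) w : (size (cons_red a w) <= (size w).+1)%N.
Proof. by case: w => //= b w; case: ifP => //= _; lia. Qed.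

Lemma flenM g h : (flen (g * h)%g <= flen g + flen h)%N.
Proof.
rewrite /flen /=; elim: (word_of g) => //= a u IH.
by apply: leq_trans (size_cons_red _ _) _; rewrite ltnS.
Qed.

Lemma flenV g : flen g^-1%g = flen g.
Proof. by rewrite /flen /= size_rev size_map. Qed.

Lemma flen_prod (s : seq (free_group d)) :
  (forall x, x \in s -> range (@fg_gen d) x \/ range (@fg_gen d) x^-1%g) ->
  (flen (\prod_(x <- s) x)%g <= size s)%N.
Proof.
elim: s => [|x s IH] hs; first by rewrite big_nil.
rewrite big_cons; apply: leq_trans (flenM _ _) _.
have -> : flen x = 1%N.
  by case: (hs x (mem_head _ _)) => [] [i _ e]; [|rewrite -flenV]; rewrite -e.
by rewrite /= add1n ltnS; apply: IH => y ys; apply: hs; rewrite inE ys orbT.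
Qed.

End FreeGroupLength.

Section Moments.
Variables (R : realType) (d : nat) (mu : free_group d -> R).
Hypothesis hmu : probability_mass mu.
Local Open Scope ereal_scope.

Definition first_moment (p : free_group d -> R) := expect p (fun g => (flen g)%:R%:E).

Hypothesis hmom : finite_first_moment (range (@fg_gen d)) mu.

(** The first moment hypothesis is stated with the infimum over all
expressions in the generators; the reduced word is one of the shortest. *)
Lemma flen_le_word_length (g : free_group d) :
  (flen g)%:R%:E <= word_length R (range (@fg_gen d)) g.
Proof.
apply: le_ereal_inf_tmp => _ [s [hs <-] <-].
by rewrite lee_fin ler_nat flen_prod.
Qed.

Lemma first_moment_fin : first_moment mu < +oo.
Proof.
apply: le_lt_trans hmom; apply: le_tsum => g; rewrite muleC.
by apply: lee_wpmul2r (flen_le_word_length g); rewrite lee_fin pmass_ge0.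
Qed.

Lemma first_moment_conv (p q : free_group d -> R) :
  probability_mass p -> probability_mass q ->
  first_moment (convolution p q) <= first_moment p + first_moment q.
Proof.
move=> pm qm; rewrite /first_moment expect_conv //.
have -> : expect p (fun g => (flen g)%:R%:E) + expect q (fun g => (flen g)%:R%:E) =
    expect p (fun h => (flen h)%:R%:E + expect q (fun g => (flen g)%:R%:E)).
  have q0 : 0 <= expect q (fun g => (flen g)%:R%:E).
    by apply: expect_ge0 => x //; apply: pmass_ge0.
  rewrite expectD //; last exact: pmass_ge0.
  congr (_ + _); rewrite /expect tsumZr ?(proj2 pm) ?mul1e // => x.
  by rewrite lee_fin pmass_ge0.
apply: le_expect => [x|x]; first exact: pmass_ge0.
rewrite -[(flen x)%:R%:E](expect_cst qm) // -expectD //; last exact: pmass_ge0.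
apply: le_expect => [y|y]; first exact: pmass_ge0.
by rewrite -EFinD lee_fin -natrD ler_nat flenM.
Qed.

Lemma first_moment_power n : first_moment (convolution_power mu n) < +oo.
Proof.
elim: n => [|n IH].
  by rewrite /first_moment expect_power0 ?ltry.
apply: le_lt_trans (first_moment_conv hmu (power_pmass n hmu)) _.
by apply: lte_add_pinfty => //; apply: first_moment_fin.
Qed.

Hypothesis d0 : (0 < d)%N.

Lemma letters_gt0 : (0 < #|{: letter d}|)%N.
Proof. by rewrite card_prod card_ord card_bool muln_gt0 d0. Qed.

(** The reduced word is a code whose mean length is the first
moment. *)
Lemma first_moment_entropy : shannon_entropy mu < +oo.
Proof.
pose K := ln (2 * #|{: letter d}|%:R) : R.
have K0 : (0 <= K)%R.
  rewrite ln_ge0 //; have : (1 <= #|{: letter d}|%:R :> R)%R by rewrite ler1n letters_gt0.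
  by lra.
have -> : shannon_entropy mu = shannon_entropy (pushforward_mass (@word_of d) mu).
  apply/eqP; rewrite eq_le entropy_push_le // andbT.
  rewrite entropyE entropy_push //; apply: le_tsum => x.
  rewrite /pushforward_mass (_ : _ @^-1` _ = [set x]); last first.
    by apply/seteqP; split=> y /=; [apply: val_inj | move=> ->].
  by rewrite esum_set1 //= lee_fin pmass_ge0.
apply: le_lt_trans (entropy_code (@word_of d) hmu letters_gt0) _.
rewrite lte_add_pinfty ?ltry //.
under (eq_expect mu) => g do rewrite mulrC EFinM.
rewrite expectZ ?lee_fin //; last by move=> x; rewrite pmass_ge0.
by apply: lte_mul_pinfty => //; apply: first_moment_fin.
Qed.

End Moments.

Notation qlaw N := (pushforward_mass (quotient_map N)).

Section QuotientEntropies.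
Variables (R : realType) (G : groupType) (mu : G -> R).
Hypothesis hmu : probability_mass mu.
Hypothesis hent : (shannon_entropy mu < +oo)%E.
Implicit Types M N K : normal_subgroup G.

Definition qstep N n := fine (shannon_entropy (qlaw N (convolution_power mu n))).

Lemma qlaw_pmass N (p : G -> R) : probability_mass p -> probability_mass (qlaw N p).
Proof. by move=> pm; apply: push_pmass. Qed.

Lemma qlaw_power N n :
  convolution_power (qlaw N mu) n = qlaw N (convolution_power mu n).
Proof. exact: (@push_power _ _ _ (quotient_map N)). Qed.

Lemma qlaw_fin N (p : G -> R) : probability_mass p -> (shannon_entropy p < +oo)%E ->
  (shannon_entropy (qlaw N p) < +oo)%E.
Proof. by move=> pm; apply: le_lt_trans; apply: entropy_push_le. Qed.

Lemma qstepE N n :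
  (qstep N n)%:E = shannon_entropy (qlaw N (convolution_power mu n)).
Proof.
rewrite fineK // ge0_fin_numE; last by apply: entropy_ge0; apply: qlaw_pmass; apply: power_pmass.
apply: qlaw_fin; first exact: power_pmass.
by rewrite -ge0_fin_numE ?entropy_power_fin //; apply: entropy_ge0; apply: power_pmass.
Qed.

Lemma quotient_entropyP N : exists h : R, [/\ quotient_entropy mu N = h%:E,
  0 <= h, forall n, (0 < n)%N -> h <= qstep N n / n%:R &
  (fun n => n%:R^-1 * qstep N n) @ \oo --> h].
Proof.
have [h [e h0 hle hc]] := asymptotic_entropyP (qlaw_pmass N hmu) (qlaw_fin N hmu hent).
exists h; split=> // [n n0|].
  by rewrite /qstep -qlaw_power; apply: hle.
by move: hc; under eq_fun => n do rewrite /step_entropy qlaw_power.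
Qed.

Lemma quotient_map_sub M N x y : M `<=` N ->
  quotient_map M x = quotient_map M y -> quotient_map N x = quotient_map N y.
Proof. by move=> MN /quotient_mapP/MN Nxy; apply/quotient_mapP. Qed.

Lemma qstep_sub M N n : M `<=` N -> qstep N n <= qstep M n.
Proof.
move=> MN; rewrite -lee_fin !qstepE; apply: entropy_factor; first exact: power_pmass.
by move=> x y; apply: quotient_map_sub.
Qed.

(** [G / ns_cap N K] is the image of [G] in the product of [G / N] and [G / K]. *)
Definition ns_cap N K : normal_subgroup G.
Proof.
exists (N `&` K).
- by split; apply: ns_one.
- by move=> x y [? ?] [? ?]; split; apply: ns_mul.
- by move=> x [? ?]; split; apply: ns_inv.
- by move=> x y [? ?]; split; apply: ns_conj.
Defined.

(** The position modulo [N :&: K] is determined by the positions modulo [N] and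
modulo [K]. *)
Lemma qstep_cap N K n : qstep (ns_cap N K) n <= qstep N n + qstep K n.
Proof.
rewrite -lee_fin EFinD !qstepE; have pn := power_pmass n hmu.
apply: le_trans (entropy_joint (quotient_map N) (quotient_map K) pn).
apply: entropy_factor => // x y [/quotient_mapP ? /quotient_mapP ?].
by apply/quotient_mapP.
Qed.

Lemma quotient_entropy_le (a b : normal_subgroup G) :
  (forall n, qstep a n <= qstep b n) ->
  (quotient_entropy mu a <= quotient_entropy mu b)%E.
Proof.
move=> ab; have [h [-> _ _ ha]] := quotient_entropyP a.
have [k [-> _ _ hb]] := quotient_entropyP b.
rewrite lee_fin -(cvg_lim _ ha) // -(cvg_lim _ hb) //.
apply: ler_lim; [by apply/cvg_ex; exists h | by apply/cvg_ex; exists k |].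
by apply: nearW => n; rewrite ler_wpM2l ?invr_ge0.
Qed.

Lemma quotient_entropy_sub M N : M `<=` N ->
  (quotient_entropy mu N <= quotient_entropy mu M)%E.
Proof.
by move=> MN; apply: quotient_entropy_le => // n; apply: qstep_sub.
Qed.

Lemma quotient_entropy_cap N K : (quotient_entropy mu (ns_cap N K) <=
  quotient_entropy mu N + quotient_entropy mu K)%E.
Proof.
have [h [-> _ _ hc]] := quotient_entropyP (ns_cap N K).
have [k [-> _ _ hN]] := quotient_entropyP N.
have [l [-> _ _ hK]] := quotient_entropyP K.
have hNK : (fun n => n%:R^-1 * qstep N n + n%:R^-1 * qstep K n) @ \oo --> k + l.
  exact: cvgD.
rewrite -EFinD lee_fin -(cvg_lim _ hc) // -(cvg_lim _ hNK) //.
apply: ler_lim; [by apply/cvg_ex; exists h | by apply/cvg_ex; exists (k + l) |].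
by apply: nearW => n /=; rewrite -mulrDr ler_wpM2l ?invr_ge0 // qstep_cap.
Qed.

End QuotientEntropies.

(** * Upper semicontinuity of entropy in the kernel *)

Section TailSums.
Variables (R : realType) (T : choiceType).
Local Open Scope ereal_scope.

Lemma tsum_split (A : set T) (f : T -> \bar R) : (forall x, 0 <= f x) ->
  \tsum_x f x = \esum_(x in A) f x + \esum_(x in ~` A) f x.
Proof. by move=> f0; rewrite (esumID A) ?setTI. Qed.

Lemma tsum_tail (f : T -> \bar R) (e : R) : (forall x, 0 <= f x) ->
  \tsum_x f x < +oo -> (0 < e)%R ->
  exists2 A : set T, finite_set A & forall B, A `<=` B ->
    \esum_(x in ~` B) f x <= e%:E.
Proof.
move=> f0 ffin e0.
have fn : \tsum_x f x \is a fin_num by rewrite ge0_fin_numE // tsum_ge0.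
have [_ [A [finA _] <-] hA] := ub_ereal_sup_adherent e0 fn.
exists A => // B AB; have := tsum_split A f0; rewrite -/(\tsum_x f x) => E.
apply: (@le_trans _ _ (\esum_(x in ~` A) f x)).
  by apply: le_esum_sub => // x nB Ax; apply: nB; apply: AB.
have An : \esum_(x in A) f x \is a fin_num.
  rewrite ge0_fin_numE ?esum_ge0 // (le_lt_trans _ ffin) // E leeDl //.
  exact: esum_ge0.
move: hA; rewrite -esum_fset // [in X in X -> _]/esum -/(\tsum_x f x) E.
by rewrite lteBlDr // lteD2lE // => /ltW.
Qed.

End TailSums.

Section UpperSemicontinuity.
Variable R : realType.
Local Open Scope ereal_scope.

Section Outside.
Variables (T : choiceType) (p : T -> R).
Hypothesis pm : probability_mass p.

(** All the points of [B] are glued together; this records the exceptional points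
and forgets where in [B] the other ones are. *)
Definition outside (B : set T) (x : T) : option T := if x \in B then None else Some x.

(** If [A] carries almost all the mass, the glued point contributes little
since its mass is near 1, and the other points contribute a tail of the convergent
series defining the entropy of [p]. *)
Lemma entropy_outside (e : R) : (0 < e)%R -> shannon_entropy p < +oo ->
  exists2 A : set T, finite_set A &
    shannon_entropy (pushforward_mass (outside A) p) <= e%:E.
Proof.
move=> e0; rewrite entropyE => /tsum_tail h.
have pl0 x : 0 <= (p x)%:E * (- ln (p x))%:E.
  by rewrite mule_ge0 ?lee_fin ?oppr_ln_ge0 ?(pmass_le1 pm) ?(pmass_ge0 pm).
have [A1 fin1 h1] := h (e / 2)%R pl0 ltac:(by rewrite divr_gt0).
have pfin : \tsum_x (p x)%:E < +oo by rewrite (proj2 pm) ltry.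
(* A mass at least [1 - e' = (1 + e / 2)^-1] has logarithm at least [- e / 2]. *)
pose e' := (e / 2 / (1 + e / 2))%R.
have e'0 : (0 < e')%R by rewrite divr_gt0; lra.
have p0 x : 0 <= (p x)%:E by rewrite lee_fin pmass_ge0.
have [A2 fin2 h2] := tsum_tail p0 pfin e'0.
exists (A1 `|` A2); first by rewrite finite_setU.
set A := A1 `|` A2.
rewrite entropy_push // /expect (tsum_split A); last first.
  move=> x; rewrite mule_ge0 ?lee_fin ?oppr_ln_ge0 ?(pmass_ge0 pm) //.
  exact: pmass_le1 (push_pmass _ _) _.
have -> : e%:E = (e / 2)%:E + (e / 2)%:E by rewrite -EFinD; congr EFin; lra.
apply: leeD; last first.
  apply: le_trans (h1 A (@subsetUl _ _ _)); apply: le_esum => x nA.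
  have := pmass_ge0 pm x; rewrite le_eqVlt => /predU1P[<-|px]; first by rewrite !mul0e.
  apply: lee_wpmul2l; first by rewrite lee_fin ltW.
  rewrite lee_fin lerN2 ler_ln ?posrE ?push_ge_term //.
  exact: lt_le_trans px (push_ge_term _ _ pm).
pose m := pushforward_mass (outside A) p None.
have mA : m%:E = \esum_(x in A) (p x)%:E.
  rewrite /m pushforwardE //; congr esum; apply/seteqP; split=> x /=.
    by rewrite /outside; case: ifP => // /set_mem.
  by move=> Ax; rewrite /outside mem_set.
have m1 : ((1 + e / 2)^-1 <= m)%R.
  have := tsum_split A p0.
  rewrite (proj2 pm) -mA => E; have := h2 A (@subsetUr _ _ _).
  have nAfin := fin_mass_sub pm (~` A).
  move: E; rewrite -(fineK nAfin) -EFinD => -[E]; rewrite lee_fin => le.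
  have : e' = (1 - (1 + e / 2)^-1)%R by rewrite /e'; field; lra.
  by lra.
apply: (@le_trans _ _ (\esum_(x in A) ((p x)%:E * (e / 2)%:E))).
  apply: le_esum => x Ax; apply: lee_wpmul2l; first by rewrite lee_fin pmass_ge0.
  rewrite /outside mem_set // -/m lee_fin.
  have i0 : (0 < (1 + e / 2)^-1)%R by rewrite invr_gt0; lra.
  have : (ln (1 + e / 2)^-1 <= ln m)%R by rewrite ler_ln ?posrE //; apply: lt_le_trans m1.
  rewrite lnV ?posrE; last by lra.
  by have := @le_ln1Dx R (e / 2); lra.
rewrite esum_mkcond.
apply: (@le_trans _ _ (expect p (fun=> (e / 2)%:E))); last by rewrite expect_cst //; lra.
apply: le_tsum => x; case: ifP => // _; rewrite mule_ge0 ?lee_fin ?(pmass_ge0 pm) //; lra.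
Qed.

(** On [A] the value of [f] is recovered from [f'], and off [A] from
the point itself. *)
Lemma entropy_local_factor (U V : choiceType) (f : T -> U) (f' : T -> V) (A : set T) :
  (forall x y, A x -> A y -> f' x = f' y -> f x = f y) ->
  shannon_entropy (pushforward_mass f p) <=
  shannon_entropy (pushforward_mass f' p) +
  shannon_entropy (pushforward_mass (outside A) p).
Proof.
move=> ff; apply: le_trans (entropy_joint f' (outside A) pm).
apply: entropy_factor => // x y [f'xy]; rewrite /outside.
case: ifPn => [/set_mem Ax|_]; case: ifPn => [/set_mem Ay|_] //.
  by move=> _; apply: ff.
by move=> [->].
Qed.

End Outside.

Lemma near_seq_all (T : eqType) (r : seq T) (P : nat -> T -> Prop) :
  (forall x, \forall n \near \oo, P n x) ->
  \forall n \near \oo, forall x, x \in r -> P n x.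
Proof.
move=> h; elim: r => [|a r IH]; first by near=> n.
near=> n => x; rewrite inE => /predU1P[->|xr]; first by near: n.
by move: x xr; near: n.
Unshelve. all: by end_near. Qed.

(** Cut the law to a finite set [A] outside of which it has little entropy.
There are finitely many quotients of elements of [A], so for large [n] two elements
of [A] in the same coset of [K'] are in the same coset of [K n]. *)
Lemma qlaw_entropy_usc (G : groupType) (p : G -> R)
  (K : nat -> normal_subgroup G) (K' : normal_subgroup G) (e : R) :
  probability_mass p -> shannon_entropy p < +oo -> (0 < e)%R ->
  (forall g, ns_set K' g -> \forall n \near \oo, ns_set (K n) g) ->
  \forall n \near \oo, shannon_entropy (qlaw (K n) p) <=
    shannon_entropy (qlaw K' p) + e%:E.
Proof.
move=> pm pfin e0 KK.
have [A finA hA] := entropy_outside pm e0 pfin.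
have /finite_seqP[r Ar] := finA.
have : \forall n \near \oo, forall z, z \in [seq (x, y) | x <- r, y <- r] ->
    ns_set K' (z.1^-1 * z.2)%g -> ns_set (K n) (z.1^-1 * z.2)%g.
  apply: near_seq_all => z; case: (pselect (ns_set K' (z.1^-1 * z.2)%g)) => [/KK|nK].
    by apply: filterS.
  by near=> n.
apply: filterS => n hn; apply: le_trans (leeD2l _ hA).
apply: entropy_local_factor => // x y; rewrite Ar /= => xr yr.
move=> /quotient_mapP Kxy; apply/quotient_mapP.
by apply: (hn (x, y)) => //; apply: allpairs_f.
Unshelve. all: by end_near. Qed.

End UpperSemicontinuity.

(** * Relative entropy along the fibres of a map *)

Section Divergence.
Variable R : realType.
Implicit Types s r a b : R.

(** Relative entropy with the linear correction [- s + r], which makes each term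
nonnegative, including for families that do not have the same mass. *)
Definition divergence s r : R := s * (ln s - ln r) - s + r.

Lemma divergence_ge0 s r : 0 <= s -> 0 <= r -> (0 < s -> 0 < r) -> 0 <= divergence s r.
Proof.
move=> s0 r0 sr; rewrite /divergence; case: (mul_ln_ge s0 sr) => [|->]; lra.
Qed.

(** The bound [ln t <= t - 1] at [t = sqrt r / sqrt s]. *)
Lemma hellinger_le_divergence s r : 0 <= s -> 0 <= r -> (0 < s -> 0 < r) ->
  (Num.sqrt s - Num.sqrt r) ^+ 2 <= divergence s r.
Proof.
move=> s0 r0 sr; rewrite /divergence -[in leRHS](sqr_sqrtr s0) -[in leRHS](sqr_sqrtr r0).
have a0 := sqrtr_ge0 s; have b0 := sqrtr_ge0 r.
have ab : 0 < Num.sqrt s -> 0 < Num.sqrt r by rewrite !sqrtr_gt0.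
move: (Num.sqrt s) (Num.sqrt r) a0 b0 ab => a b a0 b0 ab.
case: (mul_ln_ge a0 ab) => [h|->]; last by rewrite expr0n /= mul0r; lra.
have [->|an0] := eqVneq a 0; first by rewrite expr0n /= mul0r; lra.
have a1 : 0 < a by rewrite lt0r an0.
rewrite !lnXn ?ab // -mulrnBl.
have := ler_wpM2l a0 h; rewrite mulrA -expr2; set t := a ^+ 2 * _ => ht.
have -> : a ^+ 2 * ((ln a - ln b) *+ 2) = t + t by rewrite mulrnAr mulr2n.
by rewrite -/t in ht; lra.
Qed.

(** Pinsker's inequality with a free parameter [del], in a pointwise form
that can be summed without the Cauchy-Schwarz inequality: the distance is
[|sqrt s - sqrt r| * (sqrt s + sqrt r)], to which the arithmetic-geometric mean
inequality applies. *)
Lemma dist_le_divergence s r (del : R) : 0 < del -> 0 <= s -> 0 <= r ->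
  (0 < s -> 0 < r) ->
  `|s - r| <= del * (s + r) + divergence s r / (2 * del).
Proof.
move=> del0 s0 r0 sr; have := hellinger_le_divergence s0 r0 sr.
set D := divergence s r => hD.
have e : s = Num.sqrt s ^+ 2 by rewrite sqr_sqrtr.
have f : r = Num.sqrt r ^+ 2 by rewrite sqr_sqrtr.
have a0 := sqrtr_ge0 s; have b0 := sqrtr_ge0 r.
move: (Num.sqrt s) (Num.sqrt r) a0 b0 e f hD => a b a0 b0 -> -> hD.
have -> : a ^+ 2 - b ^+ 2 = (a - b) * (a + b) by ring.
rewrite normrM (ger0_norm (addr_ge0 a0 b0)).
set x := `|a - b|; have xD : x ^+ 2 <= D by rewrite real_normK ?num_real.
have h1 : D = D / (2 * del) * (2 * del) by rewrite divfK // mulf_neq0 ?gt_eqF.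
set E := D / (2 * del) in h1 *.
have h2 : 0 <= (x - del * (a + b)) ^+ 2 by rewrite sqr_ge0.
have h3 : 0 <= (a - b) ^+ 2 by rewrite sqr_ge0.
rewrite -(ler_pM2r (_ : 0 < 2 * del)); last by lra.
have : x * (a + b) * (2 * del) <= x ^+ 2 + del ^+ 2 * (a + b) ^+ 2 by nra.
have : del ^+ 2 * (a + b) ^+ 2 <= del ^+ 2 * (2 * (a ^+ 2 + b ^+ 2)).
  by rewrite ler_wpM2l ?sqr_ge0 //; nra.
by move=> h4 h5; rewrite [leRHS]mulrDl -h1; nra.
Qed.

End Divergence.

Section ConditionalInformation.
Variables (R : realType) (Y Z U : choiceType).
Variables (m : Y -> R) (s : Y -> Z -> R) (p : Z -> R) (f : Z -> U).
Hypotheses (mm : probability_mass m) (sm : forall y, probability_mass (s y))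
  (pm : probability_mass p).
Hypothesis mix : forall phi, (forall z, 0 <= phi z)%E ->
  expect p phi = expect m (fun y => expect (s y) phi).
Local Open Scope ereal_scope.

Let s' y := pushforward_mass f (s y).
Let p' := pushforward_mass f p.
Let s'm y : probability_mass (s' y). Proof. exact: push_pmass. Qed.
Let p'm : probability_mass p'. Proof. exact: push_pmass. Qed.

(** The family obtained from [s y] by keeping its image under [f] and replacing its
conditional laws on the fibres by those of the mixture [p].  It depends on [y] only
through the image of [s y], which is what makes it useful in [translates_close]. *)
Definition fibre_average y z : R := (p z * s' y (f z) / p' (f z))%R.

Lemma fibre_average_ge0 y z : (0 <= fibre_average y z)%R.
Proof. by rewrite divr_ge0 ?mulr_ge0 ?(pmass_ge0 pm) ?(pmass_ge0 p'm) ?(pmass_ge0 (s'm y)). Qed.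

Let mix_pos y z : (0 < m y)%R -> (0 < s y z)%R -> (0 < p z)%R.
Proof.
move=> my sz; rewrite -lte_fin -(expect_ind (pmass_ge0 pm) z) mix //.
under eq_expect => x do rewrite (expect_ind (pmass_ge0 (sm x))).
apply: lt_le_trans (tsum_ge_term y _); first by rewrite -EFinM lte_fin mulr_gt0.
by move=> x; rewrite -EFinM lee_fin mulr_ge0 ?(pmass_ge0 mm) ?(pmass_ge0 (sm x)).
Qed.

Let s_pos y z : (0 < s y z)%R -> (0 < s' y (f z))%R.
Proof. by move=> h; apply: lt_le_trans h (push_ge_term f z (sm y)). Qed.

Let p_pos z : (0 < p z)%R -> (0 < p' (f z))%R.
Proof. by move=> h; apply: lt_le_trans h (push_ge_term f z pm). Qed.

Lemma fibre_average_gt0 y z : (0 < m y)%R -> (0 < s y z)%R ->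
  (0 < fibre_average y z)%R.
Proof.
move=> my sz; have pz := mix_pos my sz.
by rewrite divr_gt0 ?mulr_gt0 ?p_pos ?s_pos.
Qed.

Lemma fibre_average_sum y : \tsum_z (fibre_average y z)%:E <= 1.
Proof.
pose c u := (s' y u / p' u)%R.
have c0 u : 0 <= (c u)%:E by rewrite lee_fin divr_ge0 ?(pmass_ge0 p'm) ?(pmass_ge0 (s'm y)).
have -> : \tsum_z (fibre_average y z)%:E = expect p (fun z => (c (f z))%:E).
  by apply: eq_tsum => z; rewrite -EFinM mulrA.
rewrite -(expect_push pm f c0) -(proj2 (s'm y)); apply: le_tsum => u.
rewrite -/p' -EFinM lee_fin /c; have [->|p0] := eqVneq (p' u) 0%R.
  by rewrite mul0r (pmass_ge0 (s'm y)).
by rewrite mulrCA divff // mulr1.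
Qed.

Definition fibre_divergence y := \tsum_z (divergence (s y z) (fibre_average y z))%:E.

Lemma fibre_divergence_ge0 y : (0 < m y)%R -> 0 <= fibre_divergence y.
Proof.
move=> my; apply: tsum_ge0 => z; rewrite lee_fin divergence_ge0 ?(pmass_ge0 (sm y)) //.
  exact: fibre_average_ge0.
exact: fibre_average_gt0.
Qed.

(** Expanding the logarithm of [fibre_average] expresses the divergence
through the entropies of [s y] and of its image and through the mixture; the terms are
distributed on both sides because extended reals do not subtract well. *)
Lemma fibre_divergence_entropy y : (0 < m y)%R ->
  fibre_divergence y + (shannon_entropy (s y) +
    expect (s y) (fun z => (- ln (p' (f z)))%:E)) <=
  shannon_entropy (s' y) + expect (s y) (fun z => (- ln (p z))%:E).
Proof.
move=> my; have s0 := pmass_ge0 (sm y).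
have l0 (T : choiceType) (q : T -> R) x : probability_mass q -> (0 <= - ln (q x))%R.
  by move=> qm; rewrite oppr_ln_ge0 // pmass_le1.
pose A z := (divergence (s y z) (fibre_average y z))%:E.
pose B (q : Z -> R) z := (s y z)%:E * (- ln (q z))%:E.
have A0 z : 0 <= A z.
  by rewrite lee_fin divergence_ge0 ?fibre_average_ge0 //; apply: fibre_average_gt0.
have B0 (T : choiceType) (q : T -> R) (g : Z -> T) z : probability_mass q ->
    0 <= B (q \o g) z by move=> qm; apply: mule_ge0; rewrite lee_fin //; apply: (l0 _ q).
have S0 z : 0 <= (s y z)%:E by rewrite lee_fin.
have r0 z : 0 <= (fibre_average y z)%:E by rewrite lee_fin fibre_average_ge0.
have Bs := B0 _ _ id ^~ (sm y); have Bp := B0 _ _ id ^~ pm.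
have Bs' := B0 _ _ f ^~ (s'm y); have Bp' := B0 _ _ f ^~ p'm.
rewrite -(@leeD2rE _ 1) // (entropy_push f (sm y)) entropyE -{1}(proj2 (sm y)).
apply: (@le_trans _ _ (\tsum_z (fibre_average y z)%:E +
  (\tsum_z B (s' y \o f) z + \tsum_z B p z))); last first.
  by rewrite addeC; apply: leeD2l; apply: fibre_average_sum.
have -> : \tsum_z (fibre_average y z)%:E +
    (\tsum_z B (s' y \o f) z + \tsum_z B p z) =
    \tsum_z ((fibre_average y z)%:E + (B (s' y \o f) z + B p z)).
  by rewrite !tsumD // => z; apply: adde_ge0.
change (\tsum_z A z + (\tsum_z B (s y) z + \tsum_z B (p' \o f) z) +
  \tsum_z (s y z)%:E <= \tsum_z ((fibre_average y z)%:E + (B (s' y \o f) z + B p z))).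
have -> : \tsum_z A z + (\tsum_z B (s y) z + \tsum_z B (p' \o f) z) +
    \tsum_z (s y z)%:E = \tsum_z (A z + (B (s y) z + B (p' \o f) z) + (s y z)%:E).
  by rewrite !tsumD // => z; rewrite !adde_ge0.
apply: le_tsum => z; rewrite /A /B -!EFinM -!EFinD lee_fin.
have := s0 z; rewrite le_eqVlt => /predU1P[<-|sz].
  by rewrite /divergence !mul0r; lra.
have pz := mix_pos my sz.
rewrite /divergence /fibre_average ln_div ?lnM ?posrE ?mulr_gt0 ?s_pos ?p_pos //.
by rewrite /=; lra.
Qed.

(** Chain rule: on average over [y], the divergence is the conditional
entropy given [f] under the mixture minus the same quantity under the components. *)
Lemma fibre_divergence_mean (a a' b b' : R) :
  (forall y, shannon_entropy (s y) = a%:E) ->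
  (forall y, shannon_entropy (s' y) = a'%:E) ->
  shannon_entropy p = b%:E -> shannon_entropy p' = b'%:E ->
  \tsum_y (if (0 < m y)%R then (m y)%:E * fibre_divergence y else 0) <=
  ((b - b') - (a - a'))%:E.
Proof.
move=> Ha Ha' Hb Hb'.
have l0 (T : choiceType) (q : T -> R) x : probability_mass q -> 0 <= (- ln (q x))%:E.
  by move=> qm; rewrite lee_fin oppr_ln_ge0 // pmass_le1.
have m0 := pmass_ge0 mm.
pose E1 y := expect (s y) (fun z => (- ln (p' (f z)))%:E).
pose E2 y := expect (s y) (fun z => (- ln (p z))%:E).
have E10 y : 0 <= E1 y by apply: expect_ge0 => z; [apply: pmass_ge0 | apply: l0].
have E20 y : 0 <= E2 y by apply: expect_ge0 => z; [apply: pmass_ge0 | apply: l0].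
have bE : expect m E2 = b%:E by rewrite -Hb entropyE mix // => z; apply: l0.
have b'E : expect m E1 = b'%:E.
  by rewrite -Hb' (entropy_push f pm) mix // => z; apply: l0.
have [y0 _] : exists y, (0 < m y)%R.
  apply/not_existsP => h; have : 0 = 1 :> \bar R.
    rewrite -(proj2 mm) tsum0 // => y; congr EFin; apply/eqP.
    by have := m0 y; rewrite le_eqVlt => /predU1P[<-//|/h].
  by move=> /eqP; rewrite eq_sym onee_eq0.
have a0 : 0 <= a%:E by rewrite -(Ha y0); apply: entropy_ge0.
have a'0 : 0 <= a'%:E by rewrite -(Ha' y0); apply: entropy_ge0.
set S := \tsum_y _.
have S0 y : 0 <= if (0 < m y)%R then (m y)%:E * fibre_divergence y else 0.
  by case: ifP => // my; rewrite mule_ge0 ?lee_fin ?fibre_divergence_ge0.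
suff : S + (a%:E + b'%:E) <= a'%:E + b%:E.
  move=> h; rewrite -(@leeD2rE _ (a%:E + b'%:E)) //; apply: (le_trans h).
  by rewrite -!EFinD lee_fin; lra.
rewrite -(expect_cst mm a0) -(expect_cst mm a'0).
rewrite -b'E -bE -(expectD m0) // -(expectD m0) //.
rewrite /S /expect -tsumD // => [|y]; last first.
  by rewrite mule_ge0 ?lee_fin // adde_ge0 // a0.
apply: le_tsum => y; have := m0 y; rewrite le_eqVlt => /predU1P[<-|my].
  by rewrite ltxx !mul0e adde0.
rewrite my -ge0_muleDr ?fibre_divergence_ge0 ?adde_ge0  //.
apply: lee_wpmul2l; first by rewrite lee_fin.
by rewrite -(Ha y) -(Ha' y); apply: fibre_divergence_entropy.
Qed.

(** Pinsker's inequality, tested on a function with values in the unit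
interval. *)
Lemma expect_dist_fibre_average y (phi : Z -> R) (del D : R) : (0 < m y)%R ->
  (forall z, 0 <= phi z <= 1)%R -> (0 < del)%R -> fibre_divergence y <= D%:E ->
  let c := (2 * del + D / (2 * del))%R in
  expect (s y) (fun z => (phi z)%:E) <=
    expect (fibre_average y) (fun z => (phi z)%:E) + c%:E /\
  expect (fibre_average y) (fun z => (phi z)%:E) <=
    expect (s y) (fun z => (phi z)%:E) + c%:E.
Proof.
move=> my phi01 del0 hD c.
pose r := fibre_average y; pose A z := divergence (s y z) (r z).
have s0 := pmass_ge0 (sm y).
have r0 : forall z, (0 <= r z)%R := fibre_average_ge0 y.
have A0 z : (0 <= A z)%R by apply: divergence_ge0 => //; apply: fibre_average_gt0.
have dp : (0 <= (2 * del)^-1)%R by rewrite invr_ge0; lra.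
pose w z : R := (del * (s y z + r z) + A z * (2 * del)^-1)%R.
have w0 z : (0 <= w z)%R.
  apply: addr_ge0; apply: mulr_ge0 => //; first exact: ltW.
  exact: addr_ge0.
have wc : \tsum_z (w z)%:E <= c%:E.
  have -> : \tsum_z (w z)%:E = del%:E * (\tsum_z (s y z)%:E + \tsum_z (r z)%:E)
      + (\tsum_z (A z)%:E) * ((2 * del)^-1)%:E.
    rewrite -tsumD ?lee_fin // -tsumZ ?lee_fin ?(ltW del0) //; last first.
      by move=> z; rewrite -EFinD lee_fin addr_ge0.
    rewrite -tsumZr ?lee_fin // -tsumD //.
    - by move=> z; rewrite -EFinD -EFinM lee_fin mulr_ge0 ?addr_ge0 // ltW.
    - by move=> z; rewrite -EFinM lee_fin mulr_ge0.
  rewrite (proj2 (sm y)) /c EFinD (EFinM 2); apply: leeD.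
    rewrite [leRHS]muleC; apply: lee_wpmul2l; first by rewrite lee_fin ltW.
    have -> : 2%:E = 1 + 1 :> \bar R by rewrite -EFinD.
    by apply: leeD2l; apply: fibre_average_sum.
  by rewrite EFinM; apply: lee_wpmul2r; rewrite ?lee_fin.
have key (u v : Z -> R) : (forall z, 0 <= u z)%R -> (forall z, 0 <= v z)%R ->
    (forall z, u z <= v z + w z)%R ->
    expect u (fun z => (phi z)%:E) <= expect v (fun z => (phi z)%:E) + c%:E.
  move=> u0 v0 uvw; apply: le_trans (leeD2l _ wc).
  rewrite /expect -tsumD => [|z|z]; last 2 first.
  - by rewrite -EFinM lee_fin mulr_ge0 //; have /andP[] := phi01 z.
  - by rewrite lee_fin.
  apply: le_tsum => z; rewrite -!EFinM -EFinD lee_fin.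
  have /andP[f0 f1] := phi01 z; have := uvw z; have := w0 z; have := u0 z.
  by have := v0 z; nra.
have dist z : (`|s y z - r z| <= w z)%R.
  by apply: dist_le_divergence => //; apply: fibre_average_gt0.
by split; apply: key => // z; have := dist z; rewrite /r ler_norml => /andP[]; lra.
Qed.

End ConditionalInformation.

(** * Consequences of an equality of entropies *)

Section EqualEntropies.
Variables (R : realType) (G : groupType) (mu : G -> R).
Hypothesis hmu : probability_mass mu.
Hypothesis hent : (shannon_entropy mu < +oo)%E.
Variables M N : normal_subgroup G.
Hypothesis MN : M `<=` N.
Hypothesis hMN : (quotient_entropy mu M <= quotient_entropy mu N)%E.

(** The conditional entropy of the position modulo [M] given the position modulo
[N], at time [n]. *)
Definition fibre_entropy n := qstep mu M n - qstep mu N n.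

(** If the increments over [k] steps were all larger than [e], the fibre
entropy would grow linearly, and [M] would have more asymptotic entropy than [N]. *)
Lemma small_increment k (e : R) : (0 < k)%N -> 0 < e ->
  exists i, fibre_entropy (k * i.+1) - fibre_entropy (k * i) <= e.
Proof.
move=> k0 e0; apply/not_existsP => h.
have grow i : fibre_entropy 0 + i%:R * e <= fibre_entropy (k * i).
  elim: i => [|i IH]; first by rewrite muln0 mul0r addr0.
  by have /negP := h i; rewrite -ltNge -natr1 mulrDl mul1r; lra.
have [a [aE a0 _ ac]] := quotient_entropyP hmu hent M.
have [b [bE b0 _ bc]] := quotient_entropyP hmu hent N.
move: hMN; rewrite aE bE lee_fin => ab.
have abc : (fun n => n%:R^-1 * fibre_entropy n) @ \oo --> a - b.
  rewrite [X in X @ _](_ : _ = fun n => n%:R^-1 * qstep mu M n - n%:R^-1 * qstep mu N n).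
    exact: cvgB.
  by apply/funext => n; rewrite mulrBr.
have k0R : 0 < k%:R :> R by rewrite ltr0n.
have ek : 0 < e / k%:R / 2 by rewrite !divr_gt0.
have [n0 _ hn0] : \forall n \near \oo, n%:R^-1 * fibre_entropy n < a - b + e / k%:R / 2.
  by apply: (cvgr_lt _ abc); rewrite ltrDl.
have [n1 _ hn1] : \forall n \near \oo, `|fibre_entropy 0| / (e / 2) < n%:R :> R.
  exact: nbhs_infty_gtr.
pose i := (maxn n0 n1).+1.
have i0 : 0 < i%:R :> R by rewrite ltr0n.
have /= h1 := hn0 (k * i)%N; have /= h2 := hn1 i.
have {}h1 : (k * i)%:R^-1 * fibre_entropy (k * i) < a - b + e / k%:R / 2.
  by apply: h1; rewrite /= (leq_trans (leq_maxl n0 n1)) // (leq_trans (leqnSn _)) // leq_pmull.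
have {h2} : `|fibre_entropy 0| / (e / 2) < i%:R.
  by apply: h2; rewrite /= (leq_trans (leq_maxr n0 n1)).
rewrite ltr_pdivrMr; last by lra.
have := grow i; move: h1; rewrite natrM invfM -ltr_pdivlMl; last first.
  by rewrite mulr_gt0 ?invr_gt0.
rewrite invfM !invrK => h1 h2 h3.
have : k%:R * i%:R * (a - b + e / k%:R / 2) <= i%:R * e / 2.
  have : k%:R * i%:R * (a - b) <= 0 by rewrite pmulr_rle0 ?mulr_gt0 //; lra.
  have -> : k%:R * i%:R * (a - b + e / k%:R / 2) =
    k%:R * i%:R * (a - b) + i%:R * e / 2 by field; rewrite gt_eqF.
  by lra.
have := ler_norm (- fibre_entropy 0); rewrite normrN.
by lra.
Unshelve. all: by end_near. Qed.

Lemma push_comp (T U V : choiceType) (f : T -> U) (g : U -> V) (p : T -> R) :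
  probability_mass p ->
  pushforward_mass g (pushforward_mass f p) = pushforward_mass (g \o f) p.
Proof.
move=> pm; have fm := push_pmass pm f; apply: mass_ext => [x|x|phi f0].
- exact: push_ge0.
- exact: push_ge0.
by rewrite (expect_push fm) // !expect_push // => x; apply: f0.
Qed.

Lemma entropy_translate (K : normal_subgroup G) y (q : G -> R) : probability_mass q ->
  shannon_entropy (pushforward_mass (fun g => quotient_map K (y * g)%g) q) =
  shannon_entropy (qlaw K q).
Proof.
move=> qm; apply/eqP; rewrite eq_le !entropy_factor // => g h;
  by rewrite !quotient_mapP invgM -mulgA mulKg.
Qed.

Lemma quotient_map_absorb (K : normal_subgroup G) y g : ns_set K y ->
  quotient_map K (y * g)%g = quotient_map K g.
Proof.
move=> Ky; apply/quotient_mapP.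
by have := ns_conj g (ns_inv Ky); rewrite /conjg invgM mulgA.
Qed.

(** The increment of the fibre entropy over the first [k] steps is the mean,
over the element [y] reached at time [k], of the divergence between the law of
[y * g] modulo [M] and its fibre average.  An increment that is small compared with the
masses of the elements of [Y] makes each of these divergences small.  For [y] in [N] the
law modulo [N] does not depend on [y], hence neither does the fibre average, and all the
laws are close to a common one. *)
Lemma translates_close k (Y : seq G) (phi : G -> R) (eta : R) : (0 < k)%N -> 0 < eta ->
  (forall y, y \in Y -> ns_set N y /\ 0 < convolution_power mu k y) ->
  (forall g, 0 <= phi g <= 1) ->
  (forall g h, quotient_map M g = quotient_map M h -> phi g = phi h) ->
  exists i, forall y y', y \in Y -> y' \in Y ->
    (expect (convolution_power mu (k * i)) (fun g => (phi (y * g)%g)%:E) <=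
     expect (convolution_power mu (k * i)) (fun g => (phi (y' * g)%g)%:E) + eta%:E)%E.
Proof.
move=> k0 eta0 YN phi01 phiM.
have [c c0 cY] : exists2 c : R, 0 < c & forall y, y \in Y -> c <= convolution_power mu k y.
  elim: Y YN => [|a Y IH] YN; first by exists 1.
  have [c c0 cY] := IH (fun y yY => YN y (mem_behead (yY : y \in behead (a :: Y)))).
  exists (Num.min c (convolution_power mu k a)).
    by rewrite lt_min c0 (proj2 (YN a (mem_head _ _))).
  by move=> y; rewrite inE ge_min => /predU1P[->|/cY ->//]; rewrite lexx orbT.
(* With [del = eta / 8] both terms of the bound of [expect_dist_fibre_average] are [eta / 4]. *)
pose D := eta ^+ 2 / 16; have D0 : 0 < D by rewrite divr_gt0 ?exprn_gt0.
have [i hi] := small_increment k0 (mulr_gt0 c0 D0).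
exists i; pose m := convolution_power mu k; pose q := convolution_power mu (k * i).
have mm : probability_mass m by apply: power_pmass.
have qm : probability_mass q by apply: power_pmass.
pose s y := pushforward_mass (fun g => quotient_map M (y * g)%g) q.
have sm y : probability_mass (s y) by apply: push_pmass.
pose p := qlaw M (convolution_power mu (k + k * i)).
have pkm : probability_mass (convolution_power mu (k + k * i)) by apply: power_pmass.
have pm : probability_mass p by apply: push_pmass.
(* The map from [G / M] to [G / N]. *)
pose f (z : quot_group M) := quotient_map N (quotient_repr z).
have fM g : f (quotient_map M g) = quotient_map N g.
  by apply: (quotient_map_sub MN); rewrite quotient_reprK.
have mix phi0 : (forall z, (0 <= phi0 z)%E) ->
    expect p phi0 = expect m (fun y => expect (s y) phi0).
  move=> h0; rewrite expect_push // expect_powerD //; last by move=> x; apply: h0.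
  by apply: eq_expect => y; rewrite expect_push.
have s'E y : pushforward_mass f (s y) =
    pushforward_mass (fun g => quotient_map N (y * g)%g) q.
  by rewrite push_comp //; congr pushforward_mass; apply/funext => g /=; rewrite fM.
have p'E : pushforward_mass f p = qlaw N (convolution_power mu (k + k * i)).
  by rewrite push_comp //; congr pushforward_mass; apply/funext => g /=; rewrite fM.
have info := @fibre_divergence_mean R _ _ _ m s p f mm sm pm mix (qstep mu M (k * i))
  (qstep mu N (k * i)) (qstep mu M (k + k * i)) (qstep mu N (k + k * i)).
have {}info : (\tsum_y (if (0 < m y)%R then (m y)%:E * fibre_divergence s p f y else 0)
    <= (c * D)%:E)%E.
  apply: le_trans (info _ _ _ _) _.
  - by move=> y; rewrite entropy_translate // qstepE.
  - by move=> y; rewrite s'E entropy_translate // qstepE.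
  - by rewrite qstepE.
  - by rewrite p'E qstepE.
  by rewrite lee_fin; move: hi; rewrite /fibre_entropy mulnS; lra.
have fd y : y \in Y -> (fibre_divergence s p f y <= D%:E)%E.
  move=> yY; have cy := cY _ yY; have my : 0 < m y by apply: lt_le_trans cy.
  have fd0 := fibre_divergence_ge0 f mm sm pm mix my.
  have t0 x : (0 <= if (0 < m x)%R then (m x)%:E * fibre_divergence s p f x else 0)%E.
    case: ifP => // mx; apply: mule_ge0; first by rewrite lee_fin ltW.
    exact: (fibre_divergence_ge0 f mm sm pm mix).
  have := le_trans (tsum_ge_term y t0) info; rewrite /= my EFinM => h.
  rewrite -(@lee_pmul2l _ c%:E) ?lte_fin //; apply: le_trans h.
  by apply: lee_wpmul2r => //; rewrite lee_fin.
have avg y y' : y \in Y -> y' \in Y -> fibre_average s p f y = fibre_average s p f y'.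
  move=> yY y'Y; apply/funext => z; rewrite /fibre_average !s'E.
  have -> // : (fun g => quotient_map N (y * g)%g) = (fun g => quotient_map N (y' * g)%g).
  apply/funext => g; rewrite !quotient_map_absorb //.
    by have [] := YN _ y'Y.
  by have [] := YN _ yY.
pose Phi (z : quot_group M) := phi (quotient_repr z).
have PhiM g : Phi (quotient_map M g) = phi g by apply: phiM; rewrite quotient_reprK.
have Phi01 z : 0 <= Phi z <= 1 by apply: phi01.
have sPhi y : expect (s y) (fun z => (Phi z)%:E) =
    expect q (fun g => (phi (y * g)%g)%:E).
  rewrite expect_push //; last by move=> z; rewrite lee_fin; have /andP[] := Phi01 z.
  by apply: eq_expect => g /=; rewrite PhiM.
have del0 : 0 < eta / 8 by rewrite divr_gt0.
move=> y y' yY y'Y; rewrite -!sPhi.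
have my x : x \in Y -> 0 < m x by move=> xY; apply: lt_le_trans (cY _ xY).
have [le1 _] := expect_dist_fibre_average (f := f) mm sm pm mix (my _ yY) Phi01 del0 (fd _ yY).
have [_ le2] := expect_dist_fibre_average (f := f) mm sm pm mix (my _ y'Y) Phi01 del0 (fd _ y'Y).
apply: (le_trans le1); rewrite (avg _ _ yY y'Y); apply: (le_trans (leeD2r _ le2)).
rewrite -addeA; apply: leeD2l; rewrite -EFinD lee_fin.
have -> : D / (2 * (eta / 8)) = eta / 4 by rewrite /D; field; rewrite gt_eqF.
by lra.
Qed.

End EqualEntropies.

(** * l2 contraction and almost invariant sets *)

Section RealExpectation.
Variables (R : realType) (T : choiceType) (p : T -> R).
Hypothesis pm : probability_mass p.

Definition rexpect (h : T -> R) : R := fine (expect p (fun x => (h x)%:E)).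

Lemma rexpectE (C : R) h : (forall x, 0 <= h x <= C) ->
  (rexpect h)%:E = expect p (fun x => (h x)%:E).
Proof.
move=> h01; rewrite fineK // ge0_fin_numE; last first.
  by apply: expect_ge0 => x; [apply: pmass_ge0 | have /andP[] := h01 x].
apply: (@le_lt_trans _ _ (expect p (fun=> (Num.max 0 C)%:E))).
  apply: le_expect => x; first exact: pmass_ge0.
  by rewrite lee_fin le_max; have /andP[_ ->] := h01 x; rewrite orbT.
by rewrite expect_cst ?ltry // le_max lexx.
Qed.

Lemma rexpect_bounds (C : R) h : (forall x, 0 <= h x <= C) -> 0 <= C ->
  0 <= rexpect h <= C.
Proof.
move=> h01 C0; rewrite -!lee_fin (rexpectE h01); apply/andP; split.
  by apply: expect_ge0 => x; [apply: pmass_ge0 | have /andP[] := h01 x].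
rewrite -(expect_cst pm C0); apply: le_expect => x; first exact: pmass_ge0.
by have /andP[] := h01 x.
Qed.

Lemma rexpect_dist (h : T -> R) (c : R) : (forall x, 0 <= h x <= 1) -> 0 <= c <= 1 ->
  (`|rexpect h - c|%:E <= expect p (fun x => `|h x - c|%:E))%E.
Proof.
move=> h01 /andP[c0 c1]; have p0 := pmass_ge0 pm.
have d01 x : 0 <= `|h x - c| <= 1.
  by rewrite normr_ge0 ler_norml; have /andP[] := h01 x; lra.
rewrite -(rexpectE d01) lee_fin ler_norml.
have le1 : rexpect h <= rexpect (fun x => `|h x - c|) + c.
  rewrite -lee_fin EFinD (rexpectE h01) (rexpectE d01) -(expect_cst pm c0) -expectD //.
  by apply: le_expect => // x; rewrite -EFinD lee_fin; have := ler_norm (h x - c); lra.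
have le2 : c <= rexpect h + rexpect (fun x => `|h x - c|).
  rewrite -lee_fin EFinD (rexpectE h01) (rexpectE d01) -(expect_cst pm c0) -expectD //.
    apply: le_expect => // x; rewrite -EFinD lee_fin.
    by have := ler_norm (- (h x - c)); rewrite normrN; lra.
  by move=> x; rewrite lee_fin; have /andP[] := h01 x.
by lra.
Qed.

Lemma tsum_ge2 (f : T -> \bar R) a b : (forall x, 0 <= f x)%E -> a != b ->
  (f a + f b <= \tsum_x f x)%E.
Proof.
move=> f0 ab; rewrite -(tsum_ifeq (a := a) (f := f)) // -(tsum_ifeq (a := b) (f := f)) //.
rewrite -tsumD; [|by move=> x; case: ifP..].
apply: le_tsum => x; case: eqP => [->|_].
  by rewrite (negbTE ab) adde0.
by rewrite add0e; case: ifP.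
Qed.

(** The variance of [h] is at least the part of it coming from two atoms of mass
at least [c]. *)
Lemma rexpect_sqr (h : T -> R) (c : R) a b : (forall x, 0 <= h x <= 1) ->
  0 <= c -> c <= p a -> c <= p b ->
  (((rexpect h) ^+ 2 + c / 2 * (h a - h b) ^+ 2)%:E <=
   expect p (fun x => (h x ^+ 2)%:E))%E.
Proof.
move=> h01 c0 ca cb; set m := rexpect h.
have p0 := pmass_ge0 pm.
have /andP[m0 m1] : 0 <= m <= 1 by apply: rexpect_bounds.
have h0 x : 0 <= h x by have /andP[] := h01 x.
have sq01 x : 0 <= h x ^+ 2 <= 1 by rewrite sqr_ge0 expr_le1 //; have /andP[] := h01 x.
have dd x : 0 <= (h x - m) ^+ 2 <= 1.
  rewrite sqr_ge0 /= -real_normK ?num_real // expr_le1 // ler_norml.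
  by have /andP[] := h01 x; lra.
have id1 : rexpect (fun x => h x ^+ 2) + m ^+ 2 =
    rexpect (fun x => (h x - m) ^+ 2) + 2 * m * m.
  apply: EFin_inj; rewrite !EFinD (rexpectE sq01) (rexpectE dd).
  rewrite (EFinM (2 * m)) [in (_ * _)%E](rexpectE h01) -expectZ ?lee_fin ?mulr_ge0 //.
  rewrite -(expect_cst pm (sqr_ge0 m)) -!expectD //;
    try by move=> x; rewrite -?EFinM lee_fin ?sqr_ge0 ?mulr_ge0.
  by apply: eq_expect => x; rewrite -EFinM -!EFinD; congr EFin; ring.
have var : c * ((h a - m) ^+ 2 + (h b - m) ^+ 2) <= rexpect (fun x => (h x - m) ^+ 2) \/ h a = h b.
  have [->|ab] := eqVneq a b; first by right.
  left; rewrite -lee_fin (rexpectE dd) /expect.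
  apply: le_trans (tsum_ge2 _ ab); last by move=> x; rewrite mule_ge0 ?lee_fin ?sqr_ge0.
  by rewrite -!EFinM -EFinD lee_fin mulrDr lerD // ler_wpM2r ?sqr_ge0.
rewrite -(rexpectE sq01) lee_fin.
have /andP[v0 _] := rexpect_bounds dd ler01.
case: var => [var|->]; last by rewrite subrr expr0n mulr0; lra.
have : c / 2 * (h a - h b) ^+ 2 <= c * ((h a - m) ^+ 2 + (h b - m) ^+ 2).
  have := sqr_ge0 ((h a - m) + (h b - m)) => s.
  have : 0 <= c * ((h a - m) + (h b - m)) ^+ 2 by rewrite mulr_ge0.
  by lra.
by lra.
Qed.

End RealExpectation.

Lemma contract_arith (R : realType) (c v D w : R) : 0 < c ->
  v + c / 4 * D <= w -> 2 * w <= 3 / 2 * w + 3 * D -> v <= (1 - c / 24) * w.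
Proof.
move=> c0 h1 h2.
have h3 : 0 <= D - w / 6 by lra.
have : 0 <= c * (D - w / 6) by rewrite mulr_ge0 // ltW.
by lra.
Qed.

Lemma bound_arith (R : realType) (c C : R) : 0 <= C * (c / 48) * (c / 24) ->
  (1 + c / 48) * ((1 - c / 24) * C) + C * (c / 48) <= C.
Proof. by lra. Qed.

Section ActionOperator.
Variables (R : realType) (G : groupType) (X : choiceType) (act : X -> G -> X).
Hypothesis act1 : forall x, act x 1%g = x.
Hypothesis actM : forall x g h, act x (g * h)%g = act (act x g) h.
Variable p : G -> R.
Hypothesis pm : probability_mass p.
Implicit Types f : X -> R.

Lemma act_bij g : bijective (act^~ g).
Proof. by exists (act^~ g^-1%g) => x; rewrite -actM ?mulgV ?mulVg act1. Qed.

Definition walk_operator f x : R := rexpect p (fun g => f (act x g)).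

Definition sqnorm f : \bar R := (\tsum_x (f x ^+ 2)%:E)%E.

Lemma tsum_walk_operator (f : X -> \bar R) : (forall x, 0 <= f x)%E ->
  (\tsum_x expect p (fun g => f (act x g)) = \tsum_x f x)%E.
Proof.
move=> f0; rewrite -expect_tsum; last 2 first.
- exact: pmass_ge0.
- by move=> g x; apply: f0.
rewrite /expect; under eq_tsum => g do rewrite (tsum_bij f (act_bij g)).
by rewrite tsumZr ?(proj2 pm) ?mul1e ?tsum_ge0 // => g; rewrite lee_fin pmass_ge0.
Qed.

Section Doubling.
Variables (c : R) (gam1 gam2 : X -> G).
Let psi1 x := act x (gam1 x).
Let psi2 x := act x (gam2 x).
Hypotheses (c0 : 0 < c) (c1 : c <= 1) (cp : c <= p 1%g)
  (cg1 : forall x, c <= p (gam1 x)) (cg2 : forall x, c <= p (gam2 x)).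
Hypotheses (inj1 : injective psi1) (inj2 : injective psi2)
  (disj : forall x y, psi1 x <> psi2 y).

Lemma tsum_double (f : X -> \bar R) : (forall x, 0 <= f x)%E ->
  (\tsum_x f (psi1 x) + \tsum_x f (psi2 x) <= \tsum_x f x)%E.
Proof.
move=> f0; pose A := range psi1.
rewrite (tsum_split A f0); apply: leeD.
  rewrite (@reindex_esum _ _ _ setT A psi1) //.
  by split=> [x _|x y _ _ /inj1//|y [x _ <-]]; [exists x | exists x].
rewrite [leRHS]esum_mkcond.
apply: (@le_trans _ _ (\tsum_x (if psi2 x \in ~` A then f (psi2 x) else 0%E))%E).
  apply: le_tsum => x; rewrite mem_set // => -[y _ e].
  by have := @disj y x; rewrite e.
apply: (@tsum_inj _ _ _ psi2 (fun x => if x \in ~` A then f x else 0%E)) => // y.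
by case: ifP.
Qed.

(** The loss of l2 norm under the walk is the sum of the variances, at
least a multiple of [sum (f - f psi1)^2 + sum (f - f psi2)^2].  This cannot be small
compared with the norm of [f], because the norms of [f psi1] and [f psi2] add up to at
most that of [f] instead of twice as much. *)
Lemma walk_operator_contract f : (forall x, 0 <= f x <= 1) -> (sqnorm f < +oo)%E ->
  (sqnorm (walk_operator f) <= (1 - c / 24)%:E * sqnorm f)%E.
Proof.
move=> f01 ffin; have p0 := pmass_ge0 pm.
have sq0 (h : X -> R) x : (0 <= (h x ^+ 2)%:E)%E by rewrite lee_fin sqr_ge0.
have D0 (h : X -> X) x : (0 <= ((f x - f (h x)) ^+ 2)%:E)%E by rewrite lee_fin sqr_ge0.
have fn : sqnorm f \is a fin_num by rewrite ge0_fin_numE // tsum_ge0.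
pose D1 := (\tsum_x ((f x - f (psi1 x)) ^+ 2)%:E)%E.
pose D2 := (\tsum_x ((f x - f (psi2 x)) ^+ 2)%:E)%E.
have D10 : (0 <= D1)%E by apply: tsum_ge0; apply: D0.
have D20 : (0 <= D2)%E by apply: tsum_ge0; apply: D0.
have step : (sqnorm (walk_operator f) + (c / 4)%:E * (D1 + D2) <= sqnorm f)%E.
  have c4 : (0 <= (c / 4)%:E)%E by rewrite lee_fin divr_ge0 // ltW.
  have e : sqnorm f = _ := esym (tsum_walk_operator (sq0 f)).
  rewrite [leRHS]e /D1 /D2 -tsumD; [|exact: D0..].
  rewrite -tsumZ //; last by move=> x; rewrite adde_ge0.
  rewrite -tsumD; [|exact: sq0|by move=> x; rewrite mule_ge0 ?adde_ge0].
  apply: le_tsum => x.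
  have h01 g : 0 <= f (act x g) <= 1 by [].
  have := rexpect_sqr pm h01 (ltW c0) cp (cg1 x).
  have := rexpect_sqr pm h01 (ltW c0) cp (cg2 x).
  rewrite act1 -/(psi1 x) -/(psi2 x) -/(walk_operator f x).
  have sq01 g : 0 <= f (act x g) ^+ 2 <= 1.
    by rewrite sqr_ge0 expr_le1 //; have /andP[] := f01 (act x g).
  rewrite /= -(rexpectE pm sq01) -!EFinD !lee_fin; lra.
have dbl : (2%:E * sqnorm f <= (3 / 2)%:E * sqnorm f + 3%:E * (D1 + D2))%E.
  apply: (@le_trans _ _ ((3 / 2)%:E * (\tsum_x (f (psi1 x) ^+ 2)%:E +
     \tsum_x (f (psi2 x) ^+ 2)%:E) + 3%:E * (D1 + D2))%E); last first.
    apply: leeD2r; apply: lee_wpmul2l; first by rewrite lee_fin; lra.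
    exact: (tsum_double (sq0 f)).
  have two : 2%:E = (1 + 1)%E :> \bar R by rewrite -EFinD.
  rewrite two ge0_muleDl // !mul1e.
  (* [a ^ 2 <= 3 / 2 * b ^ 2 + 3 * (a - b) ^ 2] *)
  have half (psi : X -> X) : (sqnorm f <= (3 / 2)%:E * (\tsum_x (f (psi x) ^+ 2)%:E) +
      3%:E * (\tsum_x ((f x - f (psi x)) ^+ 2)%:E))%E.
    have a0 : (0 <= (3 / 2 : R)%:E)%E by rewrite lee_fin divr_ge0.
    have b0 : (0 <= (3 : R)%:E)%E by rewrite lee_fin.
    have u0 x : (0 <= (f (psi x) ^+ 2)%:E)%E by rewrite lee_fin sqr_ge0.
    have e1 : ((3 / 2)%:E * (\tsum_x (f (psi x) ^+ 2)%:E) =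
      \tsum_x ((3 / 2)%:E * (f (psi x) ^+ 2)%:E))%E := esym (tsumZ a0 u0).
    have e2 : (3%:E * (\tsum_x ((f x - f (psi x)) ^+ 2)%:E) =
      \tsum_x (3%:E * ((f x - f (psi x)) ^+ 2)%:E))%E := esym (tsumZ b0 (D0 psi)).
    rewrite e1 e2 -tsumD => [|x|x]; try exact: mule_ge0.
    apply: le_tsum => x; rewrite -!EFinD lee_fin.
    by have := sqr_ge0 (f (psi x) - 2 * (f x - f (psi x))); lra.
  rewrite !ge0_muleDr ?tsum_ge0 // addeACA.
  by apply: leeD; apply: half.
move: step dbl; have : (0 <= D1 + D2)%E by rewrite adde_ge0.
have : (0 <= sqnorm (walk_operator f))%E by apply: tsum_ge0; apply: sq0.
rewrite -(fineK fn); set w := fine (sqnorm f).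
case: (sqnorm (walk_operator f)) => [v| |] // v0; case: (D1 + D2)%E => [D| |] // DD0.
- rewrite -!EFinM -!EFinD !lee_fin => h1 h2.
  exact: contract_arith h1 h2.
- by rewrite gt0_muley ?lte_fin ?divr_gt0.
- by rewrite gt0_muley ?lte_fin ?divr_gt0.
Qed.

End Doubling.

Section AlmostInvariantSet.
Variables (E : X -> bool) (L : G -> R).
Let e x : R := (E x)%:R.
Hypotheses (L0 : forall g, 0 <= L g) (Lfin : (expect p (fun g => (L g)%:E) < +oo)%E).
Hypothesis EL : forall g, (\tsum_x (`|e (act x g) - e x|)%:E <= (L g)%:E)%E.

Definition hitting n x : R :=
  rexpect (convolution_power p n) (fun g => (E (act x g))%:R).

Definition defect n x : R := `|hitting n x - (E x)%:R|.

Let e01 x : 0 <= e x <= 1. Proof. by rewrite /e; case: (E x); rewrite ?lexx ?ler01. Qed.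

Lemma hitting01 n x : 0 <= hitting n x <= 1.
Proof. by apply: (rexpect_bounds (power_pmass n pm)) => // g; apply: e01. Qed.

Lemma dist01 (a b : R) : 0 <= a <= 1 -> 0 <= b <= 1 -> 0 <= `|a - b| <= 1.
Proof. by move=> ? ?; rewrite normr_ge0 ler_norml; lra. Qed.

Lemma defect01 n x : 0 <= defect n x <= 1.
Proof. by apply: dist01; [apply: hitting01 | apply: e01]. Qed.

Lemma hittingS n x : hitting n.+1 x = walk_operator (hitting n) x.
Proof.
apply: EFin_inj; rewrite (rexpectE (power_pmass n.+1 pm) (fun g => e01 (act x g))).
rewrite (rexpectE pm (fun g => hitting01 n (act x g))).
rewrite expect_powerS //; last by move=> y; rewrite lee_fin; have /andP[] := e01 (act x y).
apply: eq_expect => g; rewrite (rexpectE (power_pmass n pm) (fun h => e01 (act (act x g) h))).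
by apply: eq_expect => h; rewrite actM.
Qed.

Let V x : R := rexpect p (fun g => `|e (act x g) - e x|).

Let V01 x : 0 <= V x <= 1.
Proof. by apply: (rexpect_bounds pm) => // g; apply: dist01. Qed.

(** One step of the walk transports the previous defect and adds the probability
of crossing the boundary of [E]. *)
Lemma defectS n x : defect n.+1 x <= walk_operator (defect n) x + V x.
Proof.
have h1 := fun g => defect01 n (act x g).
have h2 g : 0 <= `|e (act x g) - e x| <= 1 by apply: dist01.
rewrite /defect hittingS -lee_fin.
apply: le_trans (rexpect_dist pm (fun g => hitting01 n (act x g)) (e01 x)) _.
rewrite EFinD (rexpectE pm h1) (rexpectE pm h2) -expectD; last 3 first.
- exact: pmass_ge0.
- by move=> g; rewrite lee_fin normr_ge0.
- by move=> g; rewrite lee_fin normr_ge0.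
apply: le_expect => g; first exact: pmass_ge0.
by rewrite -EFinD lee_fin /defect; apply: ler_distD.
Qed.

Lemma tsum_V : (\tsum_x (V x)%:E <= expect p (fun g => (L g)%:E))%E.
Proof.
have -> : (\tsum_x (V x)%:E = \tsum_x expect p (fun g => `|e (act x g) - e x|%:E))%E.
  by apply: eq_tsum => x; rewrite (rexpectE pm (fun g => dist01 (e01 (act x g)) (e01 x))).
rewrite -expect_tsum; last 2 first.
- exact: pmass_ge0.
- by move=> g x; rewrite lee_fin normr_ge0.
by apply: le_expect => g; [apply: pmass_ge0 | apply: EL].
Qed.

Lemma sqnorm_V : (sqnorm V <= expect p (fun g => (L g)%:E))%E.
Proof.
apply: le_trans tsum_V; apply: le_tsum => x; rewrite lee_fin.
by have /andP[v0 v1] := V01 x; rewrite expr2 ler_piMr.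
Qed.

(** The weight [c / 48] is half of the contraction rate, so that the product
of [1 + c / 48] and [1 - c / 24] stays below [1 - c / 48]. *)
Lemma sqr_addr_le (c a b : R) : 0 < c -> 0 <= a -> 0 <= b ->
  (a + b) ^+ 2 <= (1 + c / 48) * a ^+ 2 + (1 + 48 / c) * b ^+ 2.
Proof.
move=> c0 a0 b0; have k0 : 0 < c / 48 by rewrite divr_gt0.
have -> : 48 / c = (c / 48)^-1 by rewrite invf_div.
set k := c / 48 in k0 *; have := sqr_ge0 (k * a - b) => h.
have : 0 <= k^-1 * (k * a - b) ^+ 2 by rewrite mulr_ge0 ?sqr_ge0 // invr_ge0 ltW.
have -> : k^-1 * (k * a - b) ^+ 2 = k * a ^+ 2 - 2 * a * b + k^-1 * b ^+ 2.
  by field; rewrite gt_eqF.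
by lra.
Qed.

(** The defect satisfies [defectS], whose added term is in l1, hence in l2;
a contraction with a bounded forcing term has bounded iterates. *)
Lemma defect_bounded (c : R) : 0 < c <= 1 ->
  (forall f, (forall x, 0 <= f x <= 1) -> (sqnorm f < +oo)%E ->
     (sqnorm (walk_operator f) <= (1 - c / 24)%:E * sqnorm f)%E) ->
  exists2 C : R, 0 <= C & forall n, (sqnorm (defect n) <= C%:E)%E.
Proof.
move=> /andP[c0 c1] contract.
have L00 : (0 <= expect p (fun g => (L g)%:E))%E.
  by apply: expect_ge0 => g; [apply: (pmass_ge0 pm) | rewrite lee_fin].
have Lfn : expect p (fun g => (L g)%:E) \is a fin_num by rewrite ge0_fin_numE.
pose B : R := fine (expect p (fun g => (L g)%:E)).
have BE : B%:E = expect p (fun g => (L g)%:E) by rewrite fineK.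
have B0 : 0 <= B by rewrite -lee_fin BE.
have k0 : 0 <= 1 + 48 / c by rewrite addr_ge0 // divr_ge0 // ltW.
(* The fixed point of the recursive bound [C |-> (1 - c / 48) * C + (1 + 48 / c) * B]. *)
pose C := (1 + 48 / c) * B * (48 / c).
have C0 : 0 <= C by rewrite !mulr_ge0 // ?divr_ge0 // ?invr_ge0 ltW.
exists C => // n; elim: n => [|n IH].
  rewrite /sqnorm tsum0 ?lee_fin // => x; congr EFin.
  rewrite /defect /hitting /rexpect expect_power0 /= => [|g]; last by rewrite lee_fin.
  by rewrite act1 subrr normr0 expr0n.
have nfin : (sqnorm (defect n) < +oo)%E by apply: le_lt_trans IH (ltry _).
have W := contract _ (defect01 n) nfin.
have a0 : (0 <= (1 + c / 48)%:E)%E by rewrite lee_fin addr_ge0 // divr_ge0 // ltW.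
have b0 : (0 <= (1 + 48 / c)%:E)%E by rewrite lee_fin.
have sq0 (h : X -> R) x : (0 <= (h x ^+ 2)%:E)%E by rewrite lee_fin sqr_ge0.
have s1 : (sqnorm (defect n.+1) <= (1 + c / 48)%:E * sqnorm (walk_operator (defect n)) +
     (1 + 48 / c)%:E * sqnorm V)%E.
  have e1 : ((1 + c / 48)%:E * sqnorm (walk_operator (defect n)) = _)%E
    := esym (tsumZ a0 (sq0 (walk_operator (defect n)))).
  have e2 : ((1 + 48 / c)%:E * sqnorm V = _)%E := esym (tsumZ b0 (sq0 V)).
  rewrite e1 e2 -tsumD => [|x|x]; try by apply: mule_ge0.
  apply: le_tsum => x; rewrite -!EFinM -EFinD lee_fin.
  have w0 : 0 <= walk_operator (defect n) x.
    by have /andP[] := rexpect_bounds pm (fun g => defect01 n (act x g)) ler01.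
  have /andP[v0 _] := V01 x; have /andP[d0 _] := defect01 n.+1 x.
  apply: le_trans (sqr_addr_le c0 w0 v0).
  by rewrite ler_pXn2r ?nnegrE ?addr_ge0 // defectS.
apply: (le_trans s1); apply: (@le_trans _ _ ((1 + c / 48)%:E * ((1 - c / 24)%:E * C%:E) +
   (1 + 48 / c)%:E * B%:E)%E).
  apply: leeD; apply: lee_wpmul2l => //; last by rewrite BE; apply: sqnorm_V.
  apply: (le_trans W); apply: lee_wpmul2l => //; rewrite lee_fin; lra.
rewrite -!EFinM -EFinD lee_fin.
have CB : (1 + 48 / c) * B = C * (c / 48).
  by rewrite /C; field; rewrite gt_eqF.
have k48 : 0 <= c / 48 by rewrite divr_ge0 // ltW.
have k24 : 0 <= c / 24 by rewrite divr_ge0 // ltW.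
by rewrite CB; exact: bound_arith (mulr_ge0 (mulr_ge0 C0 k48) k24).
Qed.

End AlmostInvariantSet.
End ActionOperator.

(** * A criterion for a strict increase of entropy *)

Section Reachability.
Variables (R : realType) (G : groupType) (mu : G -> R).
Hypothesis hmu : probability_mass mu.
Implicit Types g h : G.

Lemma power_gt0M m n g h : 0 < convolution_power mu m g ->
  0 < convolution_power mu n h -> 0 < convolution_power mu (m + n) (g * h)%g.
Proof.
move=> g0 h0; rewrite -power_conv //.
apply: lt_le_trans (mulr_gt0 g0 h0) _.
by apply: conv_ge_term; apply: power_pmass.
Qed.

Lemma power_gt0X m g j : 0 < convolution_power mu m g ->
  0 < convolution_power mu (m * j) (g ^+ j)%g.
Proof.
move=> g0; elim: j => [|j IH]; first by rewrite muln0 expg0 /= eqxx ltr01.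
by rewrite mulnS expgS; apply: power_gt0M.
Qed.

Lemma nondegenerate_reach g : nondegenerate_mass mu ->
  exists2 n, (0 < n)%N & 0 < convolution_power mu n g.
Proof.
move=> nd; have : [set: G] g by [].
rewrite -nd => /(_ [set g | exists2 n, (0 < n)%N & 0 < convolution_power mu n g]).
apply; split=> [x y [m m0 mx] [n n0 ny]|x mx].
  by exists (m + n)%N; [rewrite addn_gt0 m0 | apply: power_gt0M].
by exists 1%N => //; rewrite power1.
Qed.

(** Returning to the identity at time [b] allows waiting, so that the
[b]-th powers of finitely many elements are all reached at the same times.  This is why
[b]-th powers occur in the doubling hypothesis of [entropy_gap]. *)
Lemma power_gt0_common b (S : seq G) : nondegenerate_mass mu -> (0 < b)%N ->
  0 < convolution_power mu b 1%g ->
  exists k0, forall k, (k0 <= k)%N -> forall g, g \in S ->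
    0 < convolution_power mu (b * k) (g ^+ b)%g.
Proof.
move=> nd b0 b1; elim: S => [|a S [k0 IH]]; first by exists 0%N.
have [n n0 na] := nondegenerate_reach a nd.
exists (maxn n k0) => k; rewrite geq_max => /andP[nk k0k] g.
rewrite inE => /predU1P[->|]; last exact: IH.
have -> : (b * k = n * b + b * (k - n))%N by rewrite [(n * b)%N]mulnC -mulnDr subnKC.
rewrite -[(a ^+ b)%g]mulg1 -(expg1n G (k - n)%N).
by apply: power_gt0M; apply: power_gt0X.
Qed.

End Reachability.

Lemma tsum_ge_seq (R : realType) (T : choiceType) (r : seq T) (f : T -> \bar R) :
  uniq r -> (forall x, 0 <= f x)%E -> (\sum_(x <- r) f x <= \tsum_x f x)%E.
Proof.
move=> ur f0; pose g x := if x \in r then f x else 0%E.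
have -> : (\sum_(x <- r) f x = \tsum_x g x)%E.
  rewrite (tsum_finite ur) => [|x|x].
  - by apply: eq_big_seq => x xr; rewrite /g xr.
  - by rewrite /g; case: ifP.
  - by rewrite /g => /negbTE ->.
by apply: le_tsum => x; rewrite /g; case: ifP.
Qed.

(** The two defects [1 - v] and [u] add up to at least [1 / 2]. *)
Lemma cross_arith (R : realType) (u v : R) : 0 <= u -> v <= 1 -> v <= u + 2^-1 ->
  8^-1 <= (1 - v) ^+ 2 + u ^+ 2.
Proof.
move=> u0 v1 h; have := sqr_ge0 (1 - v - u).
have : 0 <= (1 - v + u - 2^-1) * (1 - v + u + 2^-1) by rewrite mulr_ge0 //; lra.
by lra.
Qed.

Lemma count_arith (R : realType) (C : R) n : 8 * C < n%:R -> 8^-1 *+ n <= C -> False.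
Proof. by rewrite -[8^-1 *+ n]mulr_natl; move: n%:R => J; lra. Qed.

Section EntropyGap.
Variables (R : realType) (G : groupType) (mu : G -> R).
Hypothesis hmu : probability_mass mu.
Hypothesis hnd : nondegenerate_mass mu.
Hypothesis hent : (shannon_entropy mu < +oo)%E.
Variables (X : choiceType) (act : X -> G -> X).
Hypothesis act1 : forall x, act x 1%g = x.
Hypothesis actM : forall x g h, act x (g * h)%g = act (act x g) h.
Variables (E : X -> bool) (L : G -> R).
Hypotheses (L0 : forall g, 0 <= L g)
  (Lfin : forall n, (expect (convolution_power mu n) (fun g => (L g)%:E) < +oo)%E).
Hypothesis EL : forall g,
  (\tsum_x (`|(E (act x g))%:R - (E x)%:R|)%:E <= (L g)%:E)%E.
Hypothesis doubling : forall b, (0 < b)%N -> exists S : seq G, exists gam1 gam2 : X -> G,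
  [/\ forall x, gam1 x \in S /\ gam2 x \in S,
      injective (fun x => act x (gam1 x ^+ b)%g),
      injective (fun x => act x (gam2 x ^+ b)%g) &
      forall x y, act x (gam1 x ^+ b)%g <> act y (gam2 y ^+ b)%g].
Variables (K N : normal_subgroup G).
Hypothesis Kact : forall g x, ns_set K g -> act x g = x.
Variables (l : G) (x0 : X).
Hypothesis lN : ns_set N l.
Hypothesis orbit_in : forall n, (0 < n)%N -> E (act x0 (l ^+ n)%g).
Hypothesis orbit_out : forall n, (0 < n)%N -> ~~ E (act x0 (l^-1 ^+ n)%g).
Hypothesis orbit_inj1 : injective (fun n => act x0 (l ^+ n)%g).
Hypothesis orbit_inj2 : injective (fun n => act x0 (l^-1 ^+ n)%g).

Lemma ns_pow (H : normal_subgroup G) g n : ns_set H g -> ns_set H (g ^+ n)%g.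
Proof.
move=> Hg; elim: n => [|n IH]; first by rewrite expg0; apply: ns_one.
by rewrite expgS; apply: ns_mul.
Qed.

(** If the entropies were equal, the hitting probabilities of [E] from [x0 * l ^ n]
and [x0 * l ^ (- n)] would differ by less than [1 / 2] at a common time for as many [n]
as desired ([translates_close]).  Each such [n] contributes at least [1 / 8] to the
squared norm of the defect, which is bounded ([defect_bounded]). *)
Theorem entropy_gap : (quotient_entropy mu N < quotient_entropy mu (ns_cap N K))%E.
Proof.
rewrite ltNge; apply/negP => hle.
have MN : ns_cap N K `<=` N by move=> g [].
(* Times that are multiples of a return time [b] avoid all periodicity problems. *)
have [b b0 b1] := nondegenerate_reach hmu 1%g hnd.
have [S [gam1 [gam2 [gS inj1 inj2 disj]]]] := doubling b0.
have [k0 hk0] := power_gt0_common hmu S hnd b0 b1.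
pose k := maxn 1 k0; have k1 : (0 < k)%N by rewrite leq_max.
pose p := convolution_power mu (b * k).
have pm : probability_mass p by apply: power_pmass.
have p1 : 0 < p 1%g by rewrite -(expg1n G k) power_gt0X.
have pS g : g \in S -> 0 < p (g ^+ b)%g by apply: hk0; rewrite leq_maxr.
have [c [c0 c1 cS]] : exists c, [/\ 0 < c, c <= p 1%g & forall g, g \in S -> c <= p (g ^+ b)%g].
  elim: (S) pS => [|a S' IH] pS'; first by exists (p 1%g).
  have [c [c0 c1 cS]] := IH (fun g gS' => pS' g (mem_behead (gS' : g \in behead (a :: S')))).
  exists (Num.min c (p (a ^+ b)%g)); split.
  - by rewrite lt_min c0 pS' // mem_head.
  - by rewrite ge_min c1.
  - by move=> g; rewrite inE ge_min => /predU1P[->|/cS -> //]; rewrite lexx orbT.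
have cle1 : c <= 1 by apply: le_trans c1 (pmass_le1 pm _).
have contract := @walk_operator_contract R G X act act1 actM p pm c
  (fun x => (gam1 x ^+ b)%g) (fun x => (gam2 x ^+ b)%g) c0 c1
  (fun x => cS _ (gS x).1) (fun x => cS _ (gS x).2) inj1 inj2 disj.
have c01 : 0 < c <= 1 by rewrite c0.
have [C C0 hC] := defect_bounded act1 actM pm L0 (Lfin (b * k)) EL c01 contract.
have [J _ hJ] : \forall n \near \oo, 8 * C < n%:R :> R by exact: nbhs_infty_gtr.
have {}hJ : 8 * C < J.+1%:R by apply: hJ => /=.
have [js [jpos ujs sjs]] : exists js : seq nat,
    [/\ forall j, j \in js -> (0 < b * j)%N, uniq js & size js = J.+1].
  exists (iota 1 J.+1); rewrite iota_uniq size_iota; split=> // j.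
  by rewrite mem_iota muln_gt0 b0 => /andP[].
pose Yp := [seq (l ^+ b ^+ j)%g | j <- js]; pose Yn := [seq (l^-1 ^+ b ^+ j)%g | j <- js].
have [k' hk'] := power_gt0_common hmu ([seq (l ^+ j)%g | j <- js] ++ [seq (l^-1 ^+ j)%g | j <- js]) hnd b0 b1.
(* The time [kt] is a multiple of [b * k], so that the walk at time [kt * i] is also a walk of step law [p]. *)
pose kk := maxn 1 k'.
pose kt := (b * k * kk)%N.
have kt0 : (0 < kt)%N by rewrite !muln_gt0 b0 k1 leq_max.
have YN y : y \in Yp ++ Yn -> ns_set N y /\ 0 < convolution_power mu kt y.
  rewrite /kt -mulnA mem_cat => yY.
  have k'le : (k' <= k * kk)%N.
    by apply: leq_trans (leq_maxr 1 k') _; rewrite leq_pmull.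
  have comm (g : G) j : (g ^+ b ^+ j = (g ^+ j) ^+ b)%g by rewrite -!expgnA mulnC.
  case/orP: yY => /mapP[j jj ->]; split.
  - by do 2 apply: ns_pow.
  - by rewrite comm; apply: hk' => //; rewrite mem_cat map_f.
  - by do 2 apply: ns_pow; apply: ns_inv.
  - by rewrite comm; apply: hk' => //; rewrite mem_cat (map_f (fun j => l^-1 ^+ j)%g) ?orbT.
pose phi g : R := (E (act x0 g))%:R.
have phi01 g : 0 <= phi g <= 1 by rewrite /phi; case: (E _); rewrite ?lexx ?ler01.
have phiM g h : quotient_map (ns_cap N K) g = quotient_map (ns_cap N K) h -> phi g = phi h.
  move=> /quotient_mapP[_ Kgh]; rewrite /phi.
  have -> : h = (g * (g^-1 * h))%g by rewrite mulVKg.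
  by rewrite actM (Kact _ Kgh).
have half0 : 0 < 2^-1 :> R by rewrite invr_gt0.
have [i hi] := translates_close hmu hent MN hle kt0 half0 YN phi01 phiM.
pose n := (kk * i)%N.
have hitE y : expect (convolution_power mu (kt * i)) (fun g => (phi (y * g)%g)%:E) =
    (hitting act p E n (act x0 y))%:E.
  have e1 g : 0 <= ((E (act (act x0 y) g))%:R : R) <= (1 : R).
    by case: (E _); rewrite ?lexx ?ler01.
  rewrite /hitting (rexpectE (power_pmass n pm) e1) /p powerM // mulnA.
  by apply: eq_expect => g; rewrite /phi actM.
pose xp j := act x0 (l ^+ b ^+ j)%g; pose xn j := act x0 (l^-1 ^+ b ^+ j)%g.
have cross j : j \in js -> 8^-1 <= defect act p E n (xp j) ^+ 2 + defect act p E n (xn j) ^+ 2.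
  move=> jj; have j0 := jpos _ jj.
  have := hi (l ^+ b ^+ j)%g (l^-1 ^+ b ^+ j)%g.
  rewrite !mem_cat !map_f // orbT => /(_ isT isT).
  rewrite !hitE -EFinD lee_fin -/(xp j) -/(xn j).
  have := hitting01 act pm E n (xp j); have := hitting01 act pm E n (xn j).
  have -> : defect act p E n (xp j) = `|hitting act p E n (xp j) - 1|.
    by rewrite /defect /xp -expgnA orbit_in.
  have -> : defect act p E n (xn j) = `|hitting act p E n (xn j) - 0|.
    by rewrite /defect /xn -expgnA (negbTE (orbit_out j0)).
  move: (hitting _ _ _ _ (xp j)) (hitting _ _ _ _ (xn j)) => v u.
  move=> /andP[u0 u1] /andP[v0 v1] h; rewrite subr0 distrC !ger0_norm ?subr_ge0 //.
  exact: cross_arith.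
(* These points are distinct, and each pair contributes [8^-1] to the squared norm of the defect. *)
pose r := [seq xp j | j <- js] ++ [seq xn j | j <- js].
have ur : uniq r.
  have bj i1 i2 : (b * i1 = b * i2 -> i1 = i2)%N by move/eqP; rewrite eqn_pmul2l // => /eqP.
  rewrite cat_uniq !map_inj_uniq ?ujs //=; last 2 first.
  - by move=> i1 i2; rewrite /xn -!expgnA => /orbit_inj2/bj.
  - by move=> i1 i2; rewrite /xp -!expgnA => /orbit_inj1/bj.
  rewrite andbT; apply/hasPn => _ /mapP[j jj ->]; apply/negP => /mapP[j' jj' e].
  have := orbit_out (jpos _ jj); rewrite expgnA -/(xn j) e /xp -expgnA orbit_in //.
  exact: jpos.
have := le_trans (tsum_ge_seq ur (fun x => ltac:(by rewrite lee_fin sqr_ge0) :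
  (0 <= (defect act p E n x ^+ 2)%:E)%E)) (hC n).
rewrite big_cat !big_map /= -big_split /= sumEFin lee_fin => hsum.
have : \sum_(j <- js) 8^-1 <= C.
  by apply: le_trans hsum; rewrite big_seq [leRHS]big_seq ler_sum.
rewrite big_const_seq count_predT sjs iter_addr addr0 => h.
exact: (count_arith hJ h).
Qed.

End EntropyGap.

(** * Actions of the free group and finite quotients separating a ball *)

Section WordActions.
Variables (d : nat) (X : Type) (step : X -> letter d -> X).
Hypothesis stepK : forall x a, step (step x a) (inv_letter a) = x.

Definition word_act x (w : seq (letter d)) := foldl step x w.

Definition free_act x (g : free_group d) := word_act x (word_of g).

Lemma word_act_cons_red x a w : word_act x (cons_red a w) = word_act (step x a) w.
Proof. by case: w => //= b w; case: eqP => [->|] //=; rewrite stepK. Qed.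

Lemma word_act_mul x u v : word_act x (mul_word u v) = word_act (word_act x u) v.
Proof.
by elim: u x => //= a u IH x; rewrite word_act_cons_red IH.
Qed.

Lemma free_act1 x : free_act x 1%g = x. Proof. by []. Qed.

Lemma free_actM x g h : free_act x (g * h)%g = free_act (free_act x g) h.
Proof. exact: word_act_mul. Qed.

Lemma free_actK g : cancel (free_act^~ g) (free_act^~ g^-1%g).
Proof. by move=> x; rewrite -free_actM mulgV. Qed.

Lemma free_actVK g : cancel (free_act^~ g^-1%g) (free_act^~ g).
Proof. by move=> x; rewrite -free_actM mulVg. Qed.

Definition of_word (w : seq (letter d)) : free_group d :=
  FreeGroup (reduced_mul w (isT : reduced [::])).

Lemma free_act_of_word x w : free_act x (of_word w) = word_act x w.
Proof. by rewrite /free_act /= word_act_mul. Qed.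

(** The words act letter by letter; [free_actM] makes this an action of the
reduced words, whose kernel is a normal subgroup. *)
Definition action_kernel : normal_subgroup (free_group d).
Proof.
exists [set g | forall x, free_act x g = x].
- by [].
- by move=> g h /= hg hh x; rewrite free_actM hg hh.
- by move=> g /= hg x; rewrite -{1}(hg x) free_actK.
- by move=> g h /= hg x; rewrite /conjg !free_actM hg -free_actM mulVg free_act1.
Defined.

Lemma quotient_map_kernel g h : (forall x, free_act x g = free_act x h) ->
  quotient_map action_kernel g = quotient_map action_kernel h.
Proof.
move=> e; apply/quotient_mapP => x /=.
by rewrite free_actM -e free_actVK.
Qed.

End WordActions.

(** The complements of the domain and of the image have the same
cardinality. *)
Lemma partial_injection_extend (T : finType) (D : {set T}) (f : T -> T) :
  {in D &, injective f} -> exists s : {perm T}, {in D, s =1 f}.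
Proof.
move=> fi; pose A := enum (~: D)%SET; pose B := enum (~: (f @: D))%SET.
have sAB : size A = size B.
  rewrite -!cardE; have := cardsC D; have := cardsC (f @: D)%SET.
  by rewrite card_in_imset // => <- /addnI.
pose g x := if x \in D then f x else nth x B (index x A).
have gB x : x \notin D -> (index x A < size B)%N.
  by rewrite -sAB index_mem mem_enum inE.
have gnotin x : x \notin D -> g x \notin (f @: D)%SET.
  move=> xD; have := mem_nth x (gB x xD); rewrite mem_enum inE.
  by rewrite /g (negbTE xD).
have gi : injective g.
  move=> x y; case: (boolP (x \in D)) (boolP (y \in D)) => xD [] yD.
  - by rewrite /g xD yD; apply: fi.
  - by move=> e; have := gnotin y yD; rewrite -e /g xD imset_f.
  - by move=> e; have := gnotin x xD; rewrite e /g yD imset_f.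
  - rewrite /g (negbTE xD) (negbTE yD) (set_nth_default y) ?gB // => /eqP.
    rewrite nth_uniq ?gB ?enum_uniq // => /eqP e.
    by rewrite -(nth_index x (_ : x \in A)) ?e ?nth_index // mem_enum inE.
exists (perm gi) => x xD; rewrite permE /g xD //.
Qed.

Definition letter_perm d (T : finType) (pl : 'I_d -> {perm T}) (a : letter d) :
  {perm T} := if a.2 then (pl a.1)^-1%g else pl a.1.

Definition word_perm d (T : finType) (pl : 'I_d -> {perm T}) w : {perm T} :=
  (\prod_(a <- w) letter_perm pl a)%g.

Section BallPermutations.
Variables (d n : nat).
Local Notation W := (n.-bseq (letter d)).

(** The empty word is encoded by [None], so that the base point of the ball is the
distinguished element of an option type. *)
Definition ball_enc (s : seq (letter d)) : option W :=
  if s is [::] then None else insub s.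
Definition ball_dec (x : option W) : seq (letter d) := if x is Some u then u else [::].

Lemma ball_encK s : (size s <= n)%N -> ball_dec (ball_enc s) = s.
Proof. by case: s => //= a s sn; rewrite insubT /=. Qed.

Lemma ball_perms : exists pl : 'I_d -> {perm option W}, forall a v, reduced v ->
  (size v <= n)%N -> (size (cons_red (inv_letter a) v) <= n)%N ->
  letter_perm pl a (ball_enc v) = ball_enc (cons_red (inv_letter a) v).
Proof.
pose f (i : 'I_d) (x : option W) := ball_enc (cons_red (i, true) (ball_dec x)).
pose D (i : 'I_d) : {set option W} := [set x | [&& x == ball_enc (ball_dec x),
  reduced (ball_dec x) & size (cons_red (i, true) (ball_dec x)) <= n]%N]%SET.
have fi i : {in D i &, injective (f i)}.
  move=> x y; rewrite !inE => /and3P[/eqP ex rx sx] /and3P[/eqP ey ry sy] /(congr1 ball_dec).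
  rewrite !ball_encK // => e.
  have := cons_redK (i, true) rx; rewrite e cons_redK // => e'.
  by rewrite ex ey e'.
have [pl hpl] : exists pl : 'I_d -> {perm option W}, forall i, {in D i, pl i =1 f i}.
  have h i := cid (partial_injection_extend (fi i)).
  by exists (fun i => sval (h i)) => i; apply: (svalP (h i)).
exists pl => -[i [|]] v rv sv; rewrite /letter_perm /inv_letter /= => sw.
  have rw : reduced (cons_red (i, false) v) by apply: reduced_cons_red.
  have vE : cons_red (i, true) (cons_red (i, false) v) = v.
    exact: (cons_redK (i, false) rv).
  apply: (@perm_inj _ (pl i)); rewrite permKV hpl ?inE ?ball_encK // ?vE ?eqxx ?rw //.
  by rewrite /f ball_encK // vE.
by rewrite hpl ?inE ?ball_encK // ?eqxx ?rv // /f ball_encK.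
Qed.

End BallPermutations.

(** Multiplication by the inverse of a letter is a partial injection of
the ball of radius [n]; extend it to a permutation.  A reduced word [w] of length at
most [n] then maps the empty word to [inv_word w]. *)
Lemma separating_permutations d n : exists (W : finType) (pl : 'I_d -> {perm option W}),
  forall w : seq (letter d), reduced w -> (size w <= n)%N -> w != [::] ->
    word_perm pl w None != None.
Proof.
have [pl hpl] := ball_perms d n; exists (n.-bseq (letter d)), pl.
suff key w : reduced w -> (size w <= n)%N ->
    word_perm pl w None = ball_enc n (inv_word w).
  move=> w rw sw w0; rewrite key //; apply/eqP => /(congr1 (@ball_dec d n)).
  rewrite ball_encK; last by rewrite size_rev size_map.
  move=> /(congr1 size); rewrite /= size_rev size_map => /eqP.
  by rewrite size_eq0 (negbTE w0).
elim/last_ind: w => [|w a IH] rw sw; first by rewrite /word_perm big_nil perm1.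
have rw' : reduced w.
  by move: rw; rewrite /reduced -cats1 => /cat_sorted2[].
rewrite size_rcons in sw.
rewrite /word_perm -cats1 big_cat big_seq1 permM -/(word_perm pl w) IH //; last exact: ltnW.
have iE : inv_word (rcons w a) = inv_letter a :: inv_word w.
  by rewrite /inv_word map_rcons rev_rcons.
have cE : cons_red (inv_letter a) (inv_word w) = inv_letter a :: inv_word w.
  by apply: cons_red_cons; rewrite -iE; apply: reduced_inv.
rewrite cats1 iE hpl ?cE //=; rewrite ?size_rev ?size_map ?(ltnW sw) //.
exact: reduced_inv.
Qed.

(** * The lamplighter over the infinite dihedral group *)

Section DihedralPositions.
Variable d : nat.
Implicit Types (a : letter d) (w u v : seq (letter d)).

(** The dihedral action on any ring: on [int] it carries the lamplighter, on
['Z_(2 * q)] the tree action, and [flip_int] compares the two. *)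
Definition flip (V : nzRingType) (x : V) a : V := if val a.1 == 0%N then - x else 1 - x.

Lemma flipK (V : nzRingType) (x : V) a : flip (flip x a) a = x.
Proof. by rewrite /flip; case: eqP => _; [rewrite opprK | rewrite subKr]. Qed.

Lemma flip_inv (V : nzRingType) (x : V) a : flip x (inv_letter a) = flip x a.
Proof. by []. Qed.

Lemma flip_stepK (V : nzRingType) (x : V) a : flip (flip x a) (inv_letter a) = x.
Proof. by rewrite flip_inv flipK. Qed.

Definition pos (x : int) w := word_act (@flip int) x w.

Lemma pos_cons x a w : pos x (a :: w) = pos (flip x a) w. Proof. by []. Qed.

(** Every word acts by [x |-> x + t] or [x |-> t - x] according to the parity of
its length, so the position is known from [pos 0 w] and that parity. *)
Lemma pos_affine x w : pos x w = (-1) ^+ size w * x + pos 0 w.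
Proof.
elim: w x => [|a w IH] x; first by rewrite /pos /= mul1r addr0.
rewrite !pos_cons (IH (flip x a)) (IH (flip 0 a)) [size _]/= exprS.
by rewrite /flip; case: ifP => _; ring.
Qed.

Lemma pos_mul x u v : pos x (mul_word u v) = pos (pos x u) v.
Proof. exact: (word_act_mul (@flip_stepK int)). Qed.

Lemma absz_flip (x : int) a : (`|flip x a| <= `|x| + 1)%N.
Proof. by rewrite /flip; case: ifP => _; lia. Qed.

Lemma absz_pos x w : (`|pos x w| <= `|x| + `|pos 0%R w|)%N.
Proof. by rewrite pos_affine -(abszMsign (size w) x); lia. Qed.

Lemma absz_pos_ge x w : (`|x| <= `|pos x w| + `|pos 0%R w|)%N.
Proof. by rewrite pos_affine -(abszMsign (size w) x); lia. Qed.

Fixpoint reach (x : int) w : nat :=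
  if w is a :: w' then maxn `|x|%N (reach (flip x a) w') else `|x|%N.

Lemma reach_ge x w : (`|x| <= reach x w)%N.
Proof. by case: w => //= a w; rewrite leq_maxl. Qed.

Lemma reach_pos x w : (`|pos x w| <= reach x w)%N.
Proof. by elim: w x => //= a w IH x; rewrite leq_max IH orbT. Qed.

Lemma reach_cons_red x a w : (reach x (cons_red a w) <= maxn `|x| (reach (flip x a) w))%N.
Proof.
case: w => [|b w] /=; first by [].
case: eqP => [->|_] //=; rewrite flip_inv flipK.
by rewrite !leq_max leqnn !orbT.
Qed.

Lemma reach_mul x u v : (reach x (mul_word u v) <= maxn (reach x u) (reach (pos x u) v))%N.
Proof.
elim: u x => [|a u IH] x /=; first by rewrite leq_maxr.
apply: leq_trans (reach_cons_red _ _ _) _; rewrite -maxnA geq_max leq_maxl /=.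
by rewrite leq_max IH orbT.
Qed.

Lemma reach_prefix x v w : prefix v w -> (`|pos x v| <= reach x w)%N.
Proof.
elim: v w x => [|a v IH] [|b w] x //=; first by rewrite leq_maxl.
by case/andP => /eqP -> vw; rewrite leq_max; apply/orP; right; apply: IH.
Qed.

Lemma reach_leP x w (r : nat) :
  (forall v, prefix v w -> `|pos x v| <= r)%N -> (reach x w <= r)%N.
Proof.
elim: w x => [|a w IH] x h /=; first exact: (h [::]).
rewrite geq_max; apply/andP; split; first exact: (h [::]).
by apply: IH => v vw; have := h (a :: v); rewrite /= eqxx; apply.
Qed.

Lemma reach_shift x w : (reach x w <= `|x| + reach 0 w)%N.
Proof.
apply: reach_leP => v vw; apply: leq_trans (absz_pos _ _) _.
by rewrite leq_add2l reach_prefix.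
Qed.

Lemma reach_size x w : (reach x w <= `|x| + size w)%N.
Proof.
elim: w x => [|a w IH] x /=; first by rewrite addn0.
rewrite geq_max leq_addr /=; apply: leq_trans (IH _) _.
by rewrite addnS -addSn leq_add2r -addn1 absz_flip.
Qed.

End DihedralPositions.

Section Lamplighter.
Variables (d : nat) (T : finType) (pl : 'I_d -> {perm T}) (c : nat).
Implicit Types (a : letter d) (w u v : seq (letter d)).

Lemma letter_perm_inv a : letter_perm pl (inv_letter a) = (letter_perm pl a)^-1%g.
Proof. by case: a => i [|]; rewrite /letter_perm //= invgK. Qed.

(** Both ends of the edge are required to be near, which makes the condition
symmetric under inversion of the letter. *)
Definition lamp_near (x : int) a := (`|x| < c)%N && (`|flip x a| < c)%N.

Definition lamp (x : int) a : {perm T} := if lamp_near x a then letter_perm pl a else 1%g.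

Definition lamp_step (z : {perm T} * int) a := ((z.1 * lamp z.2 a)%g, flip z.2 a).

Lemma lamp_stepK z a : lamp_step (lamp_step z a) (inv_letter a) = z.
Proof.
case: z => s x; rewrite /lamp_step /lamp /lamp_near /= !flip_inv flipK andbC.
by case: ifP => _; rewrite ?letter_perm_inv ?mulgK ?mulg1.
Qed.

Fixpoint lamps (x : int) w : {perm T} :=
  if w is a :: w' then (lamp x a * lamps (flip x a) w')%g else 1%g.

Lemma lamp_act z w : word_act lamp_step z w = ((z.1 * lamps z.2 w)%g, pos z.2 w).
Proof.
elim: w z => [|a w IH] [s x]; first by rewrite mulg1.
by rewrite [word_act _ _ _]IH /= mulgA.
Qed.

(** A path from [x] stays at distance at least [|x| - reach 0 w]. *)
Lemma lamps_far x w : (reach 0 w + c <= `|x|)%N -> lamps x w = 1%g.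
Proof.
move=> h; have : (forall v, prefix v w -> c <= `|pos x v|)%N.
  by move=> v vw; have := reach_prefix 0 vw; have := absz_pos_ge x v; lia.
elim: w x {h} => //= a w IH x h; rewrite IH ?mulg1.
  rewrite /lamp /lamp_near ltnNge; have := h [::]; rewrite /pos /= => -> //.
by move=> v vw; have := h (a :: v); rewrite /= eqxx; apply.
Qed.

Lemma lamps_near x w : (reach x w < c)%N -> lamps x w = word_perm pl w.
Proof.
elim: w x => [|a w IH] x /=; first by rewrite /word_perm big_nil.
rewrite gtn_max => /andP[xc wc]; rewrite IH // /word_perm big_cons /lamp /lamp_near xc.
by rewrite (leq_ltn_trans (reach_ge _ _) wc).
Qed.

(** The quotient by this kernel is a group of dihedral motions together with
their lamp configurations, one for each starting position. *)
Definition lamp_kernel := action_kernel lamp_stepK.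

Lemma lamp_kernelP g : ns_set lamp_kernel g -> forall x,
  lamps x (word_of g) = 1%g /\ pos x (word_of g) = x.
Proof.
move=> /= h x; have := h (1%g, x).
by rewrite /free_act lamp_act /= mul1g => -[].
Qed.

Definition spread (g : free_group d) := reach 0 (word_of g).

Definition drift (g : free_group d) := pos 0 (word_of g).

Lemma spread_mul g h : (spread (g * h)%g <= maxn (spread g) (`|drift g| + spread h))%N.
Proof.
apply: leq_trans (reach_mul _ _ _) _.
by rewrite geq_max leq_maxl /= leq_max reach_shift orbT.
Qed.

Lemma drift_le_spread g : (`|drift g| <= spread g)%N. Proof. exact: reach_pos. Qed.

Lemma spread_le_flen g : (spread g <= flen g)%N. Proof. exact: (reach_size 0). Qed.

(** Starting points beyond [B] see no lamp at all, so it suffices to list the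
lamps seen from the [2 * B + 1] other ones; the boolean comparison with [drift g] marks
the end point inside this list, whence no integer is needed in the alphabet. *)
Definition lamp_code (g : free_group d) : seq ({perm T} * (bool * bool)) :=
  let B := (spread g + c)%N in
  [seq (lamps (i%:Z - B%:Z) (word_of g),
        (i%:Z - B%:Z == drift g, odd (flen g))) | i <- iota 0 (2 * B).+1].

Lemma size_lamp_code g : size (lamp_code g) = (2 * (spread g + c)).+1.
Proof. by rewrite size_map size_iota. Qed.

Lemma lamp_code_inj g h : lamp_code g = lamp_code h ->
  quotient_map lamp_kernel g = quotient_map lamp_kernel h.
Proof.
move=> e; have eB : (spread g + c = spread h + c)%N.
  by have := congr1 size e; rewrite !size_lamp_code; lia.
pose B := (spread g + c)%N.
have key (x : int) : (`|x| <= B)%N -> [/\ lamps x (word_of g) = lamps x (word_of h),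
    (x == drift g) = (x == drift h) & odd (flen g) = odd (flen h)].
  move=> xB; pose i := absz (x + B%:Z).
  have iE : i%:Z - B%:Z = x by rewrite /i; lia.
  have iB : (i < (2 * B).+1)%N by rewrite /i; lia.
  pose z0 : {perm T} * (bool * bool) := (1%g, (false, false)).
  have := congr1 (fun s => nth z0 s i) e.
  rewrite /lamp_code -eB !(nth_map 0%N) ?size_iota // !nth_iota // add0n -/B iE.
  by case.
have gB : (`|drift g| <= B)%N by rewrite (leq_trans (drift_le_spread g)) // leq_addr.
have [_ /esym] := key _ gB; rewrite eqxx => /eqP sE oE.
apply: quotient_map_kernel => -[s x]; rewrite /free_act !lamp_act /=; congr (_, _).
  congr (_ * _)%g; case: (leqP `|x|%N B) => [/key[]//|xB].
  by rewrite !lamps_far //; move: xB; rewrite /B /spread; [rewrite eB|]; rewrite /spread; lia.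
rewrite pos_affine [RHS]pos_affine -/(drift g) -/(drift h) sE; congr (_ * _ + _).
by rewrite -signr_odd -/(flen g) oE signr_odd.
Qed.

End Lamplighter.

(** * Vanishing entropy of the lamplighter quotient *)

Section TailExpectation.
Variables (R : realType) (T : choiceType) (p : T -> R).
Hypothesis pm : probability_mass p.

Lemma finite_set_bounded (A : set T) (f : T -> nat) : finite_set A ->
  exists M, forall x, A x -> (f x <= M)%N.
Proof.
move=> /finite_seqP[r ->]; exists (\max_(x <- r) f x)%N => x /= xr.
by rewrite (big_rem x) //= leq_maxl.
Qed.

(** The part of an integrable function above a high level has small
expectation. *)
Lemma expect_tail (f : T -> nat) (e : R) : 0 < e ->
  (expect p (fun x => (f x)%:R%:E) < +oo)%E ->
  exists M, (expect p (fun x => (if (f x <= M)%N then 0 else (f x)%:R)%:E) <= e%:E)%E.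
Proof.
move=> e0 ffin; have p0 := pmass_ge0 pm.
have h0 x : (0 <= (p x)%:E * (f x)%:R%:E)%E by rewrite mule_ge0 ?lee_fin.
have [A finA hA] := tsum_tail h0 ffin e0.
have [M hM] := finite_set_bounded f finA; exists M.
have := hA [set x | (f x <= M)%N] hM; apply: le_trans.
rewrite [leRHS]esum_mkcond; apply: le_tsum => x.
case: (boolP (f x <= M)%N) => fM; first by rewrite mule0; case: ifP.
by rewrite mem_set //=; apply/negP.
Qed.

End TailExpectation.

Section FreeParity.
Variable d : nat.

Lemma odd_cons_red (a : letter d) w : odd (size (cons_red a w)) = ~~ odd (size w).
Proof. by case: w => //= b w; case: ifP => //= _; rewrite negbK. Qed.

Lemma odd_flenM (g h : free_group d) : odd (flen (g * h)%g) = odd (flen g) (+) odd (flen h).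
Proof.
rewrite /flen /=; elim: (word_of g) => //= a u IH.
by rewrite odd_cons_red IH addNb.
Qed.

End FreeParity.

Lemma drift_arith (R : realType) (e k m l t : R) :
  l / 4 < k * (e / 4) -> m <= t + l / 4 -> t <= e / 4 * k -> m + k * (e / 2) <= e * k.
Proof. by lra. Qed.

Lemma block_arith (R : realType) (e e1 K m c J k : R) :
  K * (2 * (m + c) + 1) + 1 < J * (e / 2) ->
  J * (e / 2) <= k * J * (e / 2) -> K * e1 * (k * J) <= e / 8 * (k * J) ->
  2 * K * (m + J * (e1 * k + e1 * k)) + K * (2 * c + 1) + 1 <= e * (k * J).
Proof. by lra. Qed.

Lemma max_arith1 s a t b M : (s <= maxn a (t + b) -> a <= M ->
  maxn s M <= t + maxn b M)%N.
Proof. by lia. Qed.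

Lemma max_arith2 s a t b M : (s <= maxn a (t + b) -> maxn s M <= t + a + maxn b M)%N.
Proof. by lia. Qed.

Section ZeroDrift.
Variables (R : realType) (d : nat) (mu : free_group d -> R).
Hypothesis hmu : probability_mass mu.
Hypothesis hmom : finite_first_moment (range (@fg_gen d)) mu.
Let hfin := first_moment_fin hmu hmom.
Hypothesis hodd : exists2 g, odd (flen g) & 0 < mu g.

Let power0 n := pmass_ge0 (power_pmass n hmu).

Section Truncation.
Variable L : nat.

(** Displacements larger than [L] are replaced by 0; the error is controlled by
[expect_tail], and the remaining walk has bounded jumps. *)
Definition trunc_drift (s : free_group d) : int :=
  if (`|drift s| <= L)%N then drift s else 0.

(** The pair of the linear part and of the truncated translation part of the
dihedral motion, in a finite type. *)
Definition jump_class (s : free_group d) : bool * 'I_(2 * L).+1 :=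
  (odd (flen s), inord (absz (trunc_drift s + L%:Z))).

Definition jump (z : bool * 'I_(2 * L).+1) : R := ((val z.2)%:Z - L%:Z)%:~R.
Definition jump_sign (z : bool * 'I_(2 * L).+1) : R := (-1) ^+ z.1.

Lemma jumpE s : jump (jump_class s) = (trunc_drift s)%:~R.
Proof.
have h : (`|trunc_drift s| <= L)%N by rewrite /trunc_drift; case: ifP.
by rewrite /jump /= inordK; [congr (_%:~R)|]; lia.
Qed.

Definition jump_law := pushforward_mass jump_class mu.

Let nu := jump_law.

Let nu0 z : 0 <= nu z. Proof. exact: push_ge0. Qed.

Let nu1 : \sum_z nu z = 1.
Proof.
apply: EFin_inj; rewrite -sumEFin -tsum_fin; last by move=> z; rewrite lee_fin.
exact: (proj2 (push_pmass hmu jump_class)).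
Qed.

(** The transition operator on functions of the position, extended to real
positions so that quadratic polynomials can be used as test functions. *)
Definition jump_op (phi : R -> R) (y : R) : R :=
  \sum_z nu z * phi (jump_sign z * y + jump z).

Lemma jump_opE phi y : (forall x, 0 <= phi x) ->
  (jump_op phi y)%:E =
  expect mu (fun s => (phi ((-1) ^+ odd (flen s) * y + (trunc_drift s)%:~R))%:E).
Proof.
move=> phi0; rewrite -sumEFin.
under eq_bigr => z _ do rewrite EFinM.
rewrite -tsum_fin; last by move=> z; rewrite -EFinM lee_fin mulr_ge0.
rewrite -/(expect nu (fun z => (phi (jump_sign z * y + jump z))%:E)) expect_push //;
  last by move=> z; rewrite lee_fin.
by apply: eq_expect => s /=; rewrite jumpE.
Qed.

Definition mean_sign := \sum_z nu z * jump_sign z.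
Definition mean_jump := \sum_z nu z * jump z.
Definition mean_sign_jump := \sum_z nu z * (jump_sign z * jump z).
Definition mean_sqr_jump := \sum_z nu z * jump z ^+ 2.

Lemma sign_sqr z : jump_sign z ^+ 2 = 1.
Proof. by rewrite /jump_sign sqrr_sign. Qed.

(** The squares of the signs are 1, so the coefficient of [y ^+ 2] is kept and
only the linear coefficient and the constant evolve. *)
Lemma jump_op_quadratic (c e f : R) y :
  jump_op (fun x => e * (x ^+ 2 + 2 * c * x) + f) y =
  e * (y ^+ 2 + 2 * (mean_sign_jump + c * mean_sign) * y) +
  (f + e * (2 * c * mean_jump + mean_sqr_jump)).
Proof.
rewrite /jump_op; transitivity (e * (y ^+ 2 * (\sum_z nu z) +
   2 * y * mean_sign_jump + 2 * c * y * mean_sign) +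
  (f * (\sum_z nu z) + e * (2 * c * mean_jump + mean_sqr_jump))); last first.
  by rewrite nu1; ring.
rewrite /mean_sign_jump /mean_sign /mean_jump /mean_sqr_jump.
rewrite !(mulr_sumr, mulrDr) -!big_split /=.
apply: eq_bigr => z _; have := sign_sqr z.
move: (nu z) (jump_sign z) (jump z) => a s t s2.
have -> : (s * y + t) ^+ 2 = s ^+ 2 * y ^+ 2 + 2 * s * y * t + t ^+ 2 by ring.
by rewrite s2; ring.
Qed.

Lemma jump_op_le phi psi y : (forall x, phi x <= psi x) ->
  jump_op phi y <= jump_op psi y.
Proof. by move=> h; apply: ler_sum => z _; rewrite ler_wpM2l. Qed.

Lemma jump_op_lipschitz phi y y' : (forall x x', phi x <= phi x' + `|x - x'|) ->
  jump_op phi y <= jump_op phi y' + `|y - y'|.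
Proof.
move=> h; rewrite -[X in _ + X]mul1r -nu1 mulr_suml -big_split /=.
apply: ler_sum => z _; rewrite -mulrDr ler_wpM2l //.
apply: le_trans (h _ (jump_sign z * y' + jump z)) _; rewrite lerD2l.
by rewrite opprD addrACA subrr addr0 -mulrBr normrM normr_sign mul1r.
Qed.

Lemma jump_range z : `|jump z| <= L%:R.
Proof.
rewrite /jump -intr_norm -[L%:R]/(L%:Z%:~R) ler_int.
by case: z => [b [i hi]] /=; rewrite ler_norml; apply/andP; split; lia.
Qed.

Lemma weighted_bound (h : bool * 'I_(2 * L).+1 -> R) (C : R) :
  (forall z, `|h z| <= C) -> `|\sum_z nu z * h z| <= C.
Proof.
move=> hC; apply: le_trans (ler_norm_sum _ _ _) _.
rewrite -[leRHS]mul1r -nu1 mulr_suml; apply: ler_sum => z _.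
by rewrite normrM ger0_norm // ler_wpM2l.
Qed.

(** Here the walk is used to have an element of odd length in its support:
reflections occur. *)
Lemma mean_sign_lt1 : mean_sign < 1.
Proof.
have [g og mug] := hodd.
have nug : 0 < nu (jump_class g) by apply: lt_le_trans mug (push_ge_term _ _ hmu).
rewrite -nu1 /mean_sign -subr_gt0 -sumrB (bigD1 (jump_class g)) //=.
apply: ltr_pwDl.
  by rewrite /jump_sign /= og expr1 mulrN1 opprK addr_gt0.
apply: sumr_ge0 => z _; rewrite -[X in X - _]mulr1 -mulrBr mulr_ge0 // subr_ge0.
by rewrite /jump_sign; case: z.1; rewrite ?expr1 ?expr0 //; lra.
Qed.

(** The linear coefficients obtained by iterating [jump_op_quadratic] from a pure
square.  They satisfy an affine recursion of ratio [mean_sign], and stay bounded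
because [mean_sign] is less than 1. *)
Fixpoint drift_coef (k : nat) : R :=
  if k is k'.+1 then mean_sign_jump + drift_coef k' * mean_sign else 0.

Definition drift_bound : R :=
  2 * (2 * L%:R / (1 - mean_sign)) * L%:R + L%:R ^+ 2.

Lemma drift_coef_bound k : `|drift_coef k| <= 2 * L%:R / (1 - mean_sign).
Proof.
have s1 := mean_sign_lt1; have s0 : 0 < 1 - mean_sign by lra.
have bL : `|mean_sign_jump| <= L%:R.
  apply: weighted_bound => z; rewrite normrM normr_sign mul1r; exact: jump_range.
have sle : `|mean_sign| <= 1.
  by apply: weighted_bound => z; rewrite normr_sign.
(* [mean_sign_jump / (1 - mean_sign)] is the fixed point of the recursion. *)
have inv : `|drift_coef k * (1 - mean_sign) - mean_sign_jump| <= L%:R.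
  elim: k => [|k IH]; first by rewrite mul0r sub0r normrN.
  have -> : drift_coef k.+1 * (1 - mean_sign) - mean_sign_jump =
    mean_sign * (drift_coef k * (1 - mean_sign) - mean_sign_jump).
    by rewrite /=; ring.
  rewrite normrM; apply: le_trans IH; rewrite -[leRHS]mul1r.
  by rewrite ler_wpM2r.
rewrite ler_pdivlMr // -{1}(gtr0_norm s0) -normrM.
have := ler_normD (drift_coef k * (1 - mean_sign) - mean_sign_jump) mean_sign_jump.
by rewrite subrK; lra.
Qed.

Lemma drift_bound_step k :
  2 * drift_coef k * mean_jump + mean_sqr_jump <= drift_bound.
Proof.
have c := drift_coef_bound k.
have t : `|mean_jump| <= L%:R by apply: weighted_bound => z; apply: jump_range.
have g : `|mean_sqr_jump| <= L%:R ^+ 2.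
  by apply: weighted_bound => z; rewrite normrX lerXn2r ?nnegrE ?jump_range.
have ct : `|drift_coef k * mean_jump| <= 2 * L%:R / (1 - mean_sign) * L%:R.
  by rewrite normrM ler_pM.
have := ler_norm (drift_coef k * mean_jump); have := ler_norm mean_sqr_jump.
by rewrite /drift_bound; lra.
Qed.

Definition mean_abs k := iter k jump_op (fun x => `|x|).

Lemma mean_abs_ge0 k y : 0 <= mean_abs k y.
Proof.
elim: k y => [|k IH] y /=; first exact: normr_ge0.
by apply: sumr_ge0 => z _; rewrite mulr_ge0 // IH.
Qed.

Lemma mean_abs_lipschitz k y y' : mean_abs k y <= mean_abs k y' + `|y - y'|.
Proof.
elim: k y y' => [|k IH] y y' /=; last exact: jump_op_lipschitz.
by rewrite -{1}(subrK y' y) addrC; apply: le_trans (ler_normD _ _) _; rewrite addrC.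
Qed.

(** Start from [|y| <= e * y ^+ 2 + 1 / (4 * e)] and iterate: the second
moment grows linearly in time, so the first one at most like its square root. *)
Lemma mean_abs_quadratic (e : R) k y : 0 < e ->
  mean_abs k y <= e * (y ^+ 2 + 2 * drift_coef k * y) + (e * drift_bound * k%:R + e^-1 / 4).
Proof.
move=> e0; elim: k y => [|k IH] y /=.
  rewrite mulr0 mul0r addr0 mulr0 add0r -(real_normK (num_real y)).
  have := sqr_ge0 (2 * e * `|y| - 1) => h.
  have : 0 <= e^-1 * (2 * e * `|y| - 1) ^+ 2 by rewrite mulr_ge0 ?invr_ge0 // ltW.
  have -> : e^-1 * (2 * e * `|y| - 1) ^+ 2 = 4 * (e * `|y| ^+ 2 + e^-1 / 4 - `|y|).
    by field; rewrite gt_eqF.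
  by lra.
apply: le_trans (jump_op_le y IH) _; rewrite jump_op_quadratic.
rewrite lerD2l -natr1.
have := ler_wpM2l (ltW e0) (drift_bound_step k).
by lra.
Qed.

End Truncation.

Definition mean_drift k (y : int) : \bar R :=
  expect (convolution_power mu k) (fun g => (`|pos y (word_of g)|%N%:R)%:E).

Lemma pos_free_mul y (g h : free_group d) :
  pos y (word_of (g * h)%g) = pos (pos y (word_of g)) (word_of h).
Proof. exact: pos_mul. Qed.

(** The expected distances of the walk and of the truncated walk are
compared step by step, since [mean_abs] is 1-Lipschitz. *)
Lemma mean_drift_truncated L (del : R) k y :
  (expect mu (fun s => (if (`|drift s| <= L)%N then 0 else `|drift s|%N%:R)%:E) <= del%:E)%E ->
  (mean_drift k y <= (mean_abs L k y%:~R + k%:R * del)%:E)%E.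
Proof.
move=> hdel; have p0 := pmass_ge0 hmu.
elim: k y => [|k IH] y.
  rewrite /mean_drift expect_power0 /=; last by move=> x; rewrite lee_fin.
  by rewrite mul0r addr0 lee_fin -intr_norm -abszE.
rewrite /mean_drift expect_powerS //.
have -> : (mean_abs L k.+1 y%:~R + k.+1%:R * del)%:E =
   (((jump_op L (mean_abs L k) y%:~R)%:E + (k%:R * del)%:E) + del%:E)%E.
  by rewrite -!EFinD /= -natr1; congr EFin; ring.
have del0 : 0 <= del.
  rewrite -lee_fin; apply: le_trans hdel; apply: expect_ge0 => // s.
  by case: ifP.
apply: le_trans (leeD2l _ hdel).
rewrite jump_opE; last exact: mean_abs_ge0.
rewrite -(expect_cst hmu (_ : 0 <= k%:R * del)) ?mulr_ge0 //.
rewrite -!expectD //;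
  try by move=> s; rewrite ?adde_ge0 ?lee_fin ?mean_abs_ge0 ?mulr_ge0 //; case: ifP.
apply: le_expect => // s.
have -> : expect (convolution_power mu k)
    (fun g => (`|pos y (word_of (s * g)%g)|%N%:R)%:E) = mean_drift k (pos y (word_of s)).
  by apply: eq_expect => g; rewrite pos_free_mul.
apply: le_trans (IH _) _; rewrite -!EFinD lee_fin.
rewrite addrAC lerD2r; apply: le_trans (mean_abs_lipschitz _ _ _
  ((-1) ^+ odd (flen s) * y%:~R + (trunc_drift L s)%:~R)) _.
rewrite lerD2l pos_affine rmorphD rmorphM rmorphXn /= signr_odd rmorphN1.
rewrite opprD addrACA subrr add0r -rmorphB /= -intr_norm -abszE /trunc_drift.
by rewrite -/(drift s); case: ifP => _; rewrite ?subrr ?subr0.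
Qed.

(** The dihedral part of the walk has zero speed. *)
Lemma mean_drift_sublinear (e : R) : 0 < e ->
  exists2 k, (0 < k)%N & (mean_drift k 0 <= (e * k%:R)%:E)%E.
Proof.
move=> e0.
have dfin : (expect mu (fun s => (`|drift s|%N%:R)%:E) < +oo)%E.
  apply: le_lt_trans hfin; apply: le_expect; first exact: pmass_ge0.
  by move=> s; rewrite lee_fin ler_nat (leq_trans (drift_le_spread s)) // spread_le_flen.
have [L hL] := expect_tail hmu (divr_gt0 e0 (ltr0Sn R 1)) dfin.
have D0 : 0 <= drift_bound L.
  have s0 : 0 < 1 - mean_sign L by rewrite subr_gt0 mean_sign_lt1.
  by rewrite addr_ge0 ?sqr_ge0 // !mulr_ge0 // invr_ge0 ltW.
(* The parameter of [mean_abs_quadratic], for which the linear growth rate is less than [e / 4]. *)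
pose l := e / 4 / (drift_bound L + 1).
have l0 : 0 < l by rewrite !divr_gt0 //; lra.
have [k0 _ hk] : \forall k \near \oo, l^-1 / 4 / (e / 4) < k%:R :> R.
  exact: nbhs_infty_gtr.
pose k := k0.+1; exists k => //.
have {}hk : l^-1 / 4 < k%:R * (e / 4).
  by rewrite -ltr_pdivrMr ?divr_gt0 //; apply: hk => /=.
apply: le_trans (mean_drift_truncated k 0 hL) _; rewrite lee_fin.
have q : mean_abs L k 0 <= l * drift_bound L * k%:R + l^-1 / 4.
  by have := mean_abs_quadratic L k 0 l0; rewrite expr0n /= !mulr0 addr0 mulr0 add0r.
have h : l * drift_bound L * k%:R <= e / 4 * k%:R.
  rewrite ler_wpM2r // /l -mulrA ger_pMr ?divr_gt0 // mulrC ler_pdivrMr; lra.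
rewrite mulr0z; exact: (drift_arith hk q h).
Qed.

Definition mean_spread n : \bar R :=
  expect (convolution_power mu n) (fun g => ((spread g)%:R)%:E).

Lemma mean_spread_fin n : (mean_spread n < +oo)%E.
Proof.
apply: le_lt_trans (first_moment_power hmu hmom n); apply: le_expect => // g.
by rewrite lee_fin ler_nat spread_le_flen.
Qed.

(** The bound [spread (g * h) <= max (spread g) (|drift g| + spread h)] makes the
range additive only through the drift of the blocks, up to the excess over [M] of the
range inside one block. *)
Lemma mean_spread_blocks k M (al be : R) J : 0 <= al -> 0 <= be ->
  (mean_drift k 0 <= al%:E)%E ->
  (expect (convolution_power mu k)
     (fun g => (if (spread g <= M)%N then 0 else (spread g)%:R)%:E) <= be%:E)%E ->
  (mean_spread (k * J) <= (M%:R + J%:R * (al + be))%:E)%E.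
Proof.
move=> al0 be0 hal hbe.
suff h : (expect (convolution_power mu (k * J)) (fun g => (maxn (spread g) M)%:R%:E) <=
    (M%:R + J%:R * (al + be))%:E)%E.
  apply: le_trans h; apply: le_expect => // g.
  by rewrite lee_fin ler_nat leq_maxl.
elim: J => [|J IH].
  rewrite muln0 expect_power0 /=; last by move=> x; rewrite lee_fin.
  by rewrite mul0r addr0 lee_fin ler_nat /spread /= max0n.
rewrite mulnS expect_powerD //.
have -> : (M%:R + J.+1%:R * (al + be))%:E =
  ((al%:E + be%:E) + (M%:R + J%:R * (al + be))%:E)%E.
  by rewrite -!EFinD -natr1; congr EFin; ring.
have C0 : 0 <= M%:R + J%:R * (al + be) by rewrite addr_ge0 // mulr_ge0 // addr_ge0.
apply: le_trans (leeD2r _ (leeD hal hbe)).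
rewrite -(expect_cst (power_pmass k hmu) C0) /mean_drift -!expectD //;
  try by move=> g; rewrite ?adde_ge0 ?lee_fin //; case: ifP.
apply: le_expect => // g.
apply: (@le_trans _ _ (expect (convolution_power mu (k * J))
   (fun h => ((`|pos 0 (word_of g)|%N%:R)%:E +
     (if (spread g <= M)%N then 0 else (spread g)%:R)%:E) + (maxn (spread h) M)%:R%:E)%E)).
  apply: le_expect => // h; rewrite -!EFinD lee_fin.
  have r := spread_mul g h; rewrite -/(drift g).
  case: ifP => [gM|_].
    by rewrite addr0 -natrD ler_nat; apply: max_arith1 r gM.
  by rewrite -!natrD ler_nat; apply: max_arith2 r.
rewrite expectD //; last first.
  by move=> h; rewrite adde_ge0 ?lee_fin //; case: ifP.
apply: leeD => //; set v := (_ + _)%E.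
have -> : v = (`|pos 0 (word_of g)|%N%:R + if (spread g <= M)%N then 0 else (spread g)%:R)%:E.
  by rewrite /v -EFinD.
rewrite expect_cst //; first exact: power_pmass.
by rewrite addr_ge0 //; case: ifP.
Qed.

Section LamplighterEntropy.
Variables (T : finType) (pl : 'I_d -> {perm T}) (c : nat).

(** The code has length about twice the range of the dihedral walk, which is
sublinear since this walk has zero speed. *)
Lemma lamplighter_entropy (e : R) : 0 < e ->
  exists2 n, (0 < n)%N & (shannon_entropy (qlaw (lamp_kernel pl c)
    (convolution_power mu n)) <= (e * n%:R)%:E)%E.
Proof.
move=> e0; pose A : finType := ({perm T} * (bool * bool))%type.
have A0 : (0 < #|A|)%N by apply/card_gt0P; exists (1%g, (true, true)).
pose K : R := ln (2 * #|A|%:R).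
have K0 : 0 <= K.
  rewrite ln_ge0 //; have : (1 <= #|A|%:R :> R) by rewrite ler1n.
  by lra.
(* The code has about twice as many letters as the range, each of cost [K]. *)
pose e1 := e / (8 * (K + 1)).
have e10 : 0 < e1 by rewrite divr_gt0 // mulr_gt0 //; lra.
have [k k0 hk] := mean_drift_sublinear e10.
have [M hM] := expect_tail (power_pmass k hmu) e10 (mean_spread_fin k).
have k1 : 1 <= k%:R :> R by rewrite ler1n.
have be0 : 0 <= e1 * k%:R by rewrite mulr_ge0 // ltW.
have hM' : (expect (convolution_power mu k) (fun g =>
    (if (spread g <= M)%N then 0 else (spread g)%:R)%:E) <= (e1 * k%:R)%:E)%E.
  by apply: le_trans hM _; rewrite lee_fin ler_peMr // ltW.
pose C := K * (2 * (M%:R + c%:R) + 1) + 1.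
have [J0 _ hJ] : \forall J \near \oo, C / (e / 2) < J%:R :> R by exact: nbhs_infty_gtr.
pose J := J0.+1; have {}hJ : C < J%:R * (e / 2).
  by rewrite -ltr_pdivrMr ?divr_gt0 //; apply: hJ => /=.
exists (k * J)%N; first by rewrite muln_gt0 k0.
have rad := mean_spread_blocks J be0 be0 hk hM'.
have pn := power_pmass (k * J) hmu.
apply: le_trans (entropy_factor pn (@lamp_code_inj d T pl c)) _.
apply: le_trans (entropy_code (lamp_code pl c) pn A0) _.
rewrite -/K.
have -> : expect (convolution_power mu (k * J))
    (fun x => ((size (lamp_code pl c x))%:R * K)%:E) =
  ((2 * K)%:E * mean_spread (k * J) + (K * (2 * c%:R + 1))%:E)%E.
  have K2 : 0 <= K * (2 * c%:R + 1) by rewrite mulr_ge0 // addr_ge0 // mulr_ge0.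
  rewrite -(expect_cst pn K2) -expectZ ?lee_fin ?mulr_ge0 //.
  rewrite -expectD //; last by move=> g; rewrite -EFinM lee_fin !mulr_ge0.
  apply: eq_expect => g; rewrite size_lamp_code -EFinM -EFinD; congr EFin.
  by rewrite -natr1 natrM natrD; ring.
apply: (@le_trans _ _ ((2 * K)%:E * (M%:R + J%:R * (e1 * k%:R + e1 * k%:R))%:E +
   (K * (2 * c%:R + 1))%:E + 1)%E).
  by rewrite !leeD2r // lee_wpmul2l // lee_fin mulr_ge0.
rewrite -EFinM -!EFinD lee_fin natrM.
have Ke : K * e1 <= e / 8.
  have K8 : 0 < 8 * (K + 1) by rewrite mulr_gt0 // ltr_wpDl.
  rewrite /e1 mulrA ler_pdivrMr //.
  have -> : e / 8 * (8 * (K + 1)) = K * e + e by field.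
  by rewrite lerDl ltW.
have kJ : 0 <= k%:R * J%:R :> R by rewrite mulr_ge0.
have kJ2 : J%:R * (e / 2) <= k%:R * J%:R * (e / 2).
  rewrite ler_wpM2r ?divr_ge0 ?(ltW e0) // ler_peMl //.
exact: (block_arith hJ kJ2 (ler_wpM2r kJ Ke)).
Qed.

End LamplighterEntropy.
End ZeroDrift.

(** * An action on a tree over a circle *)

Section TreeAction.
Variable W : finType.
(** The vertex [(k, w :: s)] hangs under [(~~ k, s)] by an edge of type [k]; hence
the types alternate along the word, and only the type of the head is recorded.  The
empty word occurs with two types, so this is a forest of two rooted trees. *)
Definition tree_vertex : Type := (bool * seq W)%type.
HB.instance Definition _ := Countable.on tree_vertex.
Implicit Types (p q : {perm option W}) (t : tree_vertex) (o : option W).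

(** The [option W]-block of type [k] over [(~~ k, s)]: its base point [None] is that
vertex itself and its other points are the vertices [(k, w :: s)]. *)
Definition tree_place (k : bool) o (s : seq W) : tree_vertex :=
  if o is Some w then (k, w :: s) else (~~ k, s).

(** The blocks of type [k] are disjoint and cover everything but the root [(k, [::])];
the permutation acts in all of them at once.  Since the blocks of both types together
form trees, the two actions are combined as in a free product. *)
Definition tree_act (k : bool) p t : tree_vertex :=
  if t.1 == k then (if t.2 is w :: s then tree_place k (p (Some w)) s else t)
  else tree_place k (p None) t.2.

Lemma tree_act_place k p o s : tree_act k p (tree_place k o s) = tree_place k (p o) s.
Proof. by case: o => [w|] //=; rewrite /tree_act /= ?eqxx //; case: k. Qed.

Lemma tree_actM k p q t : tree_act k (p * q)%g t = tree_act k q (tree_act k p t).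
Proof.
case: t => j s; rewrite /tree_act [in LHS]/= [in X in _ = X]/=.
case: (eqVneq j k) => [->|jk].
  case: s => [|w s] /=; first by rewrite eqxx.
  by rewrite -/(tree_act k q _) tree_act_place permM.
by rewrite -/(tree_act k q _) tree_act_place permM.
Qed.

Lemma tree_act1 k t : tree_act k 1%g t = t.
Proof.
case: t => j s; rewrite /tree_act /= !perm1; case: (eqVneq j k) => [->|].
  by case: s => //= w s; rewrite perm1.
by case: j; case: k.
Qed.

Lemma tree_actK k p : cancel (tree_act k p) (tree_act k p^-1%g).
Proof. by move=> t; rewrite -tree_actM mulgV tree_act1. Qed.

Lemma tree_act_push k p w s : p None = Some w ->
  tree_act k p (~~ k, s) = (k, w :: s).
Proof. by move=> pw; rewrite /tree_act /= pw; case: k. Qed.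

Lemma tree_act_last k p j w w' s d0 :
  last d0 (tree_act k p (j, w :: w' :: s)).2 = last d0 (w' :: s).
Proof.
by rewrite /tree_act /=; case: eqP => _; case: (p _).
Qed.

End TreeAction.

Section CyclicIntegers.
Variable q : nat.
Hypothesis q0 : (0 < q)%N.
Local Notation V := 'Z_(2 * q).

Let n1 : (1 < 2 * q)%N. Proof. by lia. Qed.

Lemma Zp_int_eq0 (m : int) : (m%:~R == 0 :> V) = (2 * q %| `|m|)%N.
Proof.
have key (k : nat) : (k%:R == 0 :> V) = (2 * q %| k)%N.
  by rewrite -val_eqE /= val_Zp_nat.
case: m => m; first by rewrite key.
by rewrite NegzE rmorphN oppr_eq0 key.
Qed.

Lemma Zp_int_inj (y z : int) : (`|y - z| < 2 * q)%N -> y%:~R = z%:~R :> V -> y = z.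
Proof.
move=> h /eqP; rewrite -subr_eq0 -rmorphB /= Zp_int_eq0 => dv.
have : `|y - z|%N = 0%N.
  by apply/eqP; case: posnP => // pos; have := dvdn_leq pos dv; lia.
by lia.
Qed.

(** The point [q] is fixed by [x |-> - x], so the circle looks the same from [q] as
from [0]. *)
Lemma Zp_half : q%:R + q%:R = 0 :> V.
Proof.
apply/eqP; rewrite -natrD -[(q + q)%:R]/((q + q)%N%:Z%:~R) Zp_int_eq0 /=.
by rewrite addnn -mul2n.
Qed.

End CyclicIntegers.

Lemma flip_translate (V : nzRingType) d (a : letter d) (h y : V) : h + h = 0 ->
  flip (h + y) a = h + flip y a.
Proof.
move=> hh; have hN : - h = h by apply/eqP; rewrite eq_sym -addr_eq0 hh.
by rewrite /flip; case: ifP => _; rewrite opprD hN // addrCA.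
Qed.

Lemma flip_int (V : nzRingType) d (a : letter d) (y : int) :
  flip (y%:~R : V) a = (flip y a)%:~R.
Proof. by rewrite /flip; case: ifP => _; rewrite ?rmorphB ?rmorphN. Qed.

Section TreeModel.
Variables (d : nat) (W : finType) (pl : 'I_d -> {perm option W}) (c q : nat).
Hypothesis q0 : (0 < q)%N.
Variable theta : bool -> {perm option W}.
Implicit Types (a : letter d) (w : seq (letter d)) (k : bool).
Local Notation V := 'Z_(2 * q).

Definition centre k : V := if k then 0 else q%:R.

Definition near_zero (x : V) : bool := `[< exists2 j : int, (`|j| < c)%N & x = j%:~R >].

Definition near_centre k (x : V) a : bool :=
  near_zero (x - centre k) && near_zero (flip x a - centre k).

(** Letters read near [centre k] act in the blocks of type [k].  The permutations
are conjugated by [theta k] in order to absorb the lamps met on the way to [centre k]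
from a common base point. *)
Definition tree_label (x : V) a (t : tree_vertex W) : tree_vertex W :=
  if near_centre true x a then tree_act true (letter_perm pl a ^ theta true)%g t
  else if near_centre false x a then tree_act false (letter_perm pl a ^ theta false)%g t
  else t.

Definition model_step (z : tree_vertex W * V) a : tree_vertex W * V :=
  (tree_label z.2 a z.1, flip z.2 a).

Lemma model_stepK z a : model_step (model_step z a) (inv_letter a) = z.
Proof.
case: z => t x; rewrite /model_step /= !flip_inv flipK; congr (_, _).
have sym k : near_centre k (flip x a) (inv_letter a) = near_centre k x a.
  by rewrite /near_centre flip_inv flipK andbC.
rewrite /tree_label !sym letter_perm_inv.
case: (near_centre true x a); first by rewrite conjVg tree_actK.
by case: (near_centre false x a); rewrite // conjVg tree_actK.
Qed.

Lemma centre_double k : centre k + centre k = 0.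
Proof. by case: k; rewrite /centre ?addr0 // Zp_half. Qed.

Lemma near_zero_int (y : int) : (`|y| + c <= q)%N -> near_zero y%:~R = (`|y| < c)%N.
Proof.
move=> yc; apply/asboolP/idP => [[j jc]|yc']; last by exists y.
by move=> /(Zp_int_inj q0) -> //; lia.
Qed.

Lemma near_zero_far (y : int) : (`|y| + c <= q)%N -> near_zero (q%:R + y%:~R) = false.
Proof.
move=> yc; apply/negP => /asboolP[j jc].
rewrite -[q%:R]/(q%:Z%:~R) -rmorphD /= => /eqP.
rewrite -subr_eq0 -rmorphB /= Zp_int_eq0 // => dv.
have pos : (0 < absz (q%:Z + y - j)%R)%N by lia.
by have := dvdn_leq pos dv; lia.
Qed.

Lemma tree_label_window k (y : int) a t : (`|y| + c <= q)%N -> (`|flip y a| + c <= q)%N ->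
  tree_label (centre k + y%:~R) a t = tree_act k (lamp pl c y a ^ theta k)%g t.
Proof.
move=> yc fyc.
(* The edge cannot be near the other centre, which is at distance [q]. *)
have E j : near_centre j (centre k + y%:~R) a = (j == k) && lamp_near c y a.
  rewrite /near_centre flip_translate ?centre_double // flip_int /lamp_near.
  case: (eqVneq j k) => [->|jk].
    by rewrite ![centre k + _]addrC !addrK !near_zero_int.
  have -> z : centre k + z - centre j = q%:R + z.
    have qN : - q%:R = q%:R :> V by apply/eqP; rewrite eq_sym -addr_eq0 Zp_half.
    by case: j jk; case: (k) => //= _; rewrite /centre ?add0r ?subr0 ?qN // addrC.
  by rewrite near_zero_far.
rewrite /tree_label !E /lamp.
case: (k); rewrite /= ?andbF; case: ifP => // _; by rewrite conj1g tree_act1.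
Qed.

(** As long as a path stays at distance more than [c] from the other centre, the
tree action is that of the lamplighter. *)
Lemma model_window k t y w : (reach y w + c <= q)%N ->
  word_act model_step (t, centre k + y%:~R) w =
  (tree_act k (lamps pl c y w ^ theta k)%g t, centre k + (pos y w)%:~R).
Proof.
elim: w t y => [|a w IH] t y; first by rewrite /= conj1g tree_act1.
rewrite [reach _ _]/= addn_maxl geq_max => /andP[yc wc].
have e : model_step (t, centre k + y%:~R) a =
    (tree_act k (lamp pl c y a ^ theta k)%g t, centre k + (flip y a)%:~R).
  rewrite /model_step [_.1]/= [_.2]/= flip_translate ?centre_double // flip_int.
  rewrite tree_label_window //.
  by apply: leq_trans wc; rewrite leq_add2r reach_ge.
transitivity (word_act model_step
  (tree_act k (lamp pl c y a ^ theta k)%g t, centre k + (flip y a)%:~R) w).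
  by rewrite -e.
rewrite IH //.
by congr (_, _); rewrite /= conjMg [RHS]tree_actM.
Qed.

Lemma vertex_window (x : V) : exists k (y : int), (2 * `|y| <= q)%N /\ x = centre k + y%:~R.
Proof.
have [v vq ->] : exists2 v : nat, (v < 2 * q)%N & x = v%:R.
  exists (val x); last by rewrite natr_Zp.
  have n1 : (1 < 2 * q)%N by lia.
  by rewrite -[X in (_ < X)%N](Zp_cast n1) ltn_ord.
have intB' (m n : nat) : (m%:Z - n%:Z)%:~R = m%:R - n%:R :> V by rewrite rmorphB.
case: (leqP (2 * v) q) => h1.
  by exists true, v%:Z; split; [lia | rewrite add0r].
case: (leqP (3 * q) (2 * v)) => h2.
  exists true, (v%:Z - (q + q)%N%:Z); split; first by lia.
  have qq : (q + q)%N%:R = 0 :> V by rewrite natrD Zp_half.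
  by rewrite add0r intB' qq; apply/esym/subr0.
exists false, (v%:Z - q%:Z); split; first by lia.
by rewrite intB' addrC subrK.
Qed.

Definition model_kernel := action_kernel model_stepK.

(** The path of a short word from any point stays in the window of the nearest
centre. *)
Lemma lamp_kernel_sub g : ns_set (lamp_kernel pl c) g -> (2 * (flen g + c) <= q)%N ->
  ns_set model_kernel g.
Proof.
move=> /lamp_kernelP hg gq [t x]; have [k [y [yq ->]]] := vertex_window x.
rewrite /free_act model_window; last first.
  by have := reach_size y (word_of g); rewrite -/(flen g); lia.
by have [-> ->] := hg y; rewrite conj1g tree_act1.
Qed.

End TreeModel.

(** * Branching, orbits and a set with finite boundary in the tree action *)

Section ModelMoves.
Variables (d : nat) (W : finType) (pl : 'I_d -> {perm option W}) (c q : nat).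
Variables (a b : letter d).
Hypotheses (a0 : val a.1 == 0%N) (b0 : val b.1 != 0%N).
Hypothesis q0 : (0 < q)%N.
Hypothesis cq : (2 * c <= q)%N.
Local Notation V := 'Z_(2 * q).
Implicit Types (g h : free_group d) (k : bool) (n : nat) (t : tree_vertex W).

(** The product of the two reflections is [x |-> x + 1]. *)
Definition ascent n : seq (letter d) := flatten (nseq n [:: a; b]).
Definition descent n : seq (letter d) := flatten (nseq n [:: b; a]).

Lemma flip_ascent (U : nzRingType) (x : U) n : word_act (@flip d U) x (ascent n) = x + n%:R.
Proof.
elim: n x => [|n IH] x; first by rewrite addr0.
rewrite /ascent /= -/(ascent n) IH {1}/flip (negbTE b0) /flip a0 opprK.
by rewrite [1 + x]addrC -addrA [1 + _]addrC natr1.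
Qed.

Lemma ascent_reach n : pos (- n%:Z) (ascent n) = 0 /\ (reach (- n%:Z) (ascent n) <= n)%N.
Proof.
elim: n => [//|n [IH1 IH2]].
have e : flip (flip (- n.+1%:Z) a) b = - n%:Z.
  by rewrite /flip (negbTE b0) a0; lia.
have e1 : flip (- n.+1%:Z) a = n.+1%:Z by rewrite /flip a0 opprK.
rewrite /ascent [nseq _ _]/= [flatten _]/= -/(ascent n) !pos_cons /= e IH1; split=> //.
by rewrite e1; move: IH2; lia.
Qed.

Lemma descent_reach n : pos n%:Z (descent n) = 0 /\ (reach n%:Z (descent n) <= n)%N.
Proof.
elim: n => [//|n [IH1 IH2]].
have e : flip (flip n.+1%:Z b) a = n%:Z.
  by rewrite /flip (negbTE b0) a0; lia.
have e1 : flip n.+1%:Z b = - n%:Z by rewrite /flip (negbTE b0); lia.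
rewrite /descent [nseq _ _]/= [flatten _]/= -/(descent n) !pos_cons /= e IH1; split=> //.
by rewrite e1; move: IH2; lia.
Qed.

Definition access k : seq (letter d) := if k then descent c else ascent (q - c).
Definition offset k : int := if k then c%:Z else - (q - c)%N%:Z.
(** The lamps met on the way from the base point to [centre k]; with this choice of
conjugating permutations the two centres can be treated alike in [access_act]. *)
Definition twist k : {perm option W} := lamps pl c (offset k) (access k).

Local Notation step := (model_step pl c (q := q) twist).
Local Notation stepK := (model_stepK pl c (q := q) twist).
Local Notation act := (free_act step).

(** A point just outside the neighbourhood of [0], from which both centres are
reached by paths that keep away from the other one. *)
Definition base : V := c%:R.

Lemma base_centre k : base = centre q k + (offset k)%:~R.
Proof.
case: k; rewrite /base /centre /offset ?add0r //.
have cq' : (c <= q)%N by lia.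
by rewrite rmorphN /= -[_%:~R]/((q - c)%:R) natrB // opprB addrC subrK.
Qed.

Lemma access_act k t : word_act step (t, base) (access k) = (tree_act k (twist k) t, centre q k).
Proof.
(* Both paths stay at distance at least [c] from the other centre. *)
have [p0 r0] : pos (offset k) (access k) = 0 /\ (reach (offset k) (access k) + c <= q)%N.
  case: k; rewrite /offset /access.
    by have [-> ?] := descent_reach c; split=> //; lia.
  by have [-> ?] := ascent_reach (q - c); split=> //; lia.
rewrite (base_centre k) model_window // p0 addr0 -/(twist k).
by rewrite /conjg mulKg.
Qed.

(** Go to [centre k], read [g] there and come back: an element of the normal closure of
[g] that acts over the base point by [g] in the blocks of type [k] only. *)
Definition move k g : free_group d :=
  (of_word (access k) * g * (of_word (access k))^-1)%g.

Definition gperm g : {perm option W} := word_perm pl (word_of g).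

Lemma move_act k g t : drift g = 0 -> (spread g < c)%N ->
  act (t, base) (move k g) = (tree_act k (gperm g) t, base).
Proof.
move=> dg sg; apply: (can_inj (free_actK stepK (of_word (access k)))).
rewrite !(free_actM stepK) (free_actVK stepK) !(free_act_of_word stepK) !access_act.
have := @model_window d W pl c q q0 twist k (tree_act k (twist k) t) 0 (word_of g).
rewrite /free_act addr0 => ->; last by move: sg; rewrite /spread; lia.
rewrite -/(drift g) dg addr0 lamps_near // -/(gperm g) -!tree_actM.
by rewrite /conjg mulVKg.
Qed.

Lemma move_actV k g t : drift g = 0 -> (spread g < c)%N ->
  act (t, base) (move k g)^-1%g = (tree_act k (gperm g)^-1%g t, base).
Proof.
move=> dg sg; apply: (can_inj (free_actK stepK (move k g))).
by rewrite [LHS](free_actVK stepK) [RHS]move_act // -tree_actM mulVg tree_act1.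
Qed.

Lemma act_snd z g : (act z g).2 = word_act (@flip d V) z.2 (word_of g).
Proof. by rewrite /free_act; elim: (word_of g) z => //= x w IH z; rewrite IH. Qed.

Definition transport (x : V) : free_group d := of_word (ascent (val (base - x))).

Lemma transport_act t x : (act (t, x) (transport x)).2 = base.
Proof.
rewrite /transport (free_act_of_word stepK).
have -> w z : (word_act step z w).2 = word_act (@flip d V) z.2 w.
  by elim: w z => //= y w IH z; rewrite IH.
by rewrite flip_ascent natr_Zp addrC subrK.
Qed.

Section Doubling.
Variables (ga gb : free_group d) (u v : W).
Hypotheses (da : drift ga = 0) (db : drift gb = 0).
Hypotheses (sa : (spread ga < c)%N) (sb : (spread gb < c)%N).
Hypotheses (pa : gperm ga None = Some u) (pb : gperm gb None = Some v).
Hypothesis uv : u != v.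

(** Descends by two levels in the tree; the boolean chooses between two disjoint
subtrees. *)
Definition climb (r : bool) k := (move (~~ k) ga * move k (if r then gb else ga))%g.

Lemma climb_act r k s : act ((k, s), base) (climb r k) =
  ((k, (if r then v else u) :: u :: s), base).
Proof.
rewrite /climb (free_actM stepK) move_act //.
have := tree_act_push (~~ k) s pa; rewrite negbK => ->.
by case: r; rewrite move_act // ?(tree_act_push _ _ pa) ?(tree_act_push _ _ pb).
Qed.

Lemma climb_actX r k s n : act ((k, s), base) (climb r k ^+ n)%g =
  ((k, flatten (nseq n [:: if r then v else u; u]) ++ s), base).
Proof.
elim: n => [|n IH]; first by rewrite expg0.
by rewrite expgSr (free_actM stepK) IH climb_act.
Qed.

(** The conjugate of [climb] that acts at the position of [z]. *)
Definition branch r (z : tree_vertex W * V) : free_group d :=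
  (transport z.2 * climb r (act z (transport z.2)).1.1 * (transport z.2)^-1)%g.

Lemma conj_pow (G : groupType) (g h : G) n : ((g * h * g^-1) ^+ n = g * h ^+ n * g^-1)%g.
Proof.
elim: n => [|n IH]; first by rewrite !expg0 mulg1 mulgV.
by rewrite !expgS IH !mulgA mulgVK.
Qed.

Lemma branch_actX r z n : let y := act z (transport z.2) in
  act z (branch r z ^+ n)%g =
  act ((y.1.1, flatten (nseq n [:: if r then v else u; u]) ++ y.1.2), base)
    (transport z.2)^-1%g.
Proof.
move=> y; rewrite /branch conj_pow !(free_actM stepK) -/y; congr (free_act _ _ _).
have y2 : y.2 = base by rewrite /y; case: (z) => t x; apply: transport_act.
by case: y y2 => -[k s] x /= ->; rewrite climb_actX.
Qed.

Lemma branch_snd r z n : (act z (branch r z ^+ n)%g).2 = z.2.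
Proof.
rewrite branch_actX act_snd /= -[in RHS](free_actK stepK (transport z.2) z) act_snd.
by congr word_act; case: z => t x; rewrite transport_act.
Qed.

(** From the image, the second coordinate of [z] is read off first; conjugating
back, the head of the word gives the branch and the tail gives the vertex. *)
Lemma branch_inj r r' n z z' : (0 < n)%N ->
  act z (branch r z ^+ n)%g = act z' (branch r' z' ^+ n)%g -> r = r' /\ z = z'.
Proof.
move=> n0 e; have e2 : z.2 = z'.2 by rewrite -(branch_snd r z n) e branch_snd.
move: e; rewrite !branch_actX e2 => /(can_inj (free_actVK stepK (transport z'.2))).
case=> e1 es.
have rr : r = r'.
  move: n0 es; case: (n) => // m _ [].
  by case: r; case: r' => // eq; move: uv; rewrite eq eqxx.
split=> //; move: es; rewrite rr => /eqP; rewrite eqseq_cat // eqxx => /eqP e3.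
apply: (can_inj (free_actK stepK (transport z'.2))).
have p0 (y : tree_vertex W * V) : (act y (transport y.2)).2 = base.
  by case: y => t x; apply: transport_act.
move: e1 e3 (p0 z) (p0 z'); rewrite e2.
case: (act z _) => -[k s] x; case: (act z' _) => -[k' s'] x' /=.
by move=> -> -> -> ->.
Qed.

Lemma branch_doubling n : (0 < n)%N ->
  exists S : seq (free_group d), exists gam1 gam2 : tree_vertex W * V -> free_group d,
  [/\ forall x, gam1 x \in S /\ gam2 x \in S,
      injective (fun x => act x (gam1 x ^+ n)%g),
      injective (fun x => act x (gam2 x ^+ n)%g) &
      forall x y, act x (gam1 x ^+ n)%g <> act y (gam2 y ^+ n)%g].
Proof.
move=> n0; pose m (i : bool * bool * V) :=
  (transport i.2 * climb i.1.1 i.1.2 * (transport i.2)^-1)%g.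
exists (map m (enum {: bool * bool * V})), (branch true), (branch false); split.
- move=> x; have h r : branch r x \in map m (enum {: bool * bool * V}).
    by apply/mapP; exists (r, (act x (transport x.2)).1.1, x.2); rewrite ?mem_enum.
  by split.
- by move=> x y /(branch_inj n0)[].
- by move=> x y /(branch_inj n0)[].
- by move=> x y /(branch_inj n0)[].
Qed.

End Doubling.

Section Orbit.
Variables (ga gb : free_group d) (u v : W).
Hypotheses (da : drift ga = 0) (db : drift gb = 0).
Hypotheses (sa : (spread ga < c)%N) (sb : (spread gb < c)%N).
Hypotheses (pa : gperm ga None = Some u) (pb : gperm gb None = Some v).
Hypothesis uv : u != v.
Hypothesis pab : ((gperm ga)^-1 * gperm gb)%g None != None.

(** An element that pushes a vertex of type [false] two levels down, while its
inverse does the same with a vertex of type [true]: the orbit of the vertex [v] goes deeper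
and deeper in both directions, into two different subtrees. *)
Definition weave : free_group d := (move true ga * (move false ga)^-1 * move false gb)%g.

Lemma weave_step : exists w, forall s,
  act ((false, s), base) weave = ((false, w :: u :: s), base).
Proof.
case E: (((gperm ga)^-1 * gperm gb)%g None) pab => [w|//] _; exists w => s.
rewrite /weave (free_actM stepK _ (move true ga * _)%g) (free_actM stepK _ (move true ga)).
rewrite move_act // (tree_act_push true s pa).
by rewrite move_actV // move_act // -tree_actM (tree_act_push false _ E).
Qed.

Lemma perm_inv_None (p : {perm option W}) : p None != None -> exists w, p^-1%g None = Some w.
Proof.
case E: (p^-1%g None) => [w|]; first by exists w.
by move: (permKV p None); rewrite E => ->; rewrite eqxx.
Qed.

(** The inverse of [weave] first pops the letter [v], which leads to the
root, and from then on only pushes letters. *)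
Lemma weaveV_step : exists y w,
  act ((false, [:: v]), base) weave^-1%g = ((true, [:: y; u]), base) /\
  forall s, act ((true, y :: s), base) weave^-1%g = ((true, [:: y, w, y & s]), base).
Proof.
have [y py] : exists y, (gperm ga)^-1%g None = Some y by apply: perm_inv_None; rewrite pa.
have [w pw] := perm_inv_None pab; exists y, w.
have e s : act (s, base) weave^-1%g = (tree_act true (gperm ga)^-1%g
    (tree_act false ((gperm ga)^-1 * gperm gb)^-1%g s), base).
  rewrite /weave (invgM (_ * _)%g) (invgM (move true ga)) invgK.
  rewrite (free_actM stepK _ (move false gb)^-1%g).
  rewrite (free_actM stepK _ (move false ga)) move_actV // move_act // move_actV //.
  by rewrite invgM invgK tree_actM.
split=> [|s]; rewrite e.
  rewrite invgM invgK tree_actM [tree_act false (gperm gb)^-1%g _]/tree_act /= -{1}pb permK /=.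
  by rewrite (tree_act_push false _ pa) (tree_act_push true _ py).
by rewrite (tree_act_push false _ pw) (tree_act_push true _ py).
Qed.

(** The last letter of the word is the first edge from the root, so these are the
subtrees hanging at [v] from the two roots.  The default value [u] differs from [v] in the
uses below, so that the empty words are left out. *)
Definition end_in (z : tree_vertex W * V) : bool := last u z.1.2 == v.

Let origin : tree_vertex W * V := ((false, [:: v]), base).

Lemma weave_orbit : exists w, forall n,
  act origin (weave ^+ n)%g = ((false, flatten (nseq n [:: w; u]) ++ [:: v]), base).
Proof.
have [w hw] := weave_step; exists w; elim=> [|n IH]; first by rewrite expg0.
by rewrite expgSr (free_actM stepK) IH hw.
Qed.

Lemma weaveV_orbit : exists y w, forall n,
  act origin (weave^-1 ^+ n.+1)%g =
  ((true, y :: flatten (nseq n [:: w; y]) ++ [:: u]), base).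
Proof.
have [y [w [h0 hw]]] := weaveV_step; exists y, w; elim=> [|n IH]; first by rewrite expg1.
by rewrite expgSr (free_actM stepK) IH hw.
Qed.

Lemma weave_orbit_in n : end_in (act origin (weave ^+ n)%g).
Proof. by have [w ->] := weave_orbit; rewrite /end_in /= last_cat. Qed.

Lemma weave_orbit_out n : (0 < n)%N -> ~~ end_in (act origin (weave^-1 ^+ n)%g).
Proof.
case: n => // n _; have [y [w ->]] := weaveV_orbit.
by rewrite /end_in /= last_cat.
Qed.

Lemma size_blocks n (x y : W) : size (flatten (nseq n [:: x; y])) = n.*2.
Proof. by elim: n => //= n ->. Qed.

Lemma weave_orbit_inj : injective (fun n => act origin (weave ^+ n)%g).
Proof.
have [w h] := weave_orbit; move=> m n /=; rewrite !h => -[/(congr1 size)].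
by rewrite !size_cat !size_blocks => /addIn/double_inj.
Qed.

Lemma weaveV_orbit_inj : injective (fun n => act origin (weave^-1 ^+ n)%g).
Proof.
have [y [w h]] := weaveV_orbit; case=> [|m] [|n] //=; rewrite ?expg0 ?h ?free_act1 //.
by case=> /(congr1 size); rewrite !size_cat !size_blocks => /addIn/double_inj ->.
Qed.

End Orbit.

End ModelMoves.

(** A letter changes the membership of at most [size r] points, and a word is a
product of letters. *)
Lemma finite_boundary (R : realType) d (X : choiceType) (step : X -> letter d -> X)
    (stepK : forall x a, step (step x a) (inv_letter a) = x) (E : X -> bool) (r : seq X) :
  uniq r -> (forall x a, x \notin r -> E (step x a) = E x) -> forall g,
  (\tsum_x (`|(E (free_act step x g))%:R - (E x)%:R|)%:E <= ((size r * flen g)%:R)%:E :> \bar R)%E.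
Proof.
move=> ur Er g; rewrite /free_act /flen; elim: (word_of g) => [|a w IH].
  by rewrite tsum0 ?lee_fin // => x; rewrite subrr normr0.
have stepb : bijective (step^~ a).
  exists (step^~ (inv_letter a)) => x /=; first exact: stepK.
  by rewrite -{2}(inv_letterK a) stepK.
have one : (\tsum_x (`|(E (step x a))%:R - (E x)%:R|)%:E <= ((size r)%:R)%:E :> \bar R)%E.
  rewrite (tsum_finite ur); first last.
  - by move=> x xr; rewrite Er // subrr normr0.
  - by move=> x; rewrite lee_fin.
  rewrite sumEFin lee_fin -[size r]sum1_size natr_sum; apply: ler_sum => x _.
  by case: (E _); case: (E _); rewrite ?subrr ?normr0 ?subr0 ?sub0r ?normrN ?normr1.
rewrite -(tsum_bij _ stepb) in IH.
rewrite [size _]/= mulnS natrD EFinD; apply: le_trans (leeD one IH).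
rewrite -tsumD; first last.
- by move=> x; rewrite lee_fin.
- by move=> x; rewrite lee_fin.
apply: le_tsum => x; rewrite -EFinD lee_fin /= [leRHS]addrC.
by apply: le_trans (ler_normD _ _); rewrite addrA subrK.
Qed.

(** A block contains at most one level of children, so the last letter can only
change for words of length at most one. *)
Lemma tree_label_last d (W : finType) (pl : 'I_d -> {perm option W}) c q theta x a t (o : W) :
  (1 < size t.2)%N -> last o (@tree_label d W pl c q theta x a t).2 = last o t.2.
Proof.
case: t => k [|w [|w' s]] // _; rewrite /tree_label.
by case: ifP => _; [|case: ifP => _]; rewrite // tree_act_last.
Qed.

Lemma end_in_almost_invariant (R : realType) d (W : finType) (pl : 'I_d -> {perm option W})
    c q theta (u v : W) : exists B : nat, forall g,
  (\tsum_x (`|(end_in (q := q) u v (free_act (@model_step d W pl c q theta) x g))%:R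
     - (end_in u v x)%:R|)%:E <= ((B * flen g)%:R)%:E :> \bar R)%E.
Proof.
pose short : seq (seq W) := [::] :: [seq [:: w] | w <- enum W].
pose r : seq (tree_vertex W * 'Z_(2 * q)) :=
  undup [seq ((i.1, s), i.2) | i <- enum {: bool * 'Z_(2 * q)}, s <- short].
exists (size r); apply: (finite_boundary _ (model_stepK _ _ _)); first exact: undup_uniq.
move=> [[k s] x] a; rewrite mem_undup /end_in => h.
rewrite /= tree_label_last // ltnNge; apply: contra h => h.
apply/allpairsP; exists ((k, x), s); rewrite mem_enum; split=> //.
case: s h => [|w [|//]] _; rewrite /short inE //; apply/orP; right.
by apply/mapP; exists w; rewrite ?mem_enum.
Qed.

(** * Quotients of nearby entropy *)

Lemma gpermM d (W : finType) (pl : 'I_d -> {perm option W}) (g h : free_group d) :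
  gperm pl (g * h)%g = (gperm pl g * gperm pl h)%g.
Proof.
pose step (s : {perm option W}) (x : letter d) := (s * letter_perm pl x)%g.
have stepK s x : step (step s x) (inv_letter x) = s by rewrite /step letter_perm_inv mulgK.
have e w s : word_act step s w = (s * word_perm pl w)%g.
  elim: w s => [|x w IH] s; first by rewrite /word_perm big_nil mulg1.
  by rewrite [LHS]IH /word_perm big_cons mulgA.
have := free_actM stepK 1%g g h; rewrite /free_act !e !mul1g.
exact.
Qed.

Lemma gpermV d (W : finType) (pl : 'I_d -> {perm option W}) (g : free_group d) :
  gperm pl g^-1%g = (gperm pl g)^-1%g.
Proof.
apply: (mulgI (gperm pl g)); rewrite -gpermM !mulgV.
by rewrite /gperm /word_perm big_nil.
Qed.

Lemma mul_word_cat d (u v : seq (letter d)) : reduced (u ++ v) -> mul_word u v = u ++ v.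
Proof.
elim: u => //= x u IH r; rewrite IH; last exact: reduced_tail r.
exact: cons_red_cons.
Qed.

Lemma avoid_two_letters d (p z : letter d) : (2 <= d)%N ->
  exists2 x : letter d, p != x & z != x.
Proof.
move=> hd; pose i0 : 'I_d := Ordinal (ltnW hd); pose i1 : 'I_d := Ordinal hd.
case: p z => [p1 p2] [z1 z2].
have [->|n1] := eqVneq p1 i0; have [->|n2] := eqVneq z1 i0.
- by exists (i1, false); rewrite xpair_eqE negb_and -val_eqE.
- by exists (i0, ~~ p2); rewrite xpair_eqE negb_and ?n2 // eqxx; case: p2.
- by exists (i0, ~~ z2); rewrite xpair_eqE negb_and ?n1 // eqxx; case: z2.
- by exists (i0, false); rewrite xpair_eqE negb_and ?n1 ?n2.
Qed.

(** The conjugating element is the square [x * x] of a letter: it can be chosen so that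
no cancellation occurs, and a square acts trivially on positions. *)
Lemma conj_longer d (g : free_group d) : (2 <= d)%N -> g != 1%g ->
  exists h : free_group d, (forall y, pos y (word_of h) = y) /\
    flen (h * g * h^-1)%g = (flen g + 4)%N.
Proof.
move=> hd g1; have [h0 [w gE]] : exists h0 w, word_of g = h0 :: w.
  case E: (word_of g) => [|h0 w]; last by exists h0, w.
  by move: g1; rewrite (_ : g = 1%g) ?eqxx //; apply: val_inj.
have [x xh xl] : exists2 x : letter d, h0 != inv_letter x & inv_letter x != inv_letter (last h0 w).
  have [x] := avoid_two_letters (inv_letter h0) (last h0 w) hd.
  move=> h1 h2; exists x; first by apply: contra h1 => /eqP ->; rewrite inv_letterK.
  by rewrite (inj_eq (can_inj (@inv_letterK d))) eq_sym.
have xx : x != inv_letter x by rewrite /inv_letter; case: (x) => i [|]; rewrite xpair_eqE andbF.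
have xx' : inv_letter x != inv_letter (inv_letter x) by rewrite inv_letterK eq_sym.
have rx : reduced [:: x; x] by rewrite /reduced /= xx.
exists (FreeGroup rx); split=> [y|]; first by rewrite /pos /= flipK.
have rw := word_ofP g; rewrite gE in rw.
have r1 : reduced ([:: x; x] ++ word_of g ++ [:: inv_letter x; inv_letter x]).
  rewrite gE /reduced /= xx xh /= cat_path; apply/andP; split; first exact: rw.
  by rewrite /= xl xx'.
have r2 : reduced ([:: x; x] ++ word_of g).
  by rewrite gE /reduced /= xx xh.
have -> : flen (FreeGroup rx * g * (FreeGroup rx)^-1)%g =
    size (mul_word (mul_word [:: x; x] (word_of g)) [:: inv_letter x; inv_letter x]) by [].
by rewrite (mul_word_cat r2) mul_word_cat -?catA // !size_cat /= /flen; lia.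
Qed.

(** Commutators of [g] with an element acting trivially on positions have
zero drift.  Conjugating by elements that make the length grow ensures that the results
are nontrivial and distinct. *)
Lemma two_zero_drift_elements d (N : normal_subgroup (free_group d)) : (2 <= d)%N ->
  proper_quotient N -> exists ga gb, [/\ ns_set N ga, ns_set N gb, drift ga = 0, drift gb = 0 &
    [/\ ga != 1%g, gb != 1%g & ga != gb]].
Proof.
move=> hd pN; have [g Ng g1] : exists2 g, ns_set N g & g != 1%g.
  apply: contrapT => h; apply: pN; apply/seteqP; split=> [g Ng|g ->]; last exact: ns_one.
  by apply: contrapT => g1; apply: h; exists g => //; apply/eqP.
have Nconj h k : ns_set N k -> ns_set N (h * k * h^-1)%g.
  by move=> /(ns_conj h^-1%g); rewrite /conjg invgK mulgA.
have conj_pos (h k : free_group d) y : (forall z, pos z (word_of h) = z) ->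
    pos y (word_of (h * k * h^-1)%g) = pos y (word_of k).
  move=> hh; rewrite [LHS](pos_mul y (word_of (h * k)%g) (word_of h^-1%g)).
  rewrite (pos_mul y (word_of h)) hh -{1}(hh (pos y (word_of k))).
  exact: (free_actK (@flip_stepK d int) h (pos y (word_of k))).
have [h [hh hl]] := conj_longer hd g1.
(* If [ga] were trivial, [g] and its longer conjugate would be equal. *)
pose ga := (h * g * h^-1 * g^-1)%g.
have ga1 : ga != 1%g.
  apply/eqP => e; have : flen (h * g * h^-1)%g = flen g.
    by congr flen; apply: (mulIg g^-1%g); rewrite mulgV.
  by rewrite hl; lia.
have [k [kk kl]] := conj_longer hd ga1.
have Nga : ns_set N ga by apply: ns_mul; [exact: Nconj | exact: ns_inv].
have dga : drift ga = 0.
  rewrite /drift [LHS](pos_mul 0 (word_of (h * g * h^-1)%g) (word_of g^-1%g)) conj_pos //.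
  exact: (free_actK (@flip_stepK d int) g 0).
exists ga, (k * ga * k^-1)%g; split=> //; first exact: Nconj.
  by rewrite /drift conj_pos.
split=> //; last by apply/eqP => /(congr1 (@flen d)); rewrite kl; lia.
by apply/eqP => /(congr1 (@flen d)); rewrite kl /flen /=; lia.
Qed.

(** The elements of even length form a proper subgroup. *)
Lemma nondegenerate_odd (R : realType) d (mu : free_group d -> R) : (0 < d)%N ->
  nondegenerate_mass mu -> exists2 g, odd (flen g) & 0 < mu g.
Proof.
move=> d0 hnd; apply: contrapT => h.
have gen : smallest (@mul_closed _) (mass_support mu) (fg_gen (Ordinal d0)) by rewrite hnd.
suff : ~~ odd (flen (fg_gen (Ordinal d0))) by [].
apply: (gen [set g | ~~ odd (flen g)]); split=> [x y /= hx hy|g /= g0].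
  by rewrite odd_flenM (negbTE hx) (negbTE hy).
by apply/negP => og; apply: h; exists g.
Qed.

Section NearbyQuotient.
Variables (R : realType) (d : nat) (mu : free_group d -> R).
Hypotheses (hd : (2 <= d)%N) (hmu : probability_mass mu) (hnd : nondegenerate_mass mu).
Hypothesis hmom : finite_first_moment (range (@fg_gen d)) mu.
Let d0 : (0 < d)%N. Proof. exact: ltnW. Qed.
Let hent := first_moment_entropy hmu hmom d0.

Lemma model_entropy_small (W : finType) (pl : 'I_d -> {perm option W}) c
    (theta : nat -> bool -> {perm option W}) (eps : R) : 0 < eps ->
  \forall q \near \oo, (quotient_entropy mu (model_kernel pl c q (theta q)) < eps%:E)%E.
Proof.
move=> e0; have e4 : 0 < eps / 4 by rewrite divr_gt0.
have [n n0 hn] := lamplighter_entropy hmu hmom (nondegenerate_odd d0 hnd) pl c e4.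
have fin : (shannon_entropy (convolution_power mu n) < +oo)%E.
  by rewrite ltey_eq entropy_power_fin.
have eventually g : ns_set (lamp_kernel pl c) g ->
    \forall q \near \oo, ns_set (model_kernel pl c q (theta q)) g.
  move=> Kg; exists (2 * (flen g + c)).+1 => // q /= hq.
  by apply: lamp_kernel_sub => //; [lia | apply: ltnW].
have := qlaw_entropy_usc (power_pmass n hmu) fin e4 eventually.
apply: filterS => q hq; have [h [-> h0 hle _]] := quotient_entropyP hmu hent (model_kernel pl c q (theta q)).
rewrite lte_fin; apply: le_lt_trans (hle n n0) _.
have : ((qstep mu (model_kernel pl c q (theta q)) n)%:E <= (eps / 4 * n%:R + eps / 4)%:E)%E.
  rewrite (qstepE hmu hent) EFinD; apply: le_trans hq _; by rewrite leeD2r.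
(* The two halves of the bound for the entropy at time [n] are divided by [n >= 1]. *)
have n1 : 1 <= n%:R :> R by rewrite ler1n.
rewrite lee_fin => h1; rewrite ltr_pdivrMr ?ltr0n //.
by apply: le_lt_trans h1 _; nra.
Qed.

(** The permutations are chosen to separate the finitely many elements built from
[ga] and [gb], after which [q] is taken large. *)
Lemma nearby_kernel (N : normal_subgroup (free_group d)) (eps : R) : proper_quotient N ->
  0 < eps -> exists K : normal_subgroup (free_group d),
  (quotient_entropy mu N < quotient_entropy mu (ns_cap N K))%E /\
  (quotient_entropy mu K < eps%:E)%E.
Proof.
move=> pN e0; have [ga [gb [Na Nb da db [ga1 gb1 gab]]]] := two_zero_drift_elements hd pN.
pose n := (flen ga + flen gb + flen (ga^-1 * gb)%g + flen (ga * gb^-1)%g)%N.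
have [na nb nab nab'] : [/\ flen ga <= n, flen gb <= n, flen (ga^-1 * gb)%g <= n &
    flen (ga * gb^-1)%g <= n]%N by rewrite /n; split; lia.
have [W [pl sepw]] := separating_permutations d n.
have sep g : g != 1%g -> (flen g <= n)%N -> gperm pl g None != None.
  by move=> g1 gn; apply: sepw => //; apply: word_ofP.
pose c := n.+1.
pose a : letter d := (Ordinal d0, false); pose b : letter d := (Ordinal hd, false).
have a0 : val a.1 == 0%N by [].
have b0 : val b.1 != 0%N by [].
have sa : (spread ga < c)%N by apply: leq_ltn_trans (spread_le_flen _) _; rewrite ltnS.
have sb : (spread gb < c)%N by apply: leq_ltn_trans (spread_le_flen _) _; rewrite ltnS.
case pa : (gperm pl ga None) (sep ga ga1 na) => [u|//] _.
case pb : (gperm pl gb None) (sep gb gb1 nb) => [v|//] _.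
have uv : u != v.
  have : gperm pl (ga * gb^-1)%g None != None.
    apply: sep => //.
    by apply: contra gab => /eqP e; rewrite -[ga](mulgVK gb) e mul1g.
  apply: contra => /eqP e; rewrite gpermM gpermV permM pa e -pb permK //.
have pab : ((gperm pl ga)^-1 * gperm pl gb)%g None != None.
  rewrite -gpermV -gpermM; apply: sep => //.
  by apply: contra gab => /eqP e; rewrite -[gb](mulVKg ga) e mulg1.
have [q [small cq q0]] : exists q, [/\ (quotient_entropy mu (model_kernel pl c q
    (twist pl c q a b)) < eps%:E)%E, (2 * c <= q)%N & (0 < q)%N].
  have near1 := model_entropy_small pl c (fun q => twist pl c q a b) e0.
  have near2 : \forall q \near \oo, (2 * c <= q)%N by exact: nbhs_infty_ge.
  have [q _ hq] : \forall q \near \oo, (quotient_entropy mu (model_kernel pl c q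
      (twist pl c q a b)) < eps%:E)%E /\ (2 * c <= q)%N by near=> q; split; near: q.
  by exists q; have [] := hq q (leqnn q); split=> //; lia.
exists (model_kernel pl c q (twist pl c q a b)); split=> //.
have [B hB] := end_in_almost_invariant R pl c q (twist pl c q a b) u v.
pose L (g : free_group d) : R := B%:R * (flen g)%:R.
have L0 g : 0 <= L g by rewrite mulr_ge0.
have Lfin m : (expect (convolution_power mu m) (fun g => (L g)%:E) < +oo)%E.
  have -> : expect (convolution_power mu m) (fun g => (L g)%:E) =
      ((B%:R)%:E * first_moment (convolution_power mu m))%E.
    rewrite -expectZ //; first exact: (pmass_ge0 (power_pmass m hmu)).
  have := first_moment_power hmu hmom m.
  have f0 : (0 <= first_moment (convolution_power mu m))%E.
    by apply: expect_ge0 => //; apply: (pmass_ge0 (power_pmass m hmu)).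
  by rewrite -ge0_fin_numE // => ff; rewrite ltey_eq fin_numM.
have Nmove k g : ns_set N g -> ns_set N (move c q a b k g).
  by move=> /(ns_conj (of_word (access c q a b k))^-1%g); rewrite /conjg invgK mulgA.
pose act := free_act (model_step pl c (q := q) (twist pl c q a b)).
apply: (@entropy_gap R _ mu hmu hnd hent _ act _ _ (end_in (q := q) u v) L L0 Lfin _ _ _ N _
  (weave c q a b ga gb) ((false, [:: v]), base c q)).
- by [].
- exact: free_actM (model_stepK _ _ _).
- by move=> g; apply: le_trans (hB g) _; rewrite lee_fin natrM.
- by move=> m m0; exact: (branch_doubling a0 b0 q0 cq da db sa sb pa pb uv m0).
- by move=> g x; apply.
- apply: ns_mul; last exact: Nmove.
  by apply: ns_mul; [exact: Nmove | apply/ns_inv/Nmove].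
- by move=> m _; exact: (weave_orbit_in a0 b0 q0 cq v da db sa sb pa pab m).
- by move=> m m0; exact: (weave_orbit_out a0 b0 q0 cq da db sa sb pa pb uv pab m0).
- exact: (weave_orbit_inj a0 b0 q0 cq da db sa sb pa pab).
- exact: (weaveV_orbit_inj a0 b0 q0 cq da db sa sb pa pb pab).
Unshelve. all: by end_near.
Qed.

End NearbyQuotient.

(** * Density of the entropy spectrum *)

Lemma factors_through_sub (G : groupType) (M N : normal_subgroup G) :
  M `<=` N -> factors_through M N.
Proof.
move=> MN; pose f (x : quot_group M) : quot_group N := quotient_map N (quotient_repr x).
have fE x : f (quotient_map M x) = quotient_map N x.
  by apply: (quotient_map_sub MN); rewrite quotient_reprK.
have fM : {morph f : x y / (x * y)%g}.
  move=> x y; rewrite -[x]quotient_reprK -[y]quotient_reprK.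
  by rewrite -gmulfM !fE gmulfM.
pose fI := isMultiplicative.Build _ _ f fM.
by exists (HB.pack_for {multiplicative quot_group M -> quot_group N} f fI).
Qed.

Theorem theorem1p1 (R : realType) (d : nat) (mu : free_group d -> R)
  (hd : (2 <= d)%N)
  (hmu : probability_mass mu)
  (hnd : nondegenerate_mass mu)
  (hmom : finite_first_moment (range (@fg_gen d)) mu) :
  (forall N : normal_subgroup (free_group d), proper_quotient N ->
    forall eps : R, 0 < eps ->
    exists M : normal_subgroup (free_group d),
      factors_through M N /\
      (quotient_entropy mu N < quotient_entropy mu M)%E /\
      (quotient_entropy mu M < quotient_entropy mu N + eps%:E)%E) /\
  (forall N : normal_subgroup (free_group d),
      quotient_entropy mu N \is a fin_num) /\
  (forall x : R, isolated (entropy_spectrum mu) x ->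
      ubound (entropy_spectrum mu) x).
Proof.
have hent := first_moment_entropy hmu hmom (ltnW hd).
have fin N : quotient_entropy mu N \is a fin_num.
  by have [h [-> _ _ _]] := quotient_entropyP hmu hent N.
have close (N : normal_subgroup (free_group d)) : proper_quotient N ->
    forall eps : R, 0 < eps -> exists M : normal_subgroup (free_group d),
      factors_through M N /\ (quotient_entropy mu N < quotient_entropy mu M)%E /\
      (quotient_entropy mu M < quotient_entropy mu N + eps%:E)%E.
  move=> pN eps e0; have [K [gap small]] := nearby_kernel hd hmu hnd hmom pN e0.
  exists (ns_cap N K); split; first by apply: factors_through_sub => g [].
  split=> //; apply: le_lt_trans (quotient_entropy_cap hmu hent N K) _.
  by rewrite lteD2lE.
split=> //; split=> // x [/set_mem[N _ Nx] [V nV VA]] _ [M _ <-].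
have [N1|pN] := pselect (ns_set N = [set 1%g]).
  rewrite -Nx fine_le // quotient_entropy_sub // N1 => g ->; exact: ns_one.
have [e /= e0 eV] := nV.
have [K [_ [lo hi]]] := close N pN e e0.
have NE : quotient_entropy mu N = x%:E by rewrite -Nx fineK.
have : (V `&` entropy_spectrum mu) (fine (quotient_entropy mu K)).
  split; last by exists K.
  apply: eV => /=; rewrite -(fineK (fin K)) NE -EFinD !lte_fin in lo hi.
  by rewrite ltr_norml; apply/andP; split; lra.
rewrite VA => /= Kx; move: lo; rewrite -(fineK (fin K)) Kx NE ltxx //.
Qed.
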